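(* Let $\varphi\in\mathcal{G}L^\infty(\mathbb{R})$ and let $WH_\varphi=W_\varphi+H_\varphi:L^2_+(\mathbb{R})\to L^2(\mathbb{R}_+)$ be the Wiener-Hopf plus Hankel operator with Fourier symbol $\varphi$. Let $\mathcal{S}$ be the set of sectorial functions in $L^\infty(\mathbb{R})$. In (a) and (d) the implication holds for each of the two choices of sign $+$ and $-$ (the same sign being taken at all places). Then: (a) If $\varphi\widetilde{\varphi^{-1}}=sh$ with $s\in\mathcal{S}$ and $h\in\mathcal{G}H^\infty_\pm$, then $WH_\varphi$ is invertible. (b) If $\varphi\widetilde{\varphi^{-1}}=sh$ with $s\in\mathcal{S}$ and $h\in H^\infty_+$, then $WH_\varphi$ is left-invertible. (c) If $\varphi\widetilde{\varphi^{-1}}=sh$ with $s\in\mathcal{S}$ and $h\in H^\infty_-$, then $WH_\varphi$ is right-invertible. (d) If $\varphi\widetilde{\varphi^{-1}}=sh_1h_2$ with $s\in\mathcal{S}$, $h_1\in\mathcal{G}[C(\dot{\mathbb{R}})+H^\infty_\pm]$ and $h_2\in\mathcal{G}H^\infty_\pm$, then $WH_\varphi$ is Fredholm. (e) If $\varphi\widetilde{\varphi^{-1}}=sh_1h_2$ with $s\in\mathcal{S}$, $h_1\in C(\dot{\mathbb{R}})+H^\infty_+$ and $h_2\in\mathcal{G}H^\infty_+$, then $WH_\varphi$ is left-Fredholm. (f) If $\varphi\widetilde{\varphi^{-1}}=sh_1h_2$ with $s\in\mathcal{S}$, $h_1\in C(\dot{\mathbb{R}})+H^\infty_-$ and $h_2\in\mathcal{G}H^\infty_-$,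 then $WH_\varphi$ is right-Fredholm.
   Context: All function spaces are complex-valued. $\mathbb{R}_+=(0,+\infty)$; $L^2_+(\mathbb{R})$ is the subspace of $L^2(\mathbb{R})$ of functions supported in the closure of $\mathbb{R}_+$; $r_+:L^2(\mathbb{R})\to L^2(\mathbb{R}_+)$ is the restriction operator; $\mathcal{F}$ is the Fourier transformation, with the convention $\mathcal{F}f(x)=\int_{\mathbb{R}}e^{ixt}f(t)\,dt$ (up to normalization), so that Fourier transforms of functions in $L^2_+(\mathbb{R})$ extend analytically to the upper half-plane. $J$ is the reflection operator, $J\psi(x)=\widetilde{\psi}(x)=\psi(-x)$. For $\varphi\in L^\infty(\mathbb{R})$, $$W_\varphi=r_+\mathcal{F}^{-1}\varphi\cdot\mathcal{F}:L^2_+(\mathbb{R})\to L^2(\mathbb{R}_+),\quad H_\varphi=r_+\mathcal{F}^{-1}\varphi\cdot\mathcal{F}J:L^2_+(\mathbb{R})\to L^2(\mathbb{R}_+),\quad WH_\varphi=W_\varphi+H_\varphi,$$ where $\varphi\cdot$ denotes multiplication by $\varphi$. For invertible $\varphi$, $\varphi^{-1}=1/\varphi$ is the pointwise reciprocal, so $\widetilde{\varphi^{-1}}(x)=1/\varphi(-x)$. $H^\infty_\pm=H^\infty_\pm(\mathbb{R})$ is the set of functions in $L^\infty(\mathbb{R})$ that are non-tangential boundary limits of bounded analytic functions in $\mathbb{C}_\pm=\{z\in\mathbb{C}:\pm\operatorname{Im}z>0\}$. $C(\dot{\mathbb{R}})$ is the space of continuous functions on $\mathbb{R}$ whose limits at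 $+\infty$ and $-\infty$ exist and coincide; $C(\dot{\mathbb{R}})+H^\infty_\pm$ is the algebraic sum (a closed subalgebra of $L^\infty(\mathbb{R})$). For a Banach algebra $B$, $\mathcal{G}B$ is the group of invertible elements of $B$. A function $f\in L^\infty(\mathbb{R})$ is sectorial if there exist a real $\varepsilon>0$ and $c\in\mathbb{C}$ with $|c|=1$ such that $\operatorname{Re}(cf(x))\ge\varepsilon$ for almost every $x\in\mathbb{R}$. A bounded linear operator $T:X\to Y$ between Hilbert spaces is normally solvable if its image is closed. A normally solvable $T$ is left-Fredholm if $\dim\operatorname{Ker}T<\infty$, right-Fredholm if $\dim (Y/\operatorname{Im}T)<\infty$, and Fredholm if both are finite. $T$ is left-invertible (right-invertible) if it has a bounded left (right) inverse, and invertible if it has a bounded two-sided inverse. *)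

(* Defs.v *)
From HB Require Import structures.
From mathcomp Require Import all_boot all_order all_algebra.
From mathcomp Require Import complex.
From mathcomp Require Import all_classical all_reals all_analysis.
From mathcomp Require Import measurable_realfun ess_sup_inf.

Set Implicit Arguments.
Unset Strict Implicit.
Unset Printing Implicit Defensive.

Import Order.TTheory GRing.Theory Num.Theory.
Import numFieldNormedType.Exports.

Local Open Scope classical_set_scope.
Local Open Scope complex_scope.
Local Open Scope quotient_scope.
Local Open Scope ring_scope.

Local Notation cmod := (@ComplexField.Normc.normc _).

Section L2_space.
Context d (T : measurableType d) (R : realType).
Variable mu : {measure set T -> \bar R}.

Definition cmeasurable (f : T -> R[i]) : Prop :=
  measurable_fun setT (@complex.Re R \o f) /\ measurable_fun setT (@complex.Im R \o f).

Definition cLfun (p : \bar R) : set (T -> R[i]) :=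
  [set f | cmeasurable f /\ finite_norm mu p (cmod \o f)].

Local Notation sq_integrable := (cLfun 2%:E).

Definition L2_fun : Type := {f : T -> R[i] | `[< sq_integrable f >]}.

HB.instance Definition _ := gen_eqMixin L2_fun.
HB.instance Definition _ := gen_choiceMixin L2_fun.

Definition L2_ae (f g : L2_fun) : bool :=
  `[< {ae mu, forall x, sval f x = sval g x} >].

Let L2_ae_refl : reflexive L2_ae.
Proof. by move=> f; apply/asboolP; apply: aeW. Qed.

Let L2_ae_sym : symmetric L2_ae.
Proof.
by move=> f g; apply/idP/idP => /asboolP h; apply/asboolP; apply: filterS h.
Qed.

Let L2_ae_trans : transitive L2_ae.
Proof.
move=> g f h /asboolP fg /asboolP gh; apply/asboolP.
by apply: filterS2 fg gh => x -> ->.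
Qed.

Canonical L2_ae_equiv := EquivRel L2_ae L2_ae_refl L2_ae_sym L2_ae_trans.

Definition L2 : Type := {eq_quot L2_ae}.
HB.instance Definition _ := Choice.on L2.
HB.instance Definition _ := EqQuotient.on L2.

Definition L2_repr (u : L2) : T -> R[i] := sval (repr u).

Lemma L2_reprP u : sq_integrable (L2_repr u).
Proof. by rewrite /L2_repr; case: (repr u) => f /= /asboolP. Qed.

Lemma cmeasurable_cst c : cmeasurable (cst c).
Proof. by split; exact: measurable_cst. Qed.

Lemma cmeasurableD f g :
  cmeasurable f -> cmeasurable g -> cmeasurable (fun x => f x + g x).
Proof.
move=> [f1 f2] [g1 g2]; split.
  rewrite (_ : _ \o _ = (@complex.Re R \o f) \+ (@complex.Re R \o g)).
    exact: measurable_funD.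
  by apply/funext => x /=; case: (f x) (g x) => [a b] [].
rewrite (_ : _ \o _ = (@complex.Im R \o f) \+ (@complex.Im R \o g)).
  exact: measurable_funD.
by apply/funext => x /=; case: (f x) (g x) => [a b] [].
Qed.

Lemma cmeasurableM f g :
  cmeasurable f -> cmeasurable g -> cmeasurable (fun x => f x * g x).
Proof.
move=> [f1 f2] [g1 g2]; split.
  rewrite (_ : _ \o _ = ((@complex.Re R \o f) \* (@complex.Re R \o g)) \-
                        ((@complex.Im R \o f) \* (@complex.Im R \o g))).
    by apply: measurable_funB; exact: measurable_funM.
  by apply/funext => x /=; case: (f x) (g x) => [a b] [].
rewrite (_ : _ \o _ = ((@complex.Re R \o f) \* (@complex.Im R \o g)) \+
                      ((@complex.Im R \o f) \* (@complex.Re R \o g))).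
  by apply: measurable_funD; exact: measurable_funM.
by apply/funext => x /=; case: (f x) (g x) => [a b] [].
Qed.

Lemma measurable_cmod f : cmeasurable f -> measurable_fun setT (cmod \o f).
Proof.
move=> [f1 f2].
rewrite (_ : _ \o _ = @Num.sqrt R \o (((@complex.Re R \o f) \* (@complex.Re R \o f)) \+
                      ((@complex.Im R \o f) \* (@complex.Im R \o f)))); last first.
  by apply/funext => x /=; case: (f x) => a b; rewrite /= !expr2.
apply: measurableT_comp.
  by apply: continuous_measurable_fun; exact: sqrt_continuous.
by apply: measurable_funD; exact: measurable_funM.
Qed.


Let le12 : (1 <= 2%:E :> \bar R)%E.
Proof. by rewrite lee_fin ler1n. Qed.

Let Lfun_cmod f : sq_integrable f -> (cmod \o f) \in Lfun mu 2%:E.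
Proof.
by move=> [mf ff]; rewrite inE /=; apply/andP; split;
  rewrite inE //=; exact: measurable_cmod.
Qed.

Let cmod_ge0 (z : R[i]) : 0 <= cmod z.
Proof. by case: z => a b; exact: sqrtr_ge0. Qed.

Let le_cmodD (x y : R[i]) : cmod (x + y) <= cmod x + cmod y.
Proof. exact: (@le_normcD R x y). Qed.

Let Lnorm_le (f g : T -> R) : measurable_fun setT f -> measurable_fun setT g ->
  (forall x, 0 <= f x) -> (forall x, f x <= g x) ->
  ('N[mu]_2%:E[EFin \o f] <= 'N[mu]_2%:E[EFin \o g])%E.
Proof.
move=> mf mg f0 fg; rewrite unlock /=.
have g0 x : 0 <= g x by exact: le_trans (f0 x) (fg x).
apply: gt0_ler_poweR; rewrite ?in_itv /= ?andbT ?leey ?invr_ge0 ?ler0n //.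
1,2: by rewrite andbT; apply: integral_ge0 => x _; rewrite lee_fin powR_ge0.
apply: ge0_le_integral => //=.
- apply/measurable_EFinP.
  apply: (@measurableT_comp _ _ _ _ _ _ (@powR R ^~ 2)) => //.
  exact: measurableT_comp.
- apply/measurable_EFinP.
  apply: (@measurableT_comp _ _ _ _ _ _ (@powR R ^~ 2)) => //.
  exact: measurableT_comp.
- move=> x _; rewrite lee_fin ge0_ler_powR ?nnegrE ?ler0n//.
  by rewrite !ger0_norm.
Qed.

Let Lnorm_cmodD f g : sq_integrable f -> sq_integrable g ->
  ('N[mu]_2%:E[EFin \o (cmod \o (fun x => (f x + g x)%R))] <=
   'N[mu]_2%:E[EFin \o (cmod \o f)] + 'N[mu]_2%:E[EFin \o (cmod \o g)])%E.
Proof.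
move=> [mf _] [mg _].
have cf := measurable_cmod mf; have cg := measurable_cmod mg.
apply: le_trans (eminkowski mu cf cg le12).
apply: Lnorm_le => [|||x]; last exact: le_cmodD.
- by apply: measurable_cmod; exact: cmeasurableD.
- exact: measurable_funD.
- by move=> x; exact: cmod_ge0.
Qed.

Let Lnorm_cmodZ a f : sq_integrable f ->
  ('N[mu]_2%:E[EFin \o (cmod \o (fun x => (a * f x)%R))] =
   (cmod a)%:E * 'N[mu]_2%:E[EFin \o (cmod \o f)])%E.
Proof.
move=> /Lfun_cmod F.
have := LnormZ (Lfun_Sub le12 F) (cmod a).
rewrite ger0_norm ?cmod_ge0 // => <-.
apply: eq_Lnorm => x /=; congr (_%:E).
by rewrite ComplexField.Normc.normcM.
Qed.

Lemma sq_integrable0 : sq_integrable (fun=> 0).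
Proof.
split; first exact: cmeasurable_cst.
rewrite /finite_norm (_ : _ \o _ = cst 0%E) ?Lnorm0 // ?gt_eqF //.
by apply/funext => x; congr (_%:E); exact: ComplexField.Normc.normc0.
Qed.

Lemma sq_integrableD f g : sq_integrable f -> sq_integrable g ->
  sq_integrable (fun x => f x + g x).
Proof.
move=> If Ig; split; first by apply: cmeasurableD; [case: If|case: Ig].
apply: le_lt_trans (Lnorm_cmodD If Ig) _.
by rewrite lte_add_pinfty //; [case: If|case: Ig].
Qed.

Lemma sq_integrableZ a f : sq_integrable f -> sq_integrable (fun x => a * f x).
Proof.
move=> If; split.
  by apply: cmeasurableM; [exact: cmeasurable_cst|case: If].
by rewrite /finite_norm Lnorm_cmodZ // lte_mul_pinfty // ?lee_fin; case: If.
Qed.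

Definition L2_fun0 : L2_fun := exist _ (fun=> 0) (asboolT sq_integrable0).

(* The class of f, and the class of 0 if f is not in L^2. *)
Definition L2_of (f : T -> R[i]) : L2 := \pi_L2 (insubd L2_fun0 f : L2_fun).

Lemma L2_ofK f : sq_integrable f -> {ae mu, forall x, L2_repr (L2_of f) x = f x}.
Proof.
move=> If; rewrite /L2_repr /L2_of.
have vf : val (insubd L2_fun0 f) = f by apply: insubdK; exact/asboolP.
case: piP => g /eqmodP /asboolP; rewrite -[sval (insubd _ _)]/(val _) vf.
by apply: filterS.
Qed.

Lemma L2_ext u v : {ae mu, forall x, L2_repr u x = L2_repr v x} -> u = v.
Proof.
by move=> uv; rewrite -[u]reprK -[v]reprK; apply/eqmodP/asboolP.
Qed.

Definition L2_add u v := L2_of (fun x => L2_repr u x + L2_repr v x).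
Definition L2_scale a u := L2_of (fun x => a * L2_repr u x).
Definition L2_opp u := L2_scale (-1) u.
Definition L2_zero := L2_of (fun=> 0).

Let addE u v :
  {ae mu, forall x, L2_repr (L2_add u v) x = L2_repr u x + L2_repr v x}.
Proof. by apply: L2_ofK; apply: sq_integrableD; exact: L2_reprP. Qed.

Let scaleE a u : {ae mu, forall x, L2_repr (L2_scale a u) x = a * L2_repr u x}.
Proof. by apply: L2_ofK; apply: sq_integrableZ; exact: L2_reprP. Qed.

Let zeroE : {ae mu, forall x, L2_repr L2_zero x = 0}.
Proof. exact: L2_ofK sq_integrable0. Qed.

Fact L2_addA : associative L2_add.
Proof.
move=> u v w; apply: L2_ext.
near=> x; rewrite (near (addE u (L2_add v w)) x) // (near (addE v w) x) //.
by rewrite (near (addE (L2_add u v) w) x) // (near (addE u v) x) // addrA.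
Unshelve. all: by end_near. Qed.

Fact L2_addC : commutative L2_add.
Proof. by move=> u v; congr L2_of; apply/funext => x; rewrite addrC. Qed.

Fact L2_add0 : left_id L2_zero L2_add.
Proof.
move=> u; apply: L2_ext.
near=> x; rewrite (near (addE L2_zero u) x) // (near zeroE x) //.
by rewrite add0r.
Unshelve. all: by end_near. Qed.

Fact L2_addN : left_inverse L2_zero L2_opp L2_add.
Proof.
move=> u; apply: L2_ext.
near=> x; rewrite (near (addE (L2_opp u) u) x) // (near (scaleE (-1) u) x) //.
by rewrite (near zeroE x) // mulN1r addNr.
Unshelve. all: by end_near. Qed.

HB.instance Definition _ :=
  GRing.isZmodule.Build L2 L2_addA L2_addC L2_add0 L2_addN.

Fact L2_scaleA a b u : L2_scale a (L2_scale b u) = L2_scale (a * b) u.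
Proof.
apply: L2_ext.
near=> x; rewrite (near (scaleE a (L2_scale b u)) x) //.
by rewrite (near (scaleE b u) x) // (near (scaleE (a * b) u) x) // mulrA.
Unshelve. all: by end_near. Qed.

Fact L2_scale1 : left_id 1 L2_scale.
Proof.
move=> u; apply: L2_ext.
by near=> x; rewrite (near (scaleE 1 u) x) // mul1r.
Unshelve. all: by end_near. Qed.

Fact L2_scaleDr : right_distributive L2_scale +%R.
Proof.
move=> a u v; apply: L2_ext.
near=> x; rewrite (near (scaleE a (u + v)) x) // (near (addE u v) x) //.
rewrite (near (addE (L2_scale a u) (L2_scale a v)) x) //.
by rewrite (near (scaleE a u) x) // (near (scaleE a v) x) // mulrDr.
Unshelve. all: by end_near. Qed.

Fact L2_scaleDl u : {morph L2_scale^~ u : a b / a + b}.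
Proof.
move=> a b; apply: L2_ext.
near=> x; rewrite (near (scaleE (a + b) u) x) //.
rewrite (near (addE (L2_scale a u) (L2_scale b u)) x) //.
by rewrite (near (scaleE a u) x) // (near (scaleE b u) x) // mulrDl.
Unshelve. all: by end_near. Qed.

HB.instance Definition _ := GRing.Zmodule_isLmodule.Build R[i] L2
  L2_scaleA L2_scale1 L2_scaleDr L2_scaleDl.

Lemma L2_addE (u v : L2) :
  {ae mu, forall x, L2_repr (u + v) x = L2_repr u x + L2_repr v x}.
Proof. exact: addE. Qed.

Lemma L2_scaleE a (u : L2) :
  {ae mu, forall x, L2_repr (a *: u) x = a * L2_repr u x}.
Proof. exact: scaleE. Qed.

Lemma L2_zeroE : {ae mu, forall x, L2_repr (0 : L2) x = 0}.
Proof. exact: zeroE. Qed.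

Definition L2_vanishing (A : set T) : {pred L2} :=
  fun u => `[< {ae mu, forall x, A x -> L2_repr u x = 0} >].

Fact L2_vanishing_submod_closed A : submod_closed (L2_vanishing A).
Proof.
split; first by apply/asboolP; apply: filterS L2_zeroE => x + _.
move=> a u v /asboolP u0 /asboolP v0; apply/asboolP.
near=> x => Ax; rewrite (near (L2_addE (a *: u) v) x) //.
rewrite (near (L2_scaleE a u) x) // (near u0 x) // (near v0 x) //.
by rewrite mulr0 addr0.
Unshelve. all: by end_near. Qed.

HB.instance Definition _ A := GRing.isSubmodClosed.Build R[i] L2
  (L2_vanishing A) (L2_vanishing_submod_closed A).

(* The norm of a normedModType over R[i] takes its values in R[i]. *)
Definition L2_norm (u : L2) : R[i] :=
  (fine 'N[mu]_2%:E[EFin \o (cmod \o L2_repr u)])%:C.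

Let L2_normK (u : L2) : (fine 'N[mu]_2%:E[EFin \o (cmod \o L2_repr u)])%:E =
  'N[mu]_2%:E[EFin \o (cmod \o L2_repr u)]%E.
Proof.
rewrite fineK // fin_numElt (lt_le_trans ltNy0) ?Lnorm_ge0 //=.
by case: (L2_reprP u).
Qed.

Let ae_Lnorm f g : cmeasurable f -> cmeasurable g ->
  {ae mu, forall x, f x = g x} ->
  'N[mu]_2%:E[EFin \o (cmod \o f)]%E = 'N[mu]_2%:E[EFin \o (cmod \o g)]%E.
Proof.
move=> /measurable_cmod mf /measurable_cmod mg fg.
rewrite unlock /=; congr (_ `^ _)%E; apply: ae_eq_integral => //=.
- apply/measurable_EFinP.
  apply: (@measurableT_comp _ _ _ _ _ _ (@powR R ^~ 2)) => //.
  exact: measurableT_comp.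
- apply/measurable_EFinP.
  apply: (@measurableT_comp _ _ _ _ _ _ (@powR R ^~ 2)) => //.
  exact: measurableT_comp.
- by apply: filterS fg => x -> _.
Qed.

Fact ler_L2_normD u v : L2_norm (u + v) <= L2_norm u + L2_norm v.
Proof.
have [Iu Iv] := (L2_reprP u, L2_reprP v).
rewrite /L2_norm -rmorphD lecR -lee_fin [leRHS]EFinD !L2_normK.
apply: le_trans (Lnorm_cmodD Iu Iv).
rewrite le_eqVlt; apply/orP; left; apply/eqP/ae_Lnorm; last exact: L2_addE.
- by case: (L2_reprP (u + v)).
- by apply: cmeasurableD; [case: Iu|case: Iv].
Qed.

Fact L2_normZ a u : L2_norm (a *: u) = `|a| * L2_norm u.
Proof.
have Iu := L2_reprP u.
have -> : `|a| = (cmod a)%:C by rewrite normc_def; case: a.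
rewrite /L2_norm -rmorphM; congr (_%:C); apply: EFin_inj.
rewrite EFinM !L2_normK -Lnorm_cmodZ //.
apply: ae_Lnorm; last exact: L2_scaleE.
- by case: (L2_reprP (a *: u)).
- by apply: cmeasurableM; [exact: cmeasurable_cst|case: Iu].
Qed.

Fact L2_norm_eq0 u : L2_norm u = 0 -> u = 0.
Proof.
have [/measurable_cmod mcu _] := L2_reprP u.
rewrite /L2_norm => /eqP; rewrite eq_complex /= eqxx andbT => /eqP u0.
have := L2_normK u; rewrite u0 => /esym/Lnorm_eq0_eq0 h.
have /measurable_EFinP/h {}h := mcu; have {}h := h (lt_le_trans lte01 le12).
apply: L2_ext; apply: filterS2 h L2_zeroE => x /(_ I) [ux] ->.
exact: ComplexField.Normc.eq0_normc.
Qed.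

HB.instance Definition _ :=
  Lmodule_isNormed.Build R[i] L2 ler_L2_normD L2_normZ L2_norm_eq0.

End L2_space.

Section operators.
Context (K : numFieldType) (X Y : normedModType K).

Definition bounded_linear (T : X -> Y) : Prop :=
  linear T /\ exists M : K, forall x, `|T x| <= M * `|x|.

Definition normally_solvable (T : X -> Y) : Prop :=
  bounded_linear T /\ closed (range T).

Definition finite_dim_kernel (T : X -> Y) : Prop :=
  exists n (e : 'I_n -> X), (forall i, T (e i) = 0) /\
    forall x, T x = 0 -> exists c : 'I_n -> K, x = \sum_i c i *: e i.

(* The classes of the e i span Y / Im T. *)
Definition finite_dim_cokernel (T : X -> Y) : Prop :=
  exists n (e : 'I_n -> Y), forall y,
    exists (x : X) (c : 'I_n -> K), y = T x + \sum_i c i *: e i.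

Definition left_fredholm T := normally_solvable T /\ finite_dim_kernel T.

Definition right_fredholm T := normally_solvable T /\ finite_dim_cokernel T.

Definition fredholm T :=
  [/\ normally_solvable T, finite_dim_kernel T & finite_dim_cokernel T].

End operators.

Section invertibility.
Context (K : numFieldType) (X Y : normedModType K).

Definition left_invertible (T : X -> Y) : Prop :=
  bounded_linear T /\ exists S : Y -> X, bounded_linear S /\ cancel T S.

Definition right_invertible (T : X -> Y) : Prop :=
  bounded_linear T /\ exists S : Y -> X, bounded_linear S /\ cancel S T.

Definition invertible (T : X -> Y) : Prop :=
  bounded_linear T /\
  exists S : Y -> X, [/\ bounded_linear S, cancel T S & cancel S T].

End invertibility.

(* The half-planes Im z > 0 (upper, sign +) and Im z < 0 (lower, sign -). *)
Variant half_plane := upper | lower.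

Section symbols.
Context (R : realType).
Local Notation mu := (@lebesgue_measure R).
Implicit Types (f g : R -> R[i]) (B : set (R -> R[i])).

Definition eq_ae f g : Prop := {ae mu, forall x : R, f x = g x}.

Definition Linf : set (R -> R[i]) := cLfun mu +oo%E.

Definition units B : set (R -> R[i]) :=
  [set f | B f /\ exists2 g, B g & eq_ae (fun x => f x * g x) (fun=> 1)].

Definition sectorial : set (R -> R[i]) :=
  [set f | Linf f /\ exists (eps : R) (c : R[i]),
    [/\ 0 < eps, `|c| = 1 &
      {ae mu, forall x : R, eps <= complex.Re (c * f x)}]].

Definition in_half_plane (s : half_plane) : set R[i] :=
  match s with
  | upper => [set z | 0 < complex.Im z]
  | lower => [set z | complex.Im z < 0]
  end.

Definition cone (s : half_plane) (x a : R) : set R[i] :=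
  [set z | in_half_plane s z /\
           `|complex.Re z - x| < a * `|complex.Im z|].

(* R[i]^o is R[i] as a normed module over itself, so that derivability in the
   direction 1 is complex differentiability. *)
Definition Hinf (s : half_plane) : set (R -> R[i]) :=
  [set f | Linf f /\ exists F : R[i] -> R[i],
    [/\ forall z, in_half_plane s z -> derivable (F : R[i]^o -> R[i]^o) z 1,
        exists M : R[i], forall z, in_half_plane s z -> `|F z| <= M &
        {ae mu, forall x : R, forall a : R, 0 < a ->
          (F z : R[i]^o) @[z --> within (cone s x a) (nbhs (x%:C : R[i]^o))]
            --> (f x : R[i]^o)}]].

Definition Cdot : set (R -> R[i]) :=
  [set f | continuous (f : R -> R[i]^o) /\ exists l : R[i],
    ((f x : R[i]^o) @[x --> +oo] --> (l : R[i]^o)) /\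
    ((f x : R[i]^o) @[x --> -oo] --> (l : R[i]^o))].

(* Hinf s is stable under modification on null sets, hence so is this sum. *)
Definition CdotDHinf (s : half_plane) : set (R -> R[i]) :=
  [set f | exists c h, [/\ Cdot c, Hinf s h & f = (fun x => c x + h x)]].

(* The product of f and of the reflection x |-> (1 / f) (- x) of 1 / f. *)
Definition refl_quot f : R -> R[i] := fun x => f x * (f (- x))^-1.

End symbols.

Section Wiener_Hopf_plus_Hankel.
Context (R : realType).
Local Notation mu := (@lebesgue_measure R).

Definition L2R : Type := L2 mu.
HB.instance Definition _ := NormedModule.on L2R.

Definition Rplus : set (measurableTypeR R) := [set x : R | 0 < x].

Lemma measurable_Rplus : measurable Rplus.
Proof.
by rewrite (_ : Rplus = `]0, +oo[%classic);
  [exact: measurable_itv | apply/seteqP; split => x /=; rewrite in_itv /= andbT].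
Qed.

Definition L2Rplus : Type := L2 (mrestr mu measurable_Rplus).
HB.instance Definition _ := NormedModule.on L2Rplus.


(* L^2_+(R), with the norm of L^2(R). *)
Definition L2_plus : Type := {f : L2R | f \in L2_vanishing (mu := mu) [set x : R | x < 0]}.
HB.instance Definition _ := SubChoice.on L2_plus.
HB.instance Definition _ := [SubChoice_isSubLmodule of L2_plus by <:].

Definition L2_plus_norm (u : L2_plus) : R[i] := `|val u|.

Fact ler_L2_plus_normD u v :
  L2_plus_norm (u + v) <= L2_plus_norm u + L2_plus_norm v.
Proof. exact: ler_normD. Qed.

Fact L2_plus_normZ a u : L2_plus_norm (a *: u) = `|a| * L2_plus_norm u.
Proof. exact: normrZ. Qed.

Fact L2_plus_norm_eq0 u : L2_plus_norm u = 0 -> u = 0.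
Proof. by move=> /normr0_eq0 u0; exact: val_inj. Qed.

HB.instance Definition _ := Lmodule_isNormed.Build R[i] L2_plus
  ler_L2_plus_normD L2_plus_normZ L2_plus_norm_eq0.

Definition cintegral (D : set R) (f : R -> R[i]) : R[i] :=
  (\int[mu]_(x in D) complex.Re (f x)) +i* (\int[mu]_(x in D) complex.Im (f x)).

Definition expi (t : R) : R[i] := cos t +i* sin t.

(* Plancherel's definition: the limit in L^2(R) of the truncated integrals,
   which all belong to L^2(R). *)
Definition fourier (f : L2R) : L2R :=
  lim ((fun N : nat => L2_of mu (fun x =>
    cintegral `[- N%:R, N%:R] (fun t => expi (x * t) * L2_repr f t)) : L2R)
      @ \oo).

(* The inverse map of the bijection fourier. *)
Definition fourier_inv (g : L2R) : L2R := xget 0 [set f | fourier f = g].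

Definition mult (phi : R -> R[i]) (f : L2R) : L2R :=
  L2_of mu (fun x => phi x * L2_repr f x).

Definition reflection (f : L2R) : L2R := L2_of mu (fun x : R => L2_repr f (- x)).

Definition restriction (f : L2R) : L2Rplus := L2_of _ (L2_repr f).

Definition WienerHopf (phi : R -> R[i]) (f : L2_plus) : L2Rplus :=
  restriction (fourier_inv (mult phi (fourier (val f)))).

Definition Hankel (phi : R -> R[i]) (f : L2_plus) : L2Rplus :=
  restriction (fourier_inv (mult phi (fourier (reflection (val f))))).

Definition WH (phi : R -> R[i]) (f : L2_plus) : L2Rplus :=
  WienerHopf phi f + Hankel phi f.

End Wiener_Hopf_plus_Hankel.

(* Main.v *)
(** With P the projection of L^2(R) onto functions supported in the half-line,
    Q = 1 - P, J the reflection and M_f the Fourier multiplier with symbol f,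
    the operator acts as u |-> P M_phi (u + J u) on the range of P.  If
    Psi = phi(x) / phi(-x), then M_Psi J M_phi = M_phi J, and from this one
    obtains a one-sided inverse of the operator, exact or modulo limits of
    finite-rank operators, from one of the Toeplitz operator P M_Psi P.

    For Psi = s h, the operator P M_s P is invertible by a Neumann series,
    because |1 - a s| <= q < 1 for a suitable constant a when s is sectorial.
    For h in H^oo_+, Cauchy's theorem gives Q M_h P = 0, so that h can be
    inverted on one side; for h in H^oo_- one has P M_h Q = 0 by reflection.
    For continuous h with equal limits at both infinities, Q M_h P is a limit
    of finite-rank operators: it has rank at most one for 1 / (x - i), it
    vanishes for 1 / (x + i), and these two functions generate a dense
    subalgebra. *)

(* Since phi, 1 / phi and s are essentially bounded, 1 / h is bounded in every case. What decides
   the side of the inverse, for a given sign, is which of h and 1 / h lies in the Hardy algebra: the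
   Hankel term of that factor vanishes. Invertibility and the Fredholm property share one algebraic
   argument, carried out modulo an operator ideal, either zero or the limits of finite-rank
   operators. A Neumann series turns an error of the second kind into a finite-rank one, from which
   closed range and finite dimensions are read off.

   On the analytic side, identities between bounded operators are checked on the signed indicators
   chi a, whose span is dense. By scaling alone, their transforms hat a have the same Gram matrix up
   to a constant, which gives Plancherel's identity, and the pairing of hat a with chi b depends
   only on a b, which gives the adjoint. For h in H^oo_+ the matrix entries of Q M_h P are integrals
   of h against two transforms that each decay like 1 / |z|, so that Cauchy's theorem on growing
   squares shows that they vanish. *)
Require Import Defs.
From mathcomp Require Import all_boot all_order all_algebra.
From mathcomp Require Import complex.
From mathcomp Require Import all_classical all_reals all_analysis.
From mathcomp Require Import measurable_realfun ess_sup_inf.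
From mathcomp Require Import ring lra.

Set Implicit Arguments.
Unset Strict Implicit.
Unset Printing Implicit Defensive.

Import Order.TTheory GRing.Theory Num.Theory.
Import numFieldNormedType.Exports.

Local Open Scope classical_set_scope.
Local Open Scope complex_scope.
Local Open Scope ring_scope.

Local Notation cmod := (@ComplexField.Normc.normc _).
Local Notation "x ^*" := (@conjc _ x) : ring_scope.

(** * Complex-valued integrals and square-integrable functions *)

Section complex_modulus.
Context (R : realType).
Implicit Types z w : R[i].

Lemma cmod_ge0 z : 0 <= cmod z.
Proof. by case: z => a b; exact: sqrtr_ge0. Qed.

Lemma cmodM z w : cmod (z * w) = cmod z * cmod w.
Proof. exact: ComplexField.Normc.normcM. Qed.

Lemma cmod0 : cmod (0 : R[i]) = 0.
Proof. exact: ComplexField.Normc.normc0. Qed.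

Lemma cmod1 : cmod (1 : R[i]) = 1.
Proof. exact: ComplexField.Normc.normc1. Qed.

Lemma cmod_eq0 z : cmod z = 0 -> z = 0.
Proof. exact: ComplexField.Normc.eq0_normc. Qed.

Lemma cmodV z : cmod z^-1 = (cmod z)^-1.
Proof. exact: ComplexField.Normc.normcV. Qed.

Lemma cmodD z w : cmod (z + w) <= cmod z + cmod w.
Proof. exact: (@le_normcD R z w). Qed.

Lemma cmodN z : cmod (- z) = cmod z.
Proof. exact: (@normcN R z). Qed.

Lemma cmodB z w : cmod (z - w) <= cmod z + cmod w.
Proof. by rewrite -[cmod w]cmodN; exact: cmodD. Qed.

Lemma cmodC z w : cmod (z - w) = cmod (w - z).
Proof. by rewrite -cmodN opprB. Qed.

Lemma cmod_gt0 z : z != 0 -> 0 < cmod z.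
Proof.
move=> z0; rewrite lt_def cmod_ge0 andbT.
by apply: contra z0 => /eqP /cmod_eq0 ->.
Qed.

Lemma cmod_sqr z : cmod z ^+ 2 = complex.Re z ^+ 2 + complex.Im z ^+ 2.
Proof. by case: z => a b; rewrite sqr_sqrtr // addr_ge0 ?sqr_ge0. Qed.

Lemma normcE_cmod z : `|z| = (cmod z)%:C.
Proof. by rewrite normc_def; case: z. Qed.

Lemma cmod_real (x : R) : cmod x%:C = `|x|.
Proof. by rewrite /= expr0n /= addr0 sqrtr_sqr. Qed.

Lemma cmod_conj z : cmod z^* = cmod z.
Proof. by case: z => a b /=; rewrite sqrrN. Qed.

Lemma Re_le_cmod z : `|complex.Re z| <= cmod z.
Proof.
rewrite -(@ler_pXn2r _ 2) ?nnegrE ?cmod_ge0 //.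
by rewrite real_normK ?num_real // cmod_sqr lerDl sqr_ge0.
Qed.

Lemma Im_le_cmod z : `|complex.Im z| <= cmod z.
Proof.
rewrite -(@ler_pXn2r _ 2) ?nnegrE ?cmod_ge0 //.
by rewrite real_normK ?num_real // cmod_sqr lerDr sqr_ge0.
Qed.

Lemma cmod_le_ReIm z : cmod z <= `|complex.Re z| + `|complex.Im z|.
Proof.
rewrite -(@ler_pXn2r _ 2) ?nnegrE ?cmod_ge0 ?addr_ge0 //.
by rewrite cmod_sqr sqrrD !real_normK ?num_real // lerD2r lerDl mulrn_wge0 // mulr_ge0.
Qed.

Lemma mul_conj z : z * z^* = (cmod z ^+ 2)%:C.
Proof.
rewrite cmod_sqr; case: z => a b; apply/eqP; rewrite eq_complex /=.
by apply/andP; split; apply/eqP; ring.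
Qed.

Lemma ReD z w : complex.Re (z + w) = complex.Re z + complex.Re w.
Proof. by case: z w => [a b] []. Qed.
Lemma ImD z w : complex.Im (z + w) = complex.Im z + complex.Im w.
Proof. by case: z w => [a b] []. Qed.
Lemma ReM z w : complex.Re (z * w) =
  complex.Re z * complex.Re w - complex.Im z * complex.Im w.
Proof. by case: z w => [a b] []. Qed.
Lemma ImM z w : complex.Im (z * w) =
  complex.Re z * complex.Im w + complex.Im z * complex.Re w.
Proof. by case: z w => [a b] []. Qed.
Lemma ReN z : complex.Re (- z) = - complex.Re z.
Proof. by case: z. Qed.
Lemma ImN z : complex.Im (- z) = - complex.Im z.
Proof. by case: z. Qed.
Lemma Re_conj z : complex.Re z^* = complex.Re z.
Proof. by case: z. Qed.
Lemma Im_conj z : complex.Im z^* = - complex.Im z.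
Proof. by case: z. Qed.

Lemma ReZ (r : R) z : complex.Re (r%:C * z) = r * complex.Re z.
Proof. by rewrite ReM /= mul0r subr0. Qed.

Lemma complexP z w : complex.Re z = complex.Re w ->
  complex.Im z = complex.Im w -> z = w.
Proof. by case: z w => [a b] [c e] /= -> ->. Qed.

Lemma conjM z w : (z * w)^* = z^* * w^*.
Proof. exact: (rmorphM (@conjc R)). Qed.
Lemma conjD z w : (z + w)^* = z^* + w^*.
Proof. exact: (rmorphD (@conjc R)). Qed.
Lemma conjN z : (- z)^* = - z^*.
Proof. exact: (rmorphN (@conjc R)). Qed.

Lemma lecr (x y : R) : (x%:C <= y%:C) = (x <= y).
Proof. by rewrite lecE /= eqxx. Qed.

End complex_modulus.

Section complex_integral.
Context d (T : measurableType d) (R : realType).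
Variable mu : {measure set T -> \bar R}.
Implicit Types f g : T -> R[i].

Definition cint f : R[i] :=
  (\int[mu]_x complex.Re (f x)) +i* (\int[mu]_x complex.Im (f x)).

Definition cintble f : Prop :=
  cmeasurable f /\ mu.-integrable setT (EFin \o (cmod \o f)).

Lemma cintble_Re f : cintble f -> mu.-integrable setT (EFin \o (fun x => complex.Re (f x))).
Proof.
move=> [[m1 m2] i]; apply: le_integrable i => //; first exact/measurable_EFinP.
by move=> x _ /=; rewrite lee_fin (ger0_norm (cmod_ge0 _)) Re_le_cmod.
Qed.

Lemma cintble_Im f : cintble f -> mu.-integrable setT (EFin \o (fun x => complex.Im (f x))).
Proof.
move=> [[m1 m2] i]; apply: le_integrable i => //; first exact/measurable_EFinP.
by move=> x _ /=; rewrite lee_fin (ger0_norm (cmod_ge0 _)) Im_le_cmod.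
Qed.

Lemma cintble_le f (g : T -> R) : cmeasurable f ->
  mu.-integrable setT (EFin \o g) -> (forall x, cmod (f x) <= g x) -> cintble f.
Proof.
move=> mf ig fg; split => //; apply: le_integrable ig => //.
  by apply/measurable_EFinP; exact: measurable_cmod.
by move=> x _ /=; rewrite lee_fin (ger0_norm (cmod_ge0 _)) (le_trans (fg x)) ?ler_norm.
Qed.

Lemma cintbleZ a f : cintble f -> cintble (fun x => a * f x).
Proof.
move=> [mf i_f].
apply: (@cintble_le _ (fun x => cmod a * cmod (f x))).
- by apply: cmeasurableM => //; exact: cmeasurable_cst.
- exact: (integrableZl measurableT (cmod a) i_f).
- by move=> x; rewrite cmodM.
Qed.

Lemma eq_cint f g : f =1 g -> cint f = cint g.
Proof. by move=> /funext ->. Qed.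

Lemma cintD f g : cintble f -> cintble g ->
  cint (fun x => f x + g x) = cint f + cint g.
Proof.
move=> i_f ig; apply: complexP; rewrite /= ?(ReD, ImD) /=.
  rewrite -RintegralD //; [|exact: cintble_Re|exact: cintble_Re].
  by congr fine; apply: eq_integral => x _; rewrite ReD.
rewrite -RintegralD //; [|exact: cintble_Im|exact: cintble_Im].
by congr fine; apply: eq_integral => x _; rewrite ImD.
Qed.

Lemma cintZ a f : cintble f -> cint (fun x => a * f x) = a * cint f.
Proof.
move=> i_f; have iR := cintble_Re i_f; have iI := cintble_Im i_f.
have ZR r : \int[mu]_x (r * complex.Re (f x)) = r * \int[mu]_x complex.Re (f x).
  exact: RintegralZl.
have ZI r : \int[mu]_x (r * complex.Im (f x)) = r * \int[mu]_x complex.Im (f x).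
  exact: RintegralZl.
have iZR r : mu.-integrable setT (EFin \o (fun x => r * complex.Re (f x))).
  exact: (integrableZl measurableT r iR).
have iZI r : mu.-integrable setT (EFin \o (fun x => r * complex.Im (f x))).
  exact: (integrableZl measurableT r iI).
apply: complexP; rewrite ?(ReM, ImM) /=.
  rewrite -ZR -ZI -RintegralB //.
  by congr fine; apply: eq_integral => x _; rewrite ReM.
rewrite -ZR -ZI -RintegralD //.
by congr fine; apply: eq_integral => x _; rewrite ImM.
Qed.

Lemma cint_conj f : cintble f -> cint (fun x => (f x)^*) = (cint f)^*.
Proof.
move=> i_f; apply: complexP; rewrite ?(Re_conj, Im_conj) /=.
  by congr fine; apply: eq_integral => x _; rewrite Re_conj.
rewrite -mulN1r -RintegralZl //; last exact: cintble_Im.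
by congr fine; apply: eq_integral => x _; rewrite Im_conj mulN1r.
Qed.

Lemma cmeasurable_conj f : cmeasurable f -> cmeasurable (fun x => (f x)^*).
Proof.
move=> [m1 m2]; split.
  by rewrite (_ : _ \o _ = @complex.Re R \o f) //; apply/funext => x /=; rewrite Re_conj.
rewrite (_ : _ \o _ = \- (@complex.Im R \o f)); first exact: measurable_funN.
by apply/funext => x /=; rewrite Im_conj.
Qed.

Lemma cmeasurableB f g : cmeasurable f -> cmeasurable g ->
  cmeasurable (fun x => f x - g x).
Proof.
move=> mf mg; rewrite (_ : (fun x => _) = (fun x => f x + -1 * g x)).
  by apply: cmeasurableD => //; apply: cmeasurableM => //; exact: cmeasurable_cst.
by apply/funext => x; rewrite mulN1r.
Qed.

Lemma cint_ae f g : cmeasurable f -> cmeasurable g ->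
  {ae mu, forall x, f x = g x} -> cint f = cint g.
Proof.
move=> [f1 f2] [g1 g2] fg; congr (_ +i* _); congr fine; apply: ae_eq_integral => //.
- exact/measurable_EFinP.
- exact/measurable_EFinP.
- by apply: filterS fg => x + _ => ->.
- exact/measurable_EFinP.
- exact/measurable_EFinP.
- by apply: filterS fg => x + _ => ->.
Qed.

(** Multiplication by a unimodular [u] rotates the integral onto the positive real axis, where it
    equals the integral of Re (u f), and Re (u f) <= |f|. *)
Lemma cmod_cint f : cintble f -> cmod (cint f) <= \int[mu]_x cmod (f x).
Proof.
move=> i_f; have [->|z0] := eqVneq (cint f) 0.
  by rewrite cmod0; apply: Rintegral_ge0 => x _; exact: cmod_ge0.
set z := cint f in z0 *; have zp := cmod_gt0 z0.
pose u := (cmod z)^-1%:C * z^*.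
have -> : cmod z = complex.Re (cint (fun x => u * f x)).
  rewrite cintZ // -/z /u -mulrA (mulrC _ z) mul_conj ReZ /=.
  by rewrite expr2 mulKf // gt_eqF.
have u1 : cmod u = 1.
  by rewrite cmodM cmod_real cmod_conj ger0_norm ?invr_ge0 ?cmod_ge0 // mulVf // gt_eqF.
apply: le_Rintegral => //.
- by apply: cintble_Re; exact: cintbleZ.
- by case: i_f.
- move=> x _; apply: le_trans (ler_norm _) _; apply: le_trans (Re_le_cmod _) _.
  by rewrite cmodM u1 mul1r.
Qed.

End complex_integral.

(** * Real-valued norms and convergence in normed modules over the complex numbers *)

Section real_norm.
Context (R : realType) (V : normedModType R[i]).
Implicit Types u v : V.

(** A norm over [R[i]] takes its values in [R[i]]; its real part determines it ([nrmE]) and puts all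
    estimates in the ordered field [R]. *)
Definition nrm v : R := complex.Re `|v|.

Lemma nrmE v : `|v| = (nrm v)%:C.
Proof.
have /ger0_Im := normr_ge0 v; rewrite /nrm => h.
by apply: complexP => //=.
Qed.

Lemma nrm_ge0 v : 0 <= nrm v.
Proof. by have := normr_ge0 v; rewrite nrmE -[0]/(0%:C) lecr. Qed.

Lemma nrmD u v : nrm (u + v) <= nrm u + nrm v.
Proof. by rewrite -lecr rmorphD /= -!nrmE ler_normD. Qed.

Lemma nrmZ a v : nrm (a *: v) = cmod a * nrm v.
Proof. by rewrite /nrm normrZ normcE_cmod ReZ. Qed.

Lemma nrmN v : nrm (- v) = nrm v.
Proof. by rewrite /nrm normrN. Qed.

Lemma nrmB u v : nrm (u - v) <= nrm u + nrm v.
Proof. by rewrite -[nrm v]nrmN; exact: nrmD. Qed.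

Lemma nrmC u v : nrm (u - v) = nrm (v - u).
Proof. by rewrite -nrmN opprB. Qed.

Lemma nrm0 : nrm 0 = 0.
Proof. by rewrite /nrm normr0. Qed.

Lemma nrm_eq0 v : nrm v = 0 -> v = 0.
Proof. by move=> v0; apply: normr0_eq0; rewrite nrmE v0. Qed.

Lemma nrm_tri u v w : nrm (u - w) <= nrm (u - v) + nrm (v - w).
Proof. by have := nrmD (u - v) (v - w); rewrite addrA subrK. Qed.

Lemma nrm_subr u v : nrm u <= nrm v + nrm (u - v).
Proof. by have := nrmD v (u - v); rewrite addrC subrK. Qed.

Definition tends (u : nat -> V) (l : V) : Prop :=
  forall e, 0 < e -> exists N, forall n, (N <= n)%N -> nrm (u n - l) <= e.

Lemma nrm_small v : (forall e, 0 < e -> nrm v <= e) -> v = 0.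
Proof.
move=> h; apply: nrm_eq0; apply/eqP; rewrite eq_le nrm_ge0 andbT.
by apply/ler_addgt0Pr => e e0; rewrite add0r h.
Qed.

Lemma tends_unique (u : nat -> V) l m : tends u l -> tends u m -> l = m.
Proof.
move=> ul um; apply/eqP; rewrite -subr_eq0; apply/eqP; apply: nrm_small => e e0.
have e2 : 0 < e / 2 by rewrite divr_gt0.
have [N hN] := ul _ e2; have [M hM] := um _ e2.
apply: le_trans (nrm_tri _ (u (N + M)%N) _) _.
by rewrite [leRHS]splitr lerD // ?(nrmC l) ?hN ?hM ?leq_addr ?leq_addl.
Qed.

(** The link to the topological [lim] by which [fourier] is defined; otherwise convergence of
    vectors is handled in the epsilon form [tends]. *)
Lemma tends_lim (u : nat -> V) l : tends u l -> lim (u @ \oo) = l.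
Proof.
move=> h; apply: norm_cvg_lim; apply/cvgrPdist_le => /= e.
case: e => e e' e0.
have /andP[/eqP /= ->] := e0; rewrite /= => {}e0.
have [N hN] := h _ e0; exists N => // n /= Nn.
by rewrite nrmE lecr nrmC hN.
Qed.

End real_norm.

(* A form of completeness that asks only for limits of fast Cauchy sequences. *)
Definition fast_complete (R : realType) (V : normedModType R[i]) : Prop :=
  forall u : nat -> V, (forall n, nrm (u n.+1 - u n) <= 4^-1 ^+ n.+1) ->
  exists l, forall n, nrm (u n - l) <= 2 * 4^-1 ^+ n.

Section square_integrable.
Context d (T : measurableType d) (R : realType).
Variable mu : {measure set T -> \bar R}.
Implicit Types f g : T -> R[i].
Local Notation sqi := (cLfun mu 2%:E).

(** The squared L^2 norm in the extended reals, where Fatou's lemma and monotonicity apply before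
    finiteness is known. *)
Definition sint f : \bar R := (\int[mu]_x (cmod (f x) ^+ 2)%:E)%E.

Lemma sint_ge0 f : (0 <= sint f)%E.
Proof. by apply: integral_ge0 => x _; rewrite lee_fin sqr_ge0. Qed.

Lemma measurable_cmod2 f : cmeasurable f ->
  measurable_fun setT (EFin \o (fun x => cmod (f x) ^+ 2)).
Proof.
move=> mf; apply/measurable_EFinP; apply: measurable_funX; exact: measurable_cmod.
Qed.

Lemma Lnorm_sint f : ('N[mu]_2%:E[EFin \o (cmod \o f)] = sint f `^ 2^-1)%E.
Proof.
rewrite unlock /= /sint; congr (_ `^ _)%E; apply: eq_integral => x _ /=.
by rewrite ger0_norm ?cmod_ge0 // powR_mulrn ?cmod_ge0.
Qed.

Lemma sqiP f : sqi f <-> cmeasurable f /\ (sint f < +oo)%E.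
Proof.
split=> -[mf h]; split => //; last first.
  by rewrite /finite_norm Lnorm_sint poweR_lty.
by move: h; rewrite /finite_norm Lnorm_sint; exact: lty_poweRy.
Qed.

Lemma sqi_integrable f : sqi f ->
  mu.-integrable setT (EFin \o (fun x => cmod (f x) ^+ 2)).
Proof.
move=> /sqiP[mf h]; apply/integrableP; split; first exact: measurable_cmod2.
apply: le_lt_trans h; rewrite le_eqVlt; apply/orP; left; apply/eqP.
by apply: eq_integral => x _ /=; rewrite ger0_norm ?sqr_ge0.
Qed.

Lemma sint_ae f g : cmeasurable f -> cmeasurable g ->
  {ae mu, forall x, f x = g x} -> sint f = sint g.
Proof.
move=> mf mg fg; apply: ae_eq_integral => //.
- exact: measurable_cmod2.
- exact: measurable_cmod2.
- by apply: filterS fg => x + _ => ->.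
Qed.

Lemma sint_le f g : cmeasurable f -> cmeasurable g ->
  (forall x, cmod (f x) <= cmod (g x)) -> (sint f <= sint g)%E.
Proof.
move=> mf mg fg; apply: ge0_le_integral => //.
- by move=> x _; rewrite lee_fin sqr_ge0.
- exact: measurable_cmod2.
- exact: measurable_cmod2.
- by move=> x _; rewrite lee_fin ler_pXn2r ?nnegrE ?cmod_ge0.
Qed.

Lemma nrm_sint (u : L2 mu) : ((nrm u) ^+ 2)%:E = sint (L2_repr u).
Proof.
have [mu' h] := (sqiP _).1 (L2_reprP u).
have fu : sint (L2_repr u) \is a fin_num by rewrite ge0_fin_numE // sint_ge0.
have -> : nrm u = fine (sint (L2_repr u) `^ 2^-1)%E by rewrite -Lnorm_sint.
rewrite -[in LHS](fineK fu) /= powR12_sqrt ?fine_ge0 ?sint_ge0 //.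
by rewrite sqr_sqrtr ?fine_ge0 ?sint_ge0 // fineK.
Qed.

Lemma nrm_Rint (u : L2 mu) : nrm u ^+ 2 = \int[mu]_x (cmod (L2_repr u x) ^+ 2).
Proof. by rewrite -[LHS]/(fine (nrm u ^+ 2)%:E) nrm_sint. Qed.

Lemma nrm_L2_of f : sqi f -> ((nrm (L2_of mu f)) ^+ 2)%:E = sint f.
Proof.
move=> hf; rewrite nrm_sint; apply: sint_ae; last exact: L2_ofK.
  by case: (L2_reprP (L2_of mu f)).
by case: hf.
Qed.

Lemma L2_of_ae f g : sqi f -> sqi g -> {ae mu, forall x, f x = g x} ->
  L2_of mu f = L2_of mu g.
Proof.
move=> hf hg fg; apply: L2_ext.
by apply: filterS3 fg (L2_ofK hf) (L2_ofK hg) => x -> -> ->.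
Qed.

Lemma nrm_L2_le (u : L2 mu) c : 0 <= c -> (sint (L2_repr u) <= (c ^+ 2)%:E)%E -> nrm u <= c.
Proof.
by move=> c0; rewrite -nrm_sint lee_fin ler_pXn2r // ?nnegrE ?nrm_ge0.
Qed.

Lemma cmeasurable_repr (u : L2 mu) : cmeasurable (L2_repr u).
Proof. by case: (L2_reprP u). Qed.

(** The product is dominated by |f|^2 + |g|^2. *)
Lemma sqi_mul f g : sqi f -> sqi g -> cintble mu (fun x => f x * (g x)^*).
Proof.
move=> hf hg; have [mf _] := hf; have [mg _] := hg.
apply: (@cintble_le _ _ _ mu _ (fun x => cmod (f x) ^+ 2 + cmod (g x) ^+ 2)).
- by apply: cmeasurableM => //; exact: cmeasurable_conj.
- have := integrableD measurableT (sqi_integrable hf) (sqi_integrable hg).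
  by apply: eq_integrable => // x _ /=; rewrite EFinD.
- move=> x; rewrite cmodM cmod_conj.
  have := sqr_ge0 (cmod (f x) - cmod (g x)).
  by have := cmod_ge0 (f x); have := cmod_ge0 (g x); nra.
Qed.

End square_integrable.

(** * Fatou's lemma for squared L^2 norms, and geometric Cauchy sequences *)

Section fatou.
Context d (T : measurableType d) (R : realType).
Variable mu : {measure set T -> \bar R}.

Lemma cvg_dist0 (a : nat -> R) l :
  a n @[n --> \oo] --> l -> `|a n - l| @[n --> \oo] --> (0 : R).
Proof.
move=> h; apply/cvgrPdist_le => e e0.
have /cvgrPdist_le /(_ e e0) := h; apply: filterS => n /=.
by rewrite sub0r normrN normr_id distrC.
Qed.

Lemma cmod_tends (z : nat -> R[i]) w : cmod (z n - w) @[n --> \oo] --> (0 : R) ->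
  cmod (z n) @[n --> \oo] --> cmod w.
Proof.
move=> h; apply/cvgrPdist_le => e e0.
have /cvgrPdist_le /(_ e e0) := h; apply: filterS => n /=.
rewrite sub0r normrN ger0_norm ?cmod_ge0 // => hn; apply: le_trans hn.
rewrite ler_norml; apply/andP; split.
  have := cmodD (z n - w) w; rewrite subrK; lra.
have := cmodD (w - z n) (z n); rewrite subrK cmodC; lra.
Qed.

Lemma fatou_sint (g : nat -> T -> R[i]) f (C : R) :
  (forall n, cmeasurable (g n)) -> cmeasurable f ->
  {ae mu, forall x, cmod (g n x - f x) @[n --> \oo] --> (0 : R)} ->
  (\forall n \near \oo, sint mu (g n) <= C%:E)%E -> (sint mu f <= C%:E)%E.
Proof.
move=> mg mf gf [N _ hN].
(* Shifting the index by [N] makes the bound [C], which holds only eventually, hold for every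
   term. *)
pose h n x := ((cmod (g (n + N)%N x)) ^+ 2)%:E : \bar R.
have := @fatou _ _ _ mu setT measurableT h.
have mh n : measurable_fun setT (h n) by exact: measurable_cmod2.
move=> /(_ mh); have h0 n x : (0 <= h n x)%E by rewrite lee_fin sqr_ge0.
move=> /(_ (fun n x _ => h0 n x)) fat.
have -> : sint mu f = (\int[mu]_x limn_einf (h^~ x))%E.
  apply: ae_eq_integral => //; first exact: measurable_cmod2.
    rewrite /limn_einf; apply: measurableT_comp => //.
    apply: (measurable_fun_limn_esup (f := fun n x => (- h n x)%E)) => n.
    exact: measurableT_comp.
  apply: filterS gf => x /cmod_tends hx _.
  have /cvg_limn_einf_sup [-> _] // : h n x @[n --> \oo] --> ((cmod (f x)) ^+ 2)%:E.
  apply: cvg_EFin; first exact: nearW.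
  have hx' : (cmod (g (n + N)%N x)) @[n --> \oo] --> cmod (f x).
    by move: hx; rewrite -(cvg_shiftn N).
  rewrite expr2 (_ : _ \o _ = fun n => cmod (g (n + N)%N x) * cmod (g (n + N)%N x)).
    exact: (cvgM (f := fun n => cmod (g (n + N)%N x)) hx').

  by apply/funext => n /=; rewrite expr2.
apply: le_trans fat _.
apply: le_trans (limn_einf_sup _) _.
rewrite limn_esup_lim; apply: lime_le; first exact: is_cvg_esups.
apply: nearW => n; apply: ge_ereal_sup => _ [k _ <-].
exact: (hN (k + N)%N (leq_addl _ _)).
Qed.

Lemma geometric_cauchy (a : nat -> R) (C : R) :
  (forall n, `|a n.+1 - a n| <= C * 2^-1 ^+ n) -> cvgn a.
Proof.
move=> h; pose b n := a n.+1 - a n.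
have cs : cvgn (series b).
  apply: normed_cvg; apply: (@series_le_cvg _ _ (geometric C 2^-1)) => [n|n|n|].
  - exact: normr_ge0.
  - exact: le_trans (normr_ge0 _) (h n).
  - exact: h.
  - by apply: is_cvg_geometric_series; rewrite ger0_norm ?invf_lt1 ?ltr1n.
have E : a = (fun n => a 0%N + series b n).
  apply/funext => n; rewrite /series /= telescope_sumr //.
  by rewrite addrC subrK.
by rewrite E; apply: is_cvgD => //; exact: is_cvg_cst.
Qed.

End fatou.

Section L2_completeness.
Context d (T : measurableType d) (R : realType).
Variable mu : {measure set T -> \bar R}.

Lemma L2_subE (u v : L2 mu) :
  {ae mu, forall x, L2_repr (u - v) x = L2_repr u x - L2_repr v x}.
Proof.
rewrite -[- v]scaleN1r.
apply: filterS2 (L2_addE u (-1 *: v)) (L2_scaleE (-1) v) => x -> ->.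
by rewrite mulN1r.
Qed.

Lemma geometric_cauchy_nrm (V : normedModType R[i]) (u : nat -> V) :
  (forall n, nrm (u n.+1 - u n) <= 4^-1 ^+ n.+1) ->
  forall n k, nrm (u n - u (n + k)%N) <= 4^-1 ^+ n.
Proof.
move=> h n k.
suff : nrm (u n - u (n + k)%N) <= 4^-1 ^+ n - 4^-1 ^+ (n + k).
  by move=> /le_trans; apply; rewrite gerBl exprn_ge0.
elim: k => [|k IH]; first by rewrite addn0 !subrr nrm0.
apply: le_trans (nrm_tri _ (u (n + k)%N) _) _.
have := h (n + k)%N; rewrite addnS nrmC !exprS.
by have : 0 <= 4^-1 ^+ (n + k) :> R by []; lra.
Qed.

(** Riesz-Fischer. The squared increments are at most 16^-(n+1), so the weights 4^n still leave a
    summable series and S is finite almost everywhere. Where S x is finite, the increments at x are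
    at most sqrt (S x) 2^-n, hence the sequence converges there; Fatou's lemma turns this into
    convergence in norm. *)
Lemma L2_complete : fast_complete (L2 mu).
Proof.
move=> u hu; pose D n := L2_repr (u n.+1 - u n).
pose S x := (\sum_(0 <= n <oo) (4 ^+ n * cmod (D n x) ^+ 2)%:E)%E.
have mD n : measurable_fun setT (fun x => (4 ^+ n * cmod (D n x) ^+ 2)%:E : \bar R).
  apply/measurable_EFinP; apply: measurable_funM => //.
  by apply: measurable_funX; apply: measurable_cmod; exact: cmeasurable_repr.
have D0 n x : (0 <= (4 ^+ n * cmod (D n x) ^+ 2)%:E :> \bar R)%E.
  by rewrite lee_fin mulr_ge0 ?exprn_ge0 ?cmod_ge0 ?ler0n.
have S0 x : (0 <= S x)%E by apply: nneseries_ge0 => n _ _.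
have iS : mu.-integrable setT S.
  apply/integrableP; split; first exact: ge0_emeasurable_sum.
  rewrite (eq_integral S) => [|x _]; last by rewrite gee0_abs.
  rewrite integral_nneseries //.
  apply: (@le_lt_trans _ _ (\sum_(0 <= n <oo) (1 / (2 ^ (n + 1))%:R)%:E)%E); last first.
    by have /cvg_lim := @cvg_geometric_eseries_half R 1 0; rewrite /eseries /= => -> //; rewrite ltry.
  apply: lee_nneseries => [n _ _|n _]; first by apply: integral_ge0 => x _; exact: D0.
  under eq_integral do rewrite EFinM.
  rewrite ge0_integralZl //; last 2 first.
    by apply: measurable_cmod2; exact: cmeasurable_repr.
    by move=> x _; rewrite lee_fin sqr_ge0.
  rewrite -[(\int[mu]_x _)%E]/(sint mu (D n)) -nrm_sint -EFinM lee_fin.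
  have h : nrm (u n.+1 - u n) ^+ 2 <= (4^-1 ^+ n.+1) ^+ 2.
    by rewrite ler_pXn2r // ?nnegrE ?nrm_ge0 ?exprn_ge0.
  apply: le_trans (ler_wpM2l (exprn_ge0 _ _) h) _ => //.
  have r0 : 0 <= 2^-1 ^+ n :> R by rewrite exprn_ge0 ?invr_ge0 ?ler0n.
  have r1 : 2^-1 ^+ n <= 1 :> R by rewrite exprn_ile1 ?invr_ge0 ?ler0n ?invf_le1 ?ler1n.
  have qE : 4^-1 ^+ n = (2^-1 ^+ n) ^+ 2 :> R.
    by rewrite -exprM mulnC exprM; congr (_ ^+ _); field.
  have q1 : 4 ^+ n * 4^-1 ^+ n = 1 :> R by rewrite -exprMn divff ?expr1n // pnatr_eq0.
  rewrite div1r natrX -exprVn addn1 !exprS exprMn.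
  rewrite !expr0 !mulr1.
  have -> : 4 ^+ n * (4^-1 * 4^-1 ^+ n * (4^-1 * 4^-1 ^+ n)) = 16^-1 * (4^-1 ^+ n) * (4 ^+ n * 4^-1 ^+ n) :> R.
    by field.
  by rewrite q1 qE; nra.
have ae1 : {ae mu, forall x, forall n, D n x = L2_repr (u n.+1) x - L2_repr (u n) x}.
  by apply: ae_foralln => n; exact: L2_subE.
have key : {ae mu, forall x, exists C : R, forall n,
    cmod (L2_repr (u n.+1) x - L2_repr (u n) x) <= C * 2^-1 ^+ n}.
  apply: filterS2 ae1 (integrable_ae measurableT iS) => x Dx /(_ I) fS.
  exists (Num.sqrt (fine (S x))) => n; rewrite -Dx.
  rewrite -(@ler_pXn2r _ 2) ?nnegrE ?cmod_ge0 ?mulr_ge0 ?sqrtr_ge0 ?exprn_ge0 //.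
  rewrite exprMn sqr_sqrtr ?fine_ge0 // -exprM mulnC exprM.
  have : ((4 ^+ n * cmod (D n x) ^+ 2)%:E <= S x)%E.
    rewrite /S; apply: le_trans (nneseries_lim_ge (m := 0) n.+1 _) => [|k _ _]; last exact: D0.
    by rewrite big_nat_recr //= leeDr // sume_ge0.
  rewrite -[S x]fineK // lee_fin => h.
  rewrite -ler_pdivrMr ?exprn_gt0 ?exprn_gt0 // -exprVn -exprVn invrK mulrC.
  by rewrite (_ : 2 ^+ 2 = 4) //; ring.
have cv (p : R[i] -> R) : (forall z w, p (z - w) = p z - p w) -> (forall z, `|p z| <= cmod z) ->
    {ae mu, forall x, cvgn (fun n => p (L2_repr (u n) x))}.
  move=> pB pl; apply: filterS key => x [C hC].
  by apply: (@geometric_cauchy _ _ C) => n; rewrite -pB; exact: le_trans (pl _) _.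
have cR := cv (@complex.Re R) (fun z w => ltac:(by rewrite ReD ReN)) (@Re_le_cmod R).
have cI := cv (@complex.Im R) (fun z w => ltac:(by rewrite ImD ImN)) (@Im_le_cmod R).
(* The limit is taken as a limit superior, which is measurable on the whole space; it is the true
   limit wherever the sequence converges. *)
pose L (p : R[i] -> R) x := fine (limn_esup (fun n => (p (L2_repr (u n) x))%:E)).
pose f x := L (@complex.Re R) x +i* L (@complex.Im R) x.
have mf : cmeasurable f.
  split.
    apply: (measurableT_comp (fine_measurable measurableT)).
    apply: measurable_fun_limn_esup => n; apply/measurable_EFinP.
    by case: (cmeasurable_repr (u n)).
  apply: (measurableT_comp (fine_measurable measurableT)).
  apply: measurable_fun_limn_esup => n; apply/measurable_EFinP.
  by case: (cmeasurable_repr (u n)).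
have LE p x : cvgn (fun n => p (L2_repr (u n) x)) ->
   p (L2_repr (u n) x) @[n --> \oo] --> L p x.
  move=> c; rewrite /L.
  have /cvg_limn_einf_sup [_ ->] : ((p (L2_repr (u n) x))%:E @[n --> \oo] -->
      (limn (fun n => p (L2_repr (u n) x)))%:E) by apply: cvg_EFin => //; exact: nearW.
  exact: c.
have uf : {ae mu, forall x, cmod (L2_repr (u n) x - f x) @[n --> \oo] --> (0 : R)}.
  apply: filterS2 cR cI => x /LE lR /LE lI.
  apply: (@squeeze_cvgr _ _ _ _ (cst 0) (fun n => `|complex.Re (L2_repr (u n) x) - L (@complex.Re R) x| +
      `|complex.Im (L2_repr (u n) x) - L (@complex.Im R) x|)).
  - apply: nearW => n; rewrite cmod_ge0 /=; apply: le_trans (cmod_le_ReIm _) _.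
    by rewrite !(ReD, ImD, ReN, ImN).
  - exact: cvg_cst.
  - by rewrite -[0]addr0; apply: cvgD; exact: cvg_dist0.
have sub n : (sint mu (fun x => L2_repr (u n) x - f x)%R <= ((4^-1 ^+ n) ^+ 2)%:E)%E.
  apply: (@fatou_sint _ _ _ mu (fun k x => L2_repr (u n) x - L2_repr (u k) x)).
  - by move=> k; apply: cmeasurableB; exact: cmeasurable_repr.
  - by apply: cmeasurableB => //; exact: cmeasurable_repr.
  - apply: filterS uf => x; apply: cvg_trans.
    apply: near_eq_cvg; apply: nearW => k /=.
    by rewrite cmodC; congr cmod; ring.
  - exists n => // k /= nk; rewrite -(subnKC nk).
    rewrite (_ : sint _ _ = (nrm (u n - u (n + (k - n))%N) ^+ 2)%:E).
      rewrite lee_fin ler_pXn2r ?nnegrE ?nrm_ge0 ?exprn_ge0 ?invr_ge0 ?ler0n //.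
      exact: geometric_cauchy_nrm.
    rewrite nrm_sint; apply: sint_ae; [|exact: cmeasurable_repr|].
      by apply: cmeasurableB; exact: cmeasurable_repr.
    by apply: filterS (L2_subE (u n) (u (n + (k - n))%N)) => x ->.
have sf : cLfun mu 2%:E f.
  have s0 : cLfun mu 2%:E (fun x => L2_repr (u 0%N) x - f x).
    apply/sqiP; split; first by apply: cmeasurableB => //; exact: cmeasurable_repr.
    by apply: le_lt_trans (sub 0%N) _; rewrite ltry.
  rewrite (_ : f = (fun x => L2_repr (u 0%N) x + -1 * (L2_repr (u 0%N) x - f x))).
    by apply: sq_integrableD; [exact: L2_reprP|exact: sq_integrableZ].
  by apply/funext => x; rewrite mulN1r opprB addrC subrK.
exists (L2_of mu f) => n.
apply: (@le_trans _ _ (4^-1 ^+ n)).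
  apply: nrm_L2_le; first by rewrite exprn_ge0.
  apply: le_trans (sub n); rewrite le_eqVlt; apply/orP; left; apply/eqP.
  apply: sint_ae; [exact: cmeasurable_repr| |].
    by apply: cmeasurableB => //; exact: cmeasurable_repr.
  by apply: filterS2 (L2_subE (u n) (L2_of mu f)) (L2_ofK sf) => x -> ->.
by rewrite ler_peMl ?ler1n // exprn_ge0.
Qed.

End L2_completeness.

Section L2_inner_product.
Context d (T : measurableType d) (R : realType).
Variable mu : {measure set T -> \bar R}.
Implicit Types u v w : L2 mu.

Definition dot u v : R[i] := cint mu (fun x => L2_repr u x * (L2_repr v x)^*).

Lemma dot_cintble u v : cintble mu (fun x => L2_repr u x * (L2_repr v x)^*).
Proof. by apply: sqi_mul; exact: L2_reprP. Qed.

Lemma dot_ae f g u v : cmeasurable f -> cmeasurable g ->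
  {ae mu, forall x, L2_repr u x = f x} -> {ae mu, forall x, L2_repr v x = g x} ->
  dot u v = cint mu (fun x => f x * (g x)^*).
Proof.
move=> mf mg uf vg; apply: cint_ae.
- by case: (dot_cintble u v).
- by apply: cmeasurableM => //; exact: cmeasurable_conj.
- by apply: filterS2 uf vg => x -> ->.
Qed.

Lemma dotDl u v w : dot (u + v) w = dot u w + dot v w.
Proof.
rewrite /dot -cintD; [|exact: dot_cintble|exact: dot_cintble].
apply: cint_ae; [by case: (dot_cintble (u + v) w)| |].
  by apply: cmeasurableD; [case: (dot_cintble u w)|case: (dot_cintble v w)].
by apply: filterS (L2_addE u v) => x ->; rewrite mulrDl.
Qed.

Lemma dotZl a u v : dot (a *: u) v = a * dot u v.
Proof.
rewrite /dot -cintZ; last exact: dot_cintble.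
apply: cint_ae; [by case: (dot_cintble (a *: u) v)| |].
  apply: cmeasurableM; first exact: cmeasurable_cst.
  by case: (dot_cintble u v).
by apply: filterS (L2_scaleE a u) => x ->; rewrite mulrA.
Qed.

Lemma dotC u v : dot u v = (dot v u)^*.
Proof.
rewrite /dot -cint_conj; last exact: dot_cintble.
by apply: eq_cint => x; rewrite conjM conjcK mulrC.
Qed.

Lemma dot_nrm u : dot u u = (nrm u ^+ 2)%:C.
Proof.
rewrite nrm_Rint; apply: complexP => /=.
  by congr fine; apply: eq_integral => x _; rewrite mul_conj.
rewrite (_ : (fun x => _) = cst 0) ?Rintegral_cst ?mul0r //.
by apply/funext => x; rewrite mul_conj.
Qed.

End L2_inner_product.

(** * Inner product spaces *)

Section inner_product_space.
Context (R : realType) (V : normedModType R[i]).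

Record inner_product (dt : V -> V -> R[i]) : Prop := InnerProduct {
  ipDl : forall u v w, dt (u + v) w = dt u w + dt v w;
  ipZl : forall a u v, dt (a *: u) v = a * dt u v;
  ipC : forall u v, dt u v = (dt v u)^*;
  ip_nrm : forall u, dt u u = (nrm u ^+ 2)%:C }.

Variable dt : V -> V -> R[i].
Hypothesis ip : inner_product dt.

Lemma ipDr u v w : dt u (v + w) = dt u v + dt u w.
Proof. by rewrite (ipC ip) (ipDl ip) conjD -!(ipC ip). Qed.

Lemma ipZr a u v : dt u (a *: v) = a^* * dt u v.
Proof. by rewrite (ipC ip) (ipZl ip) conjM -(ipC ip). Qed.

Lemma ipNl u v : dt (- u) v = - dt u v.
Proof. by rewrite -scaleN1r (ipZl ip) mulN1r. Qed.

Lemma ipNr u v : dt u (- v) = - dt u v.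
Proof. by rewrite (ipC ip) ipNl conjN -(ipC ip). Qed.

Lemma ipBl u v w : dt (u - v) w = dt u w - dt v w.
Proof. by rewrite (ipDl ip) ipNl. Qed.

Lemma ipBr u v w : dt u (v - w) = dt u v - dt u w.
Proof. by rewrite ipDr ipNr. Qed.

Lemma ip0l v : dt 0 v = 0.
Proof. by rewrite -(scale0r 0) (ipZl ip) mul0r. Qed.

Lemma ip0r v : dt v 0 = 0.
Proof. by rewrite (ipC ip) ip0l conjc0. Qed.

Lemma nrm_sqrD u v : nrm (u + v) ^+ 2 =
  nrm u ^+ 2 + nrm v ^+ 2 + 2 * complex.Re (dt u v).
Proof.
rewrite -[LHS]/(complex.Re (nrm (u + v) ^+ 2)%:C) -(ip_nrm ip).
rewrite (ipDl ip) !ipDr !ReD !(ip_nrm ip) (ipC ip v u) Re_conj /=.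
by ring.
Qed.

Lemma nrm_sqrB u v : nrm (u - v) ^+ 2 =
  nrm u ^+ 2 + nrm v ^+ 2 - 2 * complex.Re (dt u v).
Proof. by rewrite nrm_sqrD ipNr ReN nrmN mulrN. Qed.

Lemma parallelogram (u v : V) :
  nrm (u + v) ^+ 2 + nrm (u - v) ^+ 2 = 2 * nrm u ^+ 2 + 2 * nrm v ^+ 2.
Proof. by rewrite nrm_sqrB nrm_sqrD; ring. Qed.

(** Pythagoras for the component of u orthogonal to v. It gives the Cauchy-Schwarz inequality and,
    in [total_dense], the orthogonality of the minimizer. *)
Lemma nrm_sqr_proj u v : v != 0 ->
  nrm (u - (dt u v / (nrm v ^+ 2)%:C) *: v) ^+ 2 =
  nrm u ^+ 2 - cmod (dt u v) ^+ 2 / nrm v ^+ 2.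
Proof.
move=> v0; have nv : nrm v != 0 by apply: contra v0 => /eqP /nrm_eq0 ->.
have nv2 : nrm v ^+ 2 != 0 by rewrite expf_eq0.
rewrite nrm_sqrB nrmZ exprMn cmodM cmodV cmod_real ger0_norm ?sqr_ge0 //.
set z := dt u v; set n := nrm v ^+ 2 in nv2 *.
rewrite ipZr -/z conjM -[n%:C^-1](fmorphV (real_complex R)) conjc_real [X in complex.Re X]mulrAC.
rewrite [X in complex.Re (X * _)]mulrC mul_conj ReZ /=.
by field.
Qed.

Lemma cauchy_schwarz u v : cmod (dt u v) <= nrm u * nrm v.
Proof.
have [->|v0] := eqVneq v 0; first by rewrite ip0r cmod0 mulr_ge0 ?nrm_ge0.
have nv : nrm v != 0 by apply: contra v0 => /eqP /nrm_eq0 ->.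
have nv2 : 0 < nrm v ^+ 2 by rewrite exprn_gt0 // lt_def nv nrm_ge0.
have := sqr_ge0 (nrm (u - (dt u v / (nrm v ^+ 2)%:C) *: v)).
rewrite nrm_sqr_proj // subr_ge0 ler_pdivrMr // -exprMn.
by rewrite ler_pXn2r // nnegrE ?cmod_ge0 // mulr_ge0 ?nrm_ge0.
Qed.

Lemma geo_small (C e : R) : 0 < e -> exists n, C * 4^-1 ^+ n <= e.
Proof.
move=> e0.
have /cvgrPdist_le /(_ e e0) [N _ hN] : geometric C 4^-1 n @[n --> \oo] --> (0 : R).
  by apply: cvg_geometric; rewrite ger0_norm ?invf_lt1 ?ltr1n.
exists N; have := hN N (leqnn N); rewrite /= sub0r normrN.
exact: le_trans (ler_norm _).
Qed.

(* A subspace with trivial orthogonal complement is dense: the orthogonal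
   projection of u exists by completeness and the parallelogram law. *)
Lemma total_dense (S : set V) : fast_complete V -> S 0 ->
  (forall u v, S u -> S v -> S (u + v)) -> (forall a u, S u -> S (a *: u)) ->
  (forall w, (forall s, S s -> dt w s = 0) -> w = 0) ->
  forall u e, 0 < e -> exists2 s, S s & nrm (u - s) <= e.
Proof.
move=> cV S0 SD SZ tot u e e0.
pose E := [set nrm (u - s) | s in S].
have E0 : E !=set0 by exists (nrm (u - 0)); exists 0.
have lE : lbound E 0 by move=> _ [s _ <-]; exact: nrm_ge0.
have iE : has_inf E by split => //; exists 0.
pose d := inf E.
have d0 : 0 <= d by apply: lb_le_inf.
have dE s : S s -> d <= nrm (u - s) by move=> Ss; apply: ge_inf; [exists 0|exists s].
(* The parallelogram law bounds the squared increment by 4 (d + eta n)^2 - 4 d^2, hence by 4 (2 d +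
   1) eta n because eta n <= 1; this choice makes the bound equal to 16^-(n+1). *)
pose eta n : R := 16^-1 ^+ n.+1 / (4 * (2 * d + 1)).
have dp : 0 < 4 * (2 * d + 1) by lra.
have q0 n : 0 < 16^-1 ^+ n :> R by rewrite exprn_gt0 // invr_gt0 ltr0n.
have q1 n : 16^-1 ^+ n.+1 <= 16^-1 ^+ n :> R.
  by rewrite exprS ler_piMl ?(ltW (q0 _)) // invf_le1 ?ler1n ?ltr0n.
have q2 n : 16^-1 ^+ n <= 1 :> R.
  by rewrite exprn_ile1 // ?invr_ge0 ?ler0n // invf_le1 ?ler1n ?ltr0n.
have eta0 n : 0 < eta n by rewrite divr_gt0.
have eta1 n : eta n.+1 <= eta n by rewrite ler_pM2r ?invr_gt0 // q1.
have eta2 n : eta n <= 1 by rewrite ler_pdivrMr // mul1r; apply: le_trans (q2 _) _; lra.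
have ex n : exists s, S s /\ nrm (u - s) < d + eta n.
  by have [_ [s Ss <-] h] := inf_adherent (eta0 n) iE; exists s.
have [s hs] := choice ex.
have cs n : nrm (s n.+1 - s n) <= 4^-1 ^+ n.+1.
  have [[S1 h1] [S2 h2]] := (hs n, hs n.+1).
  have h3 : d <= nrm (u - 2^-1 *: (s n.+1 + s n)) by apply: dE; apply: SZ; exact: SD.
  have := parallelogram (u - s n.+1) (u - s n).
  have -> : u - s n.+1 + (u - s n) = 2 *: (u - 2^-1 *: (s n.+1 + s n)).
    rewrite scalerBr scalerA divff ?pnatr_eq0 // scale1r scaler_nat mulr2n.
    by rewrite opprD addrACA.
  rewrite nrmZ (_ : cmod 2 = 2); last by rewrite -(rmorph_nat (real_complex R)) cmod_real ger0_norm.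
  have -> : u - s n.+1 - (u - s n) = - (s n.+1 - s n).
    by rewrite !opprB addrC addrA subrK.
  rewrite nrmN => h4.
  rewrite -(@ler_pXn2r _ 2) ?nnegrE ?nrm_ge0 ?exprn_ge0 ?invr_ge0 ?ler0n //.
  have -> : (4^-1 ^+ n.+1) ^+ 2 = eta n * (4 * (2 * d + 1)) :> R.
    rewrite /eta divfK ?gt_eqF // -exprM mulnC exprM; congr (_ ^+ _).
    by field.
  have := nrm_ge0 (u - s n); have := nrm_ge0 (u - s n.+1); have := eta0 n.
  have := eta1 n; have := eta2 n; have := eta0 n.+1; move: h1 h2 h3 h4 d0.
  move: (nrm (u - 2^-1 *: _)) (nrm (s n.+1 - s n)) (nrm (u - s n)) (nrm (u - s n.+1)) (eta n) (eta n.+1) => a b x y p p'.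
  move=> h1 h2 h3 h4 d0 p'0 p1 pp' p0 y0 x0.
  have x2 : x ^+ 2 <= (d + p) ^+ 2 by rewrite ler_pXn2r // ?nnegrE //; lra.
  have y2 : y ^+ 2 <= (d + p) ^+ 2 by rewrite ler_pXn2r // ?nnegrE //; lra.
  have a2 : d ^+ 2 <= a ^+ 2 by rewrite ler_pXn2r // ?nnegrE //; lra.
  have pp : p ^+ 2 <= p by rewrite expr2 ler_piMl // ltW.
  by move: h4; rewrite sqrrD in x2 y2; nra.
have [l hl] := cV s cs.
have nw : nrm (u - l) <= d.
  apply/ler_addgt0Pr => r r0.
  have [n hn] := geo_small 3 r0.
  apply: le_trans (nrm_tri _ (s n) _) _; have [_ h] := hs n; have := hl n.
  suff : eta n <= 4^-1 ^+ n by lra.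
  rewrite ler_pdivrMr //; apply: le_trans (q1 n) _.
  apply: (@le_trans _ _ (4^-1 ^+ n)); last by rewrite ler_peMr ?exprn_ge0 ?invr_ge0 ?ler0n //; lra.
  by apply: lerXn2r; rewrite ?nnegrE ?invr_ge0 ?ler0n // lef_pV2 ?posrE ?ltr0n // ler_nat.
have wS t : S t -> d <= nrm (u - l - t).
  move=> St; apply/ler_addgt0Pr => r r0; have [n hn] := geo_small 2 r0.
  apply: le_trans (dE (s n + t) _) _; first by apply: SD => //; case: (hs n).
  apply: le_trans (nrm_tri _ (l + t) _) _; rewrite opprD addrA lerD2l.
  by rewrite opprD addrACA subrr addr0 nrmC (le_trans (hl n)).
(* No element of S is closer to u - l than 0, so subtracting the projection on [t] cannot shorten u
   - l, and by Pythagoras the pairing with [t] is 0. *)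
have w0 : u - l = 0.
  apply: tot => t St; have [->|t0] := eqVneq t 0; first by rewrite ip0r.
  apply: cmod_eq0; apply/eqP; rewrite -sqrf_eq0.
  have /wS := SZ (dt (u - l) t / (nrm t ^+ 2)%:C) t St => h.
  have nt : 0 < nrm t ^+ 2.
    by rewrite exprn_gt0 // lt_def nrm_ge0 andbT; apply: contra t0 => /eqP /nrm_eq0 ->.
  have : nrm (u - l) ^+ 2 <= nrm (u - l - (dt (u - l) t / (nrm t ^+ 2)%:C) *: t) ^+ 2.
    by rewrite ler_pXn2r ?nnegrE ?nrm_ge0 // (le_trans nw).
  rewrite nrm_sqr_proj // lerBrDr gerDl pmulr_lle0 ?invr_gt0 // => h2.
  by rewrite eq_le h2 sqr_ge0.
have [n hn] := geo_small 2 e0; exists (s n); first by case: (hs n).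
by move/eqP: w0; rewrite subr_eq0 => /eqP ->; rewrite nrmC (le_trans (hl n)).
Qed.

End inner_product_space.

Lemma L2_inner d (T : measurableType d) (R : realType)
  (mu : {measure set T -> \bar R}) : inner_product (@dot d T R mu).
Proof.
by split; [exact: dotDl|exact: dotZl|exact: dotC|exact: dot_nrm].
Qed.

(** * Bounded operators and Fredholm criteria *)

Section bounded_operators.
Context (R : realType).
Implicit Types X Y Z V : normedModType R[i].

(** Bounded linearity with a real bound on [nrm]; [bop_bounded_linear] returns to the form used in
    the statement. *)
Definition bop X Y (T : X -> Y) : Prop :=
  (forall a u v, T (a *: u + v) = a *: T u + T v) /\
  exists2 C : R, 0 <= C & forall u, nrm (T u) <= C * nrm u.

Lemma bopD X Y (T : X -> Y) u v : bop T -> T (u + v) = T u + T v.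
Proof. by move=> [h _]; have := h 1 u v; rewrite !scale1r. Qed.

Lemma bop0 X Y (T : X -> Y) : bop T -> T 0 = 0.
Proof.
by move=> hT; apply: (addrI (T 0)); rewrite -bopD // !addr0.
Qed.

Lemma bopZ X Y (T : X -> Y) a u : bop T -> T (a *: u) = a *: T u.
Proof. by move=> hT; have [h _] := hT; rewrite -[a *: u]addr0 h (bop0 hT) addr0. Qed.

Lemma bopN X Y (T : X -> Y) u : bop T -> T (- u) = - T u.
Proof. by move=> hT; rewrite -scaleN1r bopZ // scaleN1r. Qed.

Lemma bopB X Y (T : X -> Y) u v : bop T -> T (u - v) = T u - T v.
Proof. by move=> hT; rewrite bopD // bopN. Qed.

Lemma bop_id X : bop (fun u : X => u).
Proof. by split => //; exists 1 => // u; rewrite mul1r. Qed.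

Lemma bop_zero X Y : bop (fun _ : X => 0 : Y).
Proof.
split; first by move=> a u v; rewrite scaler0 addr0.
by exists 0 => // u; rewrite nrm0 mul0r.
Qed.

Lemma bop_comp X Y Z (T : X -> Y) (S : Y -> Z) : bop T -> bop S ->
  bop (fun u => S (T u)).
Proof.
move=> [lT [C C0 hC]] [lS [D D0 hD]]; split; first by move=> a u v; rewrite lT lS.
exists (D * C); first exact: mulr_ge0.
by move=> u; apply: le_trans (hD _) _; rewrite -mulrA ler_wpM2l.
Qed.

Lemma bop_add X Y (T S : X -> Y) : bop T -> bop S -> bop (fun u => T u + S u).
Proof.
move=> [lT [C C0 hC]] [lS [D D0 hD]]; split.
  by move=> a u v; rewrite lT lS scalerDr addrACA.
exists (C + D); first exact: addr_ge0.
by move=> u; apply: le_trans (nrmD _ _) _; rewrite mulrDl lerD.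
Qed.

Lemma bop_scale X Y (T : X -> Y) a : bop T -> bop (fun u => a *: T u).
Proof.
move=> [lT [C C0 hC]]; split.
  by move=> b u v; rewrite lT scalerDr !scalerA mulrC.
exists (cmod a * C); first by rewrite mulr_ge0 ?cmod_ge0.
by move=> u; rewrite nrmZ -mulrA ler_wpM2l ?cmod_ge0.
Qed.

Lemma bop_opp X Y (T : X -> Y) : bop T -> bop (fun u => - T u).
Proof.
move=> /(bop_scale (-1)); rewrite (_ : (fun u => _) = (fun u => - T u)) //.
by apply/funext => u; rewrite scaleN1r.
Qed.

Lemma bop_sub X Y (T S : X -> Y) : bop T -> bop S -> bop (fun u => T u - S u).
Proof. by move=> hT hS; apply: bop_add => //; exact: bop_opp. Qed.

Lemma bop_bounded_linear X Y (T : X -> Y) : bop T -> bounded_linear T.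
Proof.
move=> [lT [C C0 hC]]; split => //; exists C%:C => u.
by rewrite !nrmE -rmorphM lecr.
Qed.

Lemma bop_bound X Y (T : X -> Y) : bop T ->
  exists2 C : R, 0 < C & forall u, nrm (T u) <= C * nrm u.
Proof.
move=> [_ [C C0 hC]]; exists (C + 1); first by lra.
by move=> u; apply: le_trans (hC u) _; rewrite ler_wpM2r ?nrm_ge0 //; lra.
Qed.

Lemma closed_kernel X Y (T : X -> Y) : bop T -> closed [set u | T u = 0].
Proof.
move=> hT p cp /=; have [C C0 hC] := bop_bound hT.
apply: nrm_small => e e0.
have e1 : 0 < (e / C)%:C :> R[i] by rewrite -(rmorph0 (real_complex R)) ltcR divr_gt0.
have [q [/= Tq bq]] := cp _ (nbhsx_ballx p _ e1).
have hpq : nrm (p - q) <= e / C.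
  by move: bq; rewrite -ball_normE /ball_ /= nrmE => /ltW; rewrite lecr.
have -> : T p = T (p - q) by rewrite bopB // Tq subr0.
by apply: le_trans (hC _) _; rewrite mulrC -ler_pdivlMr.
Qed.

(** Coefficients are peeled off one at a time along the list, so facts about spans follow by
    induction; the list may be linearly dependent. *)
Fixpoint span V (s : seq V) : set V :=
  if s is e :: s' then [set x | exists c, span s' (x - c *: e)] else [set 0].

Lemma span0 V (s : seq V) : span s 0.
Proof. by elim: s => //= e s IH; exists 0; rewrite scale0r subr0. Qed.

Lemma spanD V (s t : seq V) x y : span s x -> span t y -> span (s ++ t) (x + y).
Proof.
elim: s x => [|e s IH] x /=; first by move=> -> ; rewrite add0r.
by move=> [c hc] hy; exists c; rewrite addrAC; exact: IH.
Qed.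

Lemma spanD_same V (s : seq V) x y : span s x -> span s y -> span s (x + y).
Proof.
elim: s x y => [|e s IH] x y /=; first by move=> -> ->; rewrite addr0.
move=> [c hc] [d hd]; exists (c + d).
by rewrite scalerDl opprD addrACA; exact: IH.
Qed.

Lemma spanZ V (s : seq V) a x : span s x -> span s (a *: x).
Proof.
elim: s x => [|e s IH] x /=; first by move=> ->; rewrite scaler0.
move=> [c hc]; exists (a * c); rewrite -scalerA -scalerBr; exact: IH.
Qed.

Lemma spanN V (s : seq V) x : span s x -> span s (- x).
Proof. by rewrite -scaleN1r; exact: spanZ. Qed.

Lemma span_map X Y (A : X -> Y) s x : bop A -> span s x -> span (map A s) (A x).
Proof.
move=> hA; elim: s x => [|e s IH] x /=; first by move=> ->; exact: bop0.
by move=> [c hc]; exists c; rewrite -bopZ // -bopB //; exact: IH.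
Qed.

Lemma span_sum V (s : seq V) x : span s x ->
  exists c : 'I_(size s) -> R[i], x = \sum_i c i *: s`_i.
Proof.
elim: s x => [|e s IH] x /=; first by move=> ->; exists (fun=> 0); rewrite big_ord0.
move=> [c /IH [d hd]].
exists (fun i => if unlift ord0 i is Some j then d j else c).
rewrite big_ord_recl unlift_none /= -[LHS](subrK (c *: e)) hd addrC; congr (_ + _).
by apply: eq_bigr => i _; rewrite liftK.
Qed.

Lemma span_nth V (s : seq V) (i : 'I_(size s)) : span s s`_i.
Proof.
elim: s i => [[]//|e s IH]; case=> -[|i] hi /=.
  by exists 1; rewrite scale1r subrr; exact: span0.
by exists 0; rewrite scale0r subr0; exact: (IH (Ordinal (hi : (i < size s)%N))).
Qed.

(** Induction on the list. If some x0 in D has a nonzero coefficient at e, subtracting multiples of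
    x0 eliminates e from every other element of D; otherwise e contributes nothing to the
    intersection. *)
Lemma subspan V (D : set V) (s : seq V) : D 0 ->
  (forall u v, D u -> D v -> D (u + v)) -> (forall a u, D u -> D (a *: u)) ->
  exists t, forall x, span t x <-> span s x /\ D x.
Proof.
move=> D0 DD DZ; elim: s => [|e s [t ht]].
  by exists [::] => x /=; split=> [->|[]].
have [[x0 [Dx0 [c [c0 hc]]]]|no] :=
    pselect (exists x0, D x0 /\ exists c, c != 0 /\ span s (x0 - c *: e)).
  exists (x0 :: t) => x /=; split.
    move=> [b /ht [h1 h2]]; split.
      exists (b * c); rewrite -[x](subrK (b *: x0)) -addrA -scalerA -scalerBr.
      by apply: spanD_same => //; exact: spanZ.
    by rewrite -[x](subrK (b *: x0)); apply: DD => //; exact: DZ.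
  move=> [[b hb] Dx]; exists (b / c); apply/ht; split; last first.
    by rewrite -scaleNr; apply: DD => //; exact: DZ.
  have -> : x - (b / c) *: x0 = (x - b *: e) - (b / c) *: (x0 - c *: e).
    by rewrite scalerBr scalerA divfK // opprB addrA subrK.
  by apply: spanD_same => //; apply: spanN; exact: spanZ.
exists t => x; split.
  by move=> /ht [h1 h2]; split => //=; exists 0; rewrite scale0r subr0.
move=> [/= [b hb] Dx]; apply/ht; split => //.
have [b0|b0] := eqVneq b 0; first by rewrite b0 scale0r subr0 in hb.
by exfalso; apply: no; exists x; split => //; exists b.
Qed.

(** As in Gram-Schmidt, a new vector e is replaced by e' = e - Pi e, and Pi is extended by a
    functional with value 1 at e'. The projection turns membership in a span into the closed
    condition x - Pi x = 0. *)
Lemma span_proj V (dt : V -> V -> R[i]) (ip : inner_product dt) (s : seq V) :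
  exists2 Pi : V -> V, bop Pi &
    (forall x, span s (Pi x)) /\ (forall x, span s x -> Pi x = x).
Proof.
elim: s => [|e s [Pi bPi [rPi fPi]]].
  by exists (fun=> 0); [exact: bop_zero|split => // x /= ->].
pose e' := e - Pi e.
have [e0|e0] := eqVneq e' 0.
  have es : span s e by move/eqP: e0; rewrite subr_eq0 => /eqP ->; exact: rPi.
  exists Pi => //; split; first by move=> x /=; exists 0; rewrite scale0r subr0.
  move=> x /= [c hc]; apply: fPi; rewrite -[x](subrK (c *: e)).
  by apply: spanD_same => //; exact: spanZ.
have n0 : nrm e' != 0 by apply: contra e0 => /eqP /nrm_eq0 ->.
pose l x := dt x e' / (nrm e' ^+ 2)%:C.
pose Q x := Pi x + l (x - Pi x) *: e'.
have bQ : bop Q.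
  apply: bop_add => //; split.
    move=> a u v; rewrite scalerA -scalerDl; congr (_ *: _).
    have -> : a *: u + v - Pi (a *: u + v) = a *: (u - Pi u) + (v - Pi v).
      by have [lP _] := bPi; rewrite lP opprD addrACA -scalerBr.
    by rewrite /l (ipDl ip (a *: _)) (ipZl ip) mulrDl mulrA.
  have [C C0 hC] := bop_bound bPi.
  exists (1 + C); first by rewrite addr_ge0 ?ltW.
  move=> x; rewrite nrmZ cmodM cmodV cmod_real ger0_norm ?sqr_ge0 //.
  apply: (@le_trans _ _ (nrm (x - Pi x) * nrm e' / nrm e' ^+ 2 * nrm e')).
    rewrite ler_wpM2r ?nrm_ge0 // ler_wpM2r ?invr_ge0 ?sqr_ge0 //.
    exact: cauchy_schwarz.
  rewrite (_ : _ / _ * _ = nrm (x - Pi x)); last by field.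
  by apply: le_trans (nrmB _ _) _; rewrite mulrDl mul1r lerD2l.
exists Q => //; split=> [x|x /= [c hc]].
  exists (l (x - Pi x)); rewrite /Q.
  have -> : Pi x + l (x - Pi x) *: e' - l (x - Pi x) *: e =
     Pi x - l (x - Pi x) *: Pi e.
    move: (l _) => c; rewrite /e' scalerBr -addrA; congr (_ + _).
    by rewrite addrAC subrr add0r.
  by apply: spanD_same => //; apply: spanN; exact: spanZ.
have Px : Pi x = x - c *: e' .
  have := fPi _ hc; rewrite bopB // bopZ // => /eqP; rewrite subr_eq => /eqP ->.
  by rewrite /e' scalerBr opprB addrA addrAC.
rewrite /Q Px subKr /l (ipZl ip) (ip_nrm ip).
by rewrite mulfK ?subrK // (fmorph_eq0 (real_complex R)) sqrf_eq0.
Qed.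

End bounded_operators.

(** * Finite-rank and approximable operators, operator ideals, Neumann series *)

Section operator_ideals.
Context (R : realType).
Implicit Types X Y Z V : normedModType R[i].

Definition frank X Y (T : X -> Y) : Prop :=
  bop T /\ exists s, forall x, span s (T x).

(** Operator-norm limits of finite-rank operators; between Hilbert spaces these are the compact
    operators. *)
Definition appx X Y (T : X -> Y) : Prop :=
  bop T /\ forall e : R, 0 < e ->
    exists2 F, frank F & forall x, nrm (T x - F x) <= e * nrm x.

Lemma frank_compl X Y Z (T : X -> Y) (A : Y -> Z) : bop A -> frank T ->
  frank (fun x => A (T x)).
Proof.
move=> hA [hT [s hs]]; split; first exact: bop_comp.
by exists (map A s) => x; exact: span_map.
Qed.

Lemma frank_compr X Y Z (T : Y -> Z) (A : X -> Y) : bop A -> frank T ->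
  frank (fun x => T (A x)).
Proof.
move=> hA [hT [s hs]]; split; first exact: bop_comp.
by exists s => x; exact: hs.
Qed.

Lemma frank_add X Y (T S : X -> Y) : frank T -> frank S -> frank (fun x => T x + S x).
Proof.
move=> [hT [s hs]] [hS [t ht]]; split; first exact: bop_add.
by exists (s ++ t) => x; exact: spanD.
Qed.

Lemma frank_zero X Y : frank (fun _ : X => 0 : Y).
Proof. by split; [exact: bop_zero|exists [::]]. Qed.

Lemma frank_appx X Y (T : X -> Y) : frank T -> appx T.
Proof.
move=> fT; split; first by case: fT.
by move=> e e0; exists T => // x; rewrite subrr nrm0 mulr_ge0 ?nrm_ge0 ?ltW.
Qed.

Lemma appx_compl X Y Z (T : X -> Y) (A : Y -> Z) : bop A -> appx T ->
  appx (fun x => A (T x)).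
Proof.
move=> hA [hT h]; split; first exact: bop_comp.
move=> e e0; have [C C0 hC] := bop_bound hA.
have [F fF hF] := h (e / C) (divr_gt0 e0 C0).
exists (fun x => A (F x)); first exact: frank_compl.
move=> x; rewrite -bopB //; apply: le_trans (hC _) _.
by rewrite -ler_pdivlMl // mulrA [C^-1 * e]mulrC.
Qed.

Lemma appx_compr X Y Z (T : Y -> Z) (A : X -> Y) : bop A -> appx T ->
  appx (fun x => T (A x)).
Proof.
move=> hA [hT h]; split; first exact: bop_comp.
move=> e e0; have [C C0 hC] := bop_bound hA.
have [F fF hF] := h (e / C) (divr_gt0 e0 C0).
exists (fun x => F (A x)); first exact: frank_compr.
move=> x; apply: le_trans (hF _) _.
by rewrite mulrAC ler_pdivrMr // -mulrA ler_pM2l // mulrC.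
Qed.

Lemma appx_add X Y (T S : X -> Y) : appx T -> appx S -> appx (fun x => T x + S x).
Proof.
move=> [hT h] [hS h']; split; first exact: bop_add.
move=> e e0; have e2 : 0 < e / 2 by rewrite divr_gt0.
have [F fF hF] := h _ e2; have [G fG hG] := h' _ e2.
exists (fun x => F x + G x); first exact: frank_add.
move=> x; rewrite opprD addrACA; apply: le_trans (nrmD _ _) _.
by apply: le_trans (lerD (hF x) (hG x)) _; rewrite -mulrDl -splitr.
Qed.

(** Abstracts what the parametrix computations ask of the error terms. The zero ideal yields
    one-sided inverses, the ideal of approximable operators yields the Fredholm properties. *)
Record opideal V (I : (V -> V) -> Prop) : Prop := OpIdeal {
  id_bop : forall T, I T -> bop T;
  id_zero : I (fun=> 0);
  id_add : forall T S, I T -> I S -> I (fun x => T x + S x);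
  id_compl : forall A T, bop A -> I T -> I (fun x => A (T x));
  id_compr : forall A T, bop A -> I T -> I (fun x => T (A x)) }.

Lemma id_opp V I T : @opideal V I -> I T -> I (fun x => - T x).
Proof.
by move=> h IT; apply: (id_compl h (A := fun x => - x)) => //; apply: bop_opp; exact: bop_id.
Qed.

Lemma appx_ideal V : @opideal V (@appx V V).
Proof.
split; [by move=> T []|exact: frank_appx (frank_zero _ _)|exact: appx_add
       |by move=> A T; exact: appx_compl|by move=> A T; exact: appx_compr].
Qed.

Lemma zero_ideal V : @opideal V (fun T => forall x, T x = 0).
Proof.
split=> //.
- move=> T h; rewrite (_ : T = fun=> 0); first exact: bop_zero.
  exact/funext.
- by move=> T S hT hS x; rewrite hT hS addr0.
- by move=> A T hA hT x; rewrite hT bop0.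
Qed.

Lemma cauchy_complete V (u : nat -> V) : fast_complete V ->
  (forall e : R, 0 < e -> exists N, forall n m, (N <= n)%N -> (N <= m)%N ->
    nrm (u n - u m) <= e) -> exists l, tends u l.
Proof.
move=> cV h.
have q0 n : 0 < 4^-1 ^+ n.+1 :> R by rewrite exprn_gt0 // invr_gt0 ltr0n.
have [N hN] := choice (fun n => h _ (q0 n)).
(* Summing the thresholds gives increasing indices [M n] that dominate both [N n] and [n], so that
   the subsequence is Cauchy at the rate asked for by [fast_complete]. *)
pose M n := (\sum_(i < n.+1) (N i).+1)%N.
have NM n : (N n <= M n)%N by rewrite /M big_ord_recr /= addnS leqW // leq_addl.
have nM n : (n <= M n)%N.
  elim: n => // n IH; rewrite /M big_ord_recr /= addnS ltnS; exact: leq_trans IH (leq_addr _ _).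
have MM n : (M n <= M n.+1)%N by rewrite {2}/M big_ord_recr /= leq_addr.
have [|l hl] := cV (fun n => u (M n)).
  by move=> n; rewrite nrmC; apply: (hN n) => //; exact: leq_trans (NM n) (MM n).
exists l => e e0; have e2 : 0 < e / 2 by rewrite divr_gt0.
have [N1 h1] := h _ e2; have [k hk] := geo_small 2 e2.
have kM j : (k <= j)%N -> nrm (u (M j) - l) <= e / 2.
  move=> kj; apply: le_trans (hl j) _; apply: le_trans _ hk.
  by rewrite ler_pM2l // ler_wiXn2l // ?invr_ge0 ?ler0n // invf_le1 ?ler1n ?ltr0n.
exists N1 => n nN.
apply: le_trans (nrm_tri _ (u (M (k + N1)%N)) _) _.
rewrite [leRHS]splitr lerD ?kM ?leq_addr ?h1 //.
exact: leq_trans (leq_addl _ _) (nM _).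
Qed.

(** The iteration x <- u - E x has increments at most q^(n+1) |u| and so converges to a solution of
    x + E x = u. Uniqueness, from q < 1, makes the solution map linear, and (1 - q) |B u| <= |u|
    bounds it. *)
Lemma neumann V (E : V -> V) (q : R) : fast_complete V -> bop E -> q < 1 ->
  (forall u, nrm (E u) <= q * nrm u) ->
  exists2 B, bop B & (forall u, B u + E (B u) = u) /\ (forall u, B (u + E u) = u).
Proof.
move=> cV bE q1 hE.
wlog q0 : q q1 hE / 0 <= q.
  move=> wl; apply: (wl (Num.max q 0)); rewrite ?gt_max ?q1 ?ltr01 ?le_max ?lexx ?orbT //.
  move=> u; apply: le_trans (hE u) _; rewrite ler_wpM2r ?nrm_ge0 //.
  by rewrite le_max lexx.
have uniq u v : u + E u = v + E v -> u = v.
  move=> /eqP; rewrite -subr_eq0 opprD addrACA -bopB // addr_eq0 => /eqP h.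
  apply/eqP; rewrite -subr_eq0; apply/eqP/nrm_eq0/eqP; rewrite eq_le nrm_ge0 andbT.
  have := hE (u - v); rewrite {2}h nrmN -{1}[nrm (E _)]mul1r.
  have : nrm (u - v) = nrm (E (u - v)) by rewrite {1}h nrmN.
  by have := nrm_ge0 (u - v); nra.
have ex u : exists x, x + E x = u.
  pose x := fix x n := if n is n'.+1 then u - E (x n') else u.
  have hx n : nrm (x n.+1 - x n) <= q ^+ n.+1 * nrm u.
    elim: n => [|n IH].
      by rewrite /= addrAC subrr add0r nrmN expr1.
    have -> : x n.+2 - x n.+1 = E (x n - x n.+1).
      by rewrite /= opprB addrC addrA subrK -bopB // opprB; congr E; rewrite /= addrC.
    apply: le_trans (hE _) _; rewrite nrmC exprS -mulrA.
    by rewrite ler_wpM2l.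
  have p0 : 0 < 1 - q by rewrite subr_gt0.
  have hnm n k : nrm (x n - x (n + k)%N) <= (q ^+ n.+1 - q ^+ (n + k).+1) / (1 - q) * nrm u.
    elim: k => [|k IH]; first by rewrite addn0 !subrr nrm0 mul0r mul0r.
    apply: le_trans (nrm_tri _ (x (n + k)%N) _) _.
    have := hx (n + k)%N; rewrite nrmC addnS => h; apply: le_trans (lerD IH h) _.
    rewrite -mulrDl ler_wpM2r ?nrm_ge0 // le_eqVlt; apply/orP; left; apply/eqP.
    by rewrite !exprS; field; rewrite gt_eqF.
  have [l hl] : exists l, tends x l.
    apply: cauchy_complete => // e e0.
    have /cvgrPdist_le : geometric (q / (1 - q) * nrm u) q n @[n --> \oo] --> (0 : R).
      by apply: cvg_geometric; rewrite ger0_norm.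
    move=> /(_ e e0) [N _ hN]; exists N.
    have key n m : (N <= n)%N -> (n <= m)%N -> nrm (x n - x m) <= e.
      move=> Nn nm; rewrite -(subnKC nm); apply: le_trans (hnm _ _) _.
      have := hN n Nn; rewrite /= sub0r normrN => /(le_trans (ler_norm _)); apply: le_trans.
      have -> : q / (1 - q) * nrm u * q ^+ n = q ^+ n.+1 / (1 - q) * nrm u.
        by rewrite exprS; ring.
      rewrite ler_wpM2r ?nrm_ge0 // ler_wpM2r ?invr_ge0 ?(ltW p0) //.
      by rewrite gerBl exprn_ge0.
    move=> n m Nn Nm; have [nm|/ltnW mn] := leqP n m; first exact: key.
    by rewrite nrmC; exact: key.
  exists l; apply/eqP; rewrite -subr_eq0; apply/eqP; apply: nrm_small => e e0.
  have e2 : 0 < e / 2 by rewrite divr_gt0.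
  have [N hN] := hl _ e2.
  have -> : l + E l - u = (l - x N.+1) + E (l - x N).
    rewrite (bopB _ _ bE) -[x N.+1]/(u - E (x N)) opprB addrACA.
    by rewrite [X in _ = _ + X]addrAC subrr add0r.
  apply: le_trans (nrmD _ _) _; rewrite [leRHS]splitr lerD //.
    by rewrite nrmC hN.
  apply: le_trans (hE _) _; apply: le_trans (hN N (leqnn N)); rewrite nrmC.
  by rewrite ler_piMl ?nrm_ge0 // ltW.
have [B hB] := choice ex; exists B.
  split.
    move=> a u v; apply: uniq; rewrite hB; have [lE _] := bE.
    by rewrite lE addrACA -scalerDr !hB.
  exists (1 - q)^-1; first by rewrite invr_ge0 subr_ge0 ltW.
  move=> u; rewrite mulrC ler_pdivlMr ?subr_gt0 //.
  have := nrmB (B u + E (B u)) (E (B u)); rewrite addrK hB.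
  by have := hE (B u); lra.
by split=> // u; apply: uniq; rewrite hB.
Qed.

(** Choose F of finite rank with |K - F| <= 1/2. The Neumann inverse B of 1 + K - F satisfies B (1 +
    K) = 1 + B F. *)
Lemma appx_left V (K : V -> V) : fast_complete V -> appx K ->
  exists B F, [/\ bop B, frank F & forall u, B (u + K u) = u + F u].
Proof.
move=> cV [bK hK]; have [F fF hF] := hK 2^-1 ltac:(by rewrite invr_gt0).
have [bF _] := fF.
have [|B bB [_ h]] := neumann cV (bop_sub bK bF) _ hF.
  by rewrite invf_lt1 ?ltr1n.
exists B, (fun u => B (F u)); split => //; first exact: frank_compl.
by move=> u; rewrite -[X in _ = X + _]h -(bopD _ _ bB) -addrA subrK.
Qed.

(** Replacing F by P F keeps |K - P F| <= 1/2, as K = P K and P is a contraction, and it keeps the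
    solution in the range of P, because B u = u - (K - P F) B u. *)
Lemma appx_right V (K P : V -> V) : fast_complete V -> appx K -> bop P ->
  (forall u, nrm (P u) <= nrm u) -> (forall u, P (P u) = P u) ->
  (forall u, P (K u) = K u) ->
  exists B F, [/\ bop B, frank F, forall u, B u + K (B u) = u + F u &
    forall u, P u = u -> P (B u) = B u].
Proof.
move=> cV [bK hK] bP cP PP PK; have [F fF hF] := hK 2^-1 ltac:(by rewrite invr_gt0).
have [bF _] := fF.
have bE := bop_sub bK (bop_comp bF bP).
have [||B bB [h _]] := neumann (q := 2^-1) cV bE.
- by rewrite invf_lt1 ?ltr1n.
- by move=> u; rewrite -PK -bopB // (le_trans (cP _)).
exists B, (fun u => P (F (B u))); split => //.
- by apply: frank_compl => //; exact: frank_compr.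
- by move=> u; rewrite -[X in _ = X + _]h -addrA subrK.
- move=> u Pu; have -> : B u = u - (K (B u) - P (F (B u))) by rewrite -[X in _ = X - _]h addrK.
  by rewrite bopB // Pu bopB // PK PP.
Qed.

End operator_ideals.

(** * Fredholm properties read off a one-sided inverse modulo finite rank *)

Section fredholm_criteria.
Context (R : realType) (X Y : normedModType R[i]).
Variables (dt : Y -> Y -> R[i]) (ip : inner_product dt).
Variables (T : X -> Y) (bT : bop T).

(** On the kernel of T, x = - F x, so the kernel lies in [span s]. For closed range let G = T L - 1:
    it maps the range of T into T (span s), and conversely G y = T x gives y = T (L y - x). The
    range of T is thus the preimage under G of a finite-dimensional space. *)
Lemma left_parametrix (L : Y -> X) (F : X -> X) : bop L -> frank F ->
  (forall x, L (T x) = x + F x) -> left_fredholm T.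
Proof.
move=> bL [bF [s hs]] h; split; [split; first exact: bop_bounded_linear|].
  have [Pi bPi [rPi fPi]] := span_proj ip (map T s).
  have spT y : span (map T s) y -> range T y.
    elim: s {hs rPi fPi} y => [|e s IH] y /=; first by move=> ->; exists 0; rewrite ?bop0.
    move=> [c /IH [x _ hx]]; exists (x + c *: e) => //.
    by rewrite (bopD _ _ bT) hx (bopZ _ _ bT) subrK.
  pose G y := T (L y) - y.
  have bG : bop G by apply: bop_sub; [exact: bop_comp|exact: bop_id].
  rewrite (_ : range T = [set y | G y - Pi (G y) = 0]).
    by apply: closed_kernel; apply: bop_sub => //; exact: bop_comp.
  apply/seteqP; split=> y /=.
    move=> [x _ <-]; apply/eqP; rewrite subr_eq0 eq_sym; apply/eqP/fPi.
    by rewrite /G h -(bopB _ _ bT) addrC addKr; exact: span_map.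
  move=> /eqP; rewrite subr_eq0 => /eqP Gy.
  have [x _ hx] : range T (G y) by rewrite Gy; apply: spT.
  by exists (L y - x) => //; rewrite (bopB _ _ bT) hx /G opprB addrC subrK.
have [t ht] := @subspan _ _ [set x | T x = 0] s (bop0 bT)
  (fun u v hu hv => ltac:(by rewrite /= (bopD _ _ bT) hu hv addr0))
  (fun a u hu => ltac:(by rewrite /= (bopZ _ _ bT) hu scaler0)).
exists (size t), (fun i => t`_i); split.
  by move=> i; have /ht [] := span_nth i.
move=> x Tx; apply: span_sum; apply/ht; split => //.
have := h x; rewrite Tx (bop0 bL) => /esym/eqP; rewrite addr_eq0 => /eqP ->.
exact: spanN.
Qed.

(** Since T S = 1 + F, y is in the range of T exactly when F y is. The part of [span s] inside the
    range is spanned by a list t, so the range is the preimage of [span t] under F, hence closed;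
    the list s covers the cokernel. *)
Lemma right_parametrix (S : Y -> X) (F : Y -> Y) : bop S -> frank F ->
  (forall y, T (S y) = y + F y) -> right_fredholm T.
Proof.
move=> bS [bF [s hs]] h; split; [split; first exact: bop_bounded_linear|]; last first.
  exists (size s), (fun i => s`_i) => y; exists (S y).
  have [c hc] := span_sum (spanN (hs y)); exists c.
  by rewrite -hc h addrK.
have [t ht] := @subspan _ _ (range T) s
  (ltac:(by exists 0 => //; exact: bop0))
  (fun u v hu hv => ltac:(by move: hu hv => [x _ <-] [y _ <-]; exists (x + y) => //; exact: bopD))
  (fun a u hu => ltac:(by move: hu => [x _ <-]; exists (a *: x) => //; exact: bopZ)).
have [Pi bPi [rPi fPi]] := span_proj ip t.
rewrite (_ : range T = [set y | F y - Pi (F y) = 0]).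
  by apply: closed_kernel; apply: bop_sub => //; exact: bop_comp.
apply/seteqP; split=> y /=.
  move=> [x _ <-]; apply/eqP; rewrite subr_eq0 eq_sym; apply/eqP/fPi/ht.
  split => //; exists (S (T x) - x) => //.
  by rewrite (bopB _ _ bT) h addrC addKr.
move=> /eqP; rewrite subr_eq0 => /eqP Fy.
have /ht [_ [x _ hx]] : span t (F y) by rewrite Fy.
by exists (S y - x) => //; rewrite (bopB _ _ bT) hx h addrK.
Qed.

End fredholm_criteria.

(** * Step functions and multiplication operators *)

Section lebesgue_change_of_variable.
Context (R : realType).
Local Notation mu := (@lebesgue_measure R).

(** Lebesgue measure is determined by its values on the intervals ]x, y], so the hypothesis
    identifies it with c times its pushforward under phi. *)
Lemma ge0_integral_change (phi : R -> R) (c : R) (f : R -> \bar R) :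
  measurable_fun setT phi -> 0 <= c ->
  (forall x y, mu `]x, y] = (c%:E * mu (phi @^-1` `]x, y]))%E) ->
  measurable_fun setT f -> (forall x, 0 <= f x)%E ->
  (\int[mu]_x f x = c%:E * \int[mu]_x f (phi x))%E.
Proof.
move=> mphi c0 h mf f0.
pose pf : {measure set (measurableTypeR R) -> \bar R} :=
  pushforward mu (phi : measurableTypeR R -> measurableTypeR R).
pose nu : {measure set (measurableTypeR R) -> \bar R} := mscale (NngNum c0) (pf mphi).
have E : forall A, measurable A -> mu A = nu A.
  by apply: lebesgue_measure_unique => _ [[x y] _ <-]; exact: h.
have -> : (\int[mu]_x f x = \int[nu]_x f x)%E.
  apply: eq_measure_integral => A mA _; exact: E.
rewrite ge0_integral_mscale //= ge0_integral_pushforward //.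
Qed.

Lemma ge0_integral_oppr (f : R -> \bar R) : measurable_fun setT f ->
  (forall x, 0 <= f x)%E -> (\int[mu]_x f x = \int[mu]_x f (- x)%R)%E.
Proof.
move=> mf f0; rewrite (@ge0_integral_change -%R 1) ?mul1e // => x y.
rewrite mul1e (_ : _ @^-1` _ = `[(- y)%R, (- x)%R[%classic); last first.
  apply/seteqP; split=> t /=; rewrite !in_itv /= => /andP[t1 t2].
    by rewrite lerNl ltrNr t1 t2.
  by rewrite ltrNr lerNl t1 t2.
by rewrite !lebesgue_measure_itv /= !lte_fin ltrN2 opprK addrC.
Qed.

Lemma integral_oppr (f : R -> \bar R) : measurable_fun setT f ->
  (\int[mu]_x f x = \int[mu]_x f (- x)%R)%E.
Proof.
move=> mf.
have E (g : R -> \bar R) : (\int[mu]_x g x = \int[mu]_x g^\+ x - \int[mu]_x g^\- x)%E.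
  exact: integralE.
have hp := ge0_integral_oppr (measurable_funepos mf) (fun x => funepos_ge0 f x).
have hn := ge0_integral_oppr (measurable_funeneg mf) (fun x => funeneg_ge0 f x).
rewrite (E f) (E (f \o -%R)) hp hn.
have -> : (f \o -%R)^\+%E = (fun x => f^\+%E (- x)) by apply/funext => x; rewrite !funeposE.
by have -> : (f \o -%R)^\-%E = (fun x => f^\-%E (- x)) by apply/funext => x; rewrite !funenegE.
Qed.

Lemma ge0_integral_scale (a : R) (f : R -> \bar R) : 0 < a -> measurable_fun setT f ->
  (forall x, 0 <= f x)%E -> (\int[mu]_x f x = a%:E * \int[mu]_x f (a * x)%R)%E.
Proof.
move=> a0 mf f0; rewrite (@ge0_integral_change ( *%R a) a) ?ltW // => x y.
rewrite (_ : _ @^-1` _ = `](x / a)%R, (y / a)%R]%classic); last first.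
  apply/seteqP; split=> t /=; rewrite !in_itv /= => /andP[t1 t2].
    by rewrite ltr_pdivrMr // ler_pdivlMr // mulrC t1 t2.
  by rewrite mulrC -ltr_pdivrMr // -ler_pdivlMr // t1 t2.
rewrite !lebesgue_measure_itv /= !lte_fin ltr_pM2r ?invr_gt0 //.
case: ifP => _; last by rewrite mule0.
by rewrite -!EFinB -EFinM -mulrBl mulrC divfK // gt_eqF.
Qed.

Lemma negligible_oppr (A : set R) : mu.-negligible A -> mu.-negligible [set x | A (- x)].
Proof.
move=> [B [mB B0 AB]]; exists [set x | B (- x)].
have mB' : measurable [set x : R | B (- x)].
  have mo : measurable_fun setT (-%R : R -> R) by [].
  by rewrite -[X in measurable X]setTI; exact: mo.
split => //; last by move=> x /= /AB.
have mi : measurable_fun setT (EFin \o (\1_B : R -> R)).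
  by apply/measurable_EFinP; exact: measurable_indic.
have h := ge0_integral_oppr mi (fun x => ltac:(by rewrite lee_fin)).
have h0 : (\int[mu]_x (\1_B x)%:E = 0)%E by rewrite integral_indic // setIT.
transitivity (\int[mu]_x (\1_[set x | B (- x)] x)%:E)%E.
  by rewrite integral_indic // setIT.
rewrite -h0 [RHS]h; apply: eq_integral => x _.
by rewrite /= !indicE.
Qed.

Lemma ae_oppr (P : R -> Prop) : {ae mu, forall x, P x} -> {ae mu, forall x, P (- x)}.
Proof. exact: negligible_oppr. Qed.

Lemma cmeasurable_oppr (f : R -> R[i]) : cmeasurable f -> cmeasurable (fun x : R => f (- x)).
Proof.
by move=> [m1 m2]; split; [exact: (measurableT_comp m1)|exact: (measurableT_comp m2)].
Qed.

Lemma cint_oppr (f : R -> R[i]) : cmeasurable f ->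
  cint mu f = cint mu (fun x : R => f (- x)).
Proof.
move=> [m1 m2]; congr (_ +i* _); congr fine;
  by rewrite integral_oppr //; exact/measurable_EFinP.
Qed.

Lemma sint_oppr (f : R -> R[i]) : cmeasurable f ->
  sint mu f = sint mu (fun x : R => f (- x)).
Proof.
move=> mf; rewrite /sint ge0_integral_oppr //; first exact: measurable_cmod2.
by move=> x; rewrite lee_fin sqr_ge0.
Qed.

End lebesgue_change_of_variable.

(** * Signed indicators of intervals with one endpoint at 0: Gram matrix and totality *)

Section signed_indicators.
Context (R : realType).
Local Notation mu := (@lebesgue_measure R).

(* The indicator function of ]0, a] for 0 <= a, and minus that of ]a, 0] for
   a <= 0, so that its integral over R is a for every sign of a. *)
Definition chif (a x : R) : R := (0 < x <= a)%R%:R - (a < x <= 0)%R%:R.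

Lemma measurable_chif a : measurable_fun setT (chif a).
Proof.
have mi (p q : R) : measurable_fun setT (fun x : R => (p < x <= q)%R%:R : R).
  rewrite (_ : (fun x => _) = \1_`]p, q]); first exact: measurable_indic.
  by apply/funext => x; rewrite indicE mem_setE in_itv.
by apply: measurable_funB; exact: mi.
Qed.

Lemma chif_sub p q x : p <= q -> chif q x - chif p x = (p < x <= q)%R%:R.
Proof.
move=> pq; rewrite /chif.
case: (ltP 0 x) => x0; case: (leP x q) => xq; case: (leP x p) => xp /=;
  rewrite ?andbT ?andbF ?subr0 ?sub0r ?opprK ?addr0 ?add0r ?subrr //; lra.
Qed.

Lemma chif_sqr a x : chif a x ^+ 2 = (Num.min a 0 < x <= Num.max a 0)%R%:R.
Proof.
rewrite /chif; case: (lerP a 0) => a0.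
  case: (ltP 0 x) => x0 /=.
    by rewrite andbF (_ : x <= a = false) ?subr0 ?expr0n //; apply/negbTE; lra.
  by case: (a < x); rewrite /= ?sub0r ?subr0 ?sqrrN ?expr1n ?expr0n.
case: (ltP 0 x) => x0 /=.
  by rewrite andbF subr0; case: (x <= a); rewrite ?expr1n ?expr0n.
by rewrite (_ : a < x = false) /= ?subr0 ?expr0n //; apply/negbTE; lra.
Qed.

Lemma integral_oc (p q : R) : p <= q ->
  (\int[mu]_x ((p < x <= q)%R%:R)%:E = (q - p)%:E)%E.
Proof.
move=> pq; transitivity (\int[mu]_x (\1_`]p, q] x)%:E)%E.
  by apply: eq_integral => x _; rewrite indicE mem_setE in_itv.
transitivity (mu `]p, q]); first by rewrite integral_indic // setIT.
rewrite lebesgue_measure_itv /= lte_fin.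
by case: ltP => // qp; congr (_%:E); lra.
Qed.

Definition chi (a : R) : L2 mu := L2_of mu (fun x => (chif a x)%:C).

Lemma cmeasurable_real (f : R -> R) : measurable_fun setT f -> cmeasurable (fun x => (f x)%:C).
Proof. by move=> mf; split => //; exact: measurable_cst. Qed.

Lemma sqi_chif a : cLfun mu 2%:E (fun x => (chif a x)%:C).
Proof.
apply/sqiP; split; first by apply: cmeasurable_real; exact: measurable_chif.
rewrite /sint (_ : (fun x => _) = fun x => ((Num.min a 0 < x <= Num.max a 0)%R%:R)%:E).
  by rewrite integral_oc ?ltry // ge_min !le_max !lexx ?orbT.
apply/funext => x; rewrite cmod_real real_normK ?num_real //.
by rewrite chif_sqr.
Qed.

Lemma chiE a : {ae mu, forall x, L2_repr (chi a) x = (chif a x)%:C}.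
Proof. exact: L2_ofK (sqi_chif a). Qed.

(** Polarization: the squares of [chif a], [chif b] and their difference are indicators of intervals
    of lengths |a|, |b| and |a - b|. The formula is kept in this form to be matched with
    [dot_hat]. *)
Lemma dot_chi a b :
  dot (chi a) (chi b) = ((`|a| + `|b| - `|a - b|) / 2)%:C.
Proof.
have mc c := cmeasurable_real (@measurable_chif c).
rewrite (@dot_ae _ _ _ mu _ _ _ _ (mc a) (mc b) (chiE a) (chiE b)).
pose h x := (chif a x - chif b x) ^+ 2.
have hE x : h x = (Num.min a b < x <= Num.max a b)%R%:R.
  rewrite /h; have [ab|/ltW ba] := leP a b.
    by rewrite -(chif_sub _ ab) -sqrrN opprB chif_sub //; case: (_ && _); rewrite ?expr1n ?expr0n.
  by rewrite chif_sub //; case: (_ && _); rewrite ?expr1n ?expr0n.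
have ioc p q : p <= q -> mu.-integrable setT (EFin \o (fun x : R => (p < x <= q)%R%:R)).
  move=> pq; apply/integrableP; split.
    apply/measurable_EFinP; rewrite (_ : (fun x => _) = \1_`]p, q]); first exact: measurable_indic.
    by apply/funext => x; rewrite indicE mem_setE in_itv.
  rewrite (_ : (\int[mu]_x _)%E = (q - p)%:E) ?ltry // -(integral_oc pq).
  by apply: eq_integral => x _; rewrite /= ger0_norm.
have Roc p q : p <= q -> \int[mu]_x ((p < x <= q)%R%:R) = q - p.
  by move=> pq; rewrite /Rintegral integral_oc.
have m0 c e : Num.min c e <= Num.max c e :> R by rewrite ge_min !le_max !lexx.
have mm c e : Num.max c e - Num.min c e = `|c - e| :> R.
  have [ce|/ltW ec] := leP c e; first by rewrite distrC ger0_norm ?subr_ge0.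
  by rewrite ger0_norm ?subr_ge0.
have key x : chif a x * chif b x =
    2^-1 * (((Num.min a 0 < x <= Num.max a 0)%R%:R + (Num.min b 0 < x <= Num.max b 0)%R%:R)
     - (Num.min a b < x <= Num.max a b)%R%:R).
  by rewrite -!chif_sqr -hE /h; field.
apply: complexP => /=.
  transitivity (\int[mu]_x (2^-1 * (((Num.min a 0 < x <= Num.max a 0)%R%:R + (Num.min b 0 < x <= Num.max b 0)%R%:R)
     - (Num.min a b < x <= Num.max a b)%R%:R))).
    by congr fine; apply: eq_integral => x _; rewrite -key mul0r subr0.
  have iD := integrableD measurableT (ioc _ _ (m0 a 0)) (ioc _ _ (m0 b 0)).
  rewrite RintegralZl //; last exact: (integrableB measurableT iD (ioc _ _ (m0 a b))).
  rewrite RintegralB //; last exact: ioc.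
  rewrite RintegralD //; [|exact: ioc|exact: ioc].
  by rewrite !Roc // !mm !subr0 mulrC.
rewrite (_ : (fun x => _) = cst 0) ?Rintegral_cst ?mul0r //.
by apply/funext => x; rewrite oppr0 mulr0 mul0r addr0.
Qed.

(** The integrals over all ]p, q] vanish, so on each bounded interval the indefinite integral is the
    zero function, and Lebesgue's differentiation theorem recovers f from it almost everywhere. *)
Lemma real_weak_zero (f : R -> R) : measurable_fun setT f ->
  (forall a b, mu.-integrable `]a, b] (EFin \o f)) ->
  (forall a, \int[mu]_x (chif a x * f x) = 0) -> {ae mu, forall x, f x = 0}.
Proof.
move=> mf If h.
have ocE p q x : (p < x <= q)%R%:R * f x = (f \_ `]p, q]) x.
  by rewrite patchE mem_setE in_itv /=; case: (_ && _); rewrite ?mul1r ?mul0r.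
have iT p q : mu.-integrable setT (EFin \o (f \_ `]p, q])).
  have := iffLR (@integrable_mkcond _ _ _ mu _ (EFin \o f) (measurable_itv `]p, q])) (If p q).
  by apply: eq_integrable => // x _ /=; rewrite !patchE; case: ifP.
have ic a : mu.-integrable setT (EFin \o (fun x => chif a x * f x)).
  have := integrableB measurableT (iT 0 a) (iT a 0).
  apply: eq_integrable => // x _ /=; rewrite -!ocE -EFinB; congr (_%:E).
  by rewrite /chif mulrBl.
have hpq p q : \int[mu]_(x in `]p, q]) f x = 0.
  have [pq|qp] := leP p q; last first.
    by rewrite set_itv_ge ?Rintegral_set0 // bnd_simp -leNgt ltW.
  rewrite Rintegral_mkcond.
  transitivity (\int[mu]_x (chif q x * f x - chif p x * f x)).
    by congr fine; apply: eq_integral => x _; rewrite -mulrBl chif_sub // ocE.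
  by rewrite RintegralB // !h subrr.
have hN (N : nat) : {ae mu, forall x, - N%:R < x < N%:R -> f x = 0}.
  pose g := f \_ `](- N%:R), N%:R].
  have ig y : mu.-integrable [set` Interval (BRight (- N%:R)) (BRight y)] (EFin \o g).
    exact: integrableS (iT _ _).
  have lg : locally_integrable setT g.
    by apply: integrable_locally; [exact: measurable_itv|exact: If].
  have := FTC1 ig lg.
  set F := fun x => _.
  have -> : F = cst 0.
    apply/funext => x; rewrite /F -Rintegral_mkcondr.
    rewrite (_ : _ `&` _ = `](- N%:R), (Num.min x N%:R)]%classic) ?hpq //.
    apply/seteqP; split=> t /=; rewrite !in_itv /= le_min.
      by move=> [/andP[-> ->] /andP[_ ->]].
    by move=> /andP[-> /andP[-> ->]].
  apply: filterS; first exact: (ae_filter_ringOfSetsType mu).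
  move=> x hx /andP[x1 x2].
  have := hx x1; rewrite derive1_cst => -[_].
  by rewrite /g patchE mem_set //= in_itv /= x1 ltW.
apply: filterS (ae_foralln hN) => x hx.
apply: (hx (Num.truncn `|x|).+1).
by rewrite -ltr_norml; exact: truncnS_gt.
Qed.

End signed_indicators.

Lemma ae_and d (T : measurableType d) (R : realType) (mu : {measure set T -> \bar R})
  (P Q : T -> Prop) : {ae mu, forall x, P x} -> {ae mu, forall x, Q x} ->
  {ae mu, forall x, P x /\ Q x}.
Proof. by move=> hP hQ; apply: filterS2 hP hQ. Qed.

Section multiplication_operators.
Context d (T : measurableType d) (R : realType).
Variable mu : {measure set T -> \bar R}.
Implicit Types (p q : T -> R[i]) (u v : L2 mu).

(** Essential boundedness with an explicit constant, the form in which estimates use it;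
    [Linf_ebounded] derives it from a finite essential supremum. *)
Definition ebounded p : Prop :=
  cmeasurable p /\ exists M : R, {ae mu, forall x, cmod (p x) <= M}.

Definition Mult p u : L2 mu := L2_of mu (fun x => p x * L2_repr u x).

Lemma sint_mult p f (M : R) : cmeasurable p -> cmeasurable f -> 0 <= M ->
  {ae mu, forall x, cmod (p x) <= M} ->
  (sint mu (fun x => p x * f x)%R <= (M ^+ 2)%:E * sint mu f)%E.
Proof.
move=> mp mf M0 h; rewrite /sint -ge0_integralZl //.
- apply: ae_ge0_le_integral => //.
  + by move=> x _; rewrite lee_fin sqr_ge0.
  + by apply: measurable_cmod2; exact: cmeasurableM.
  + by move=> x _; rewrite -EFinM lee_fin mulr_ge0 ?sqr_ge0.
  + by apply: measurable_funeM; exact: measurable_cmod2.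
  + apply: filterS h => x h _; rewrite -EFinM lee_fin cmodM exprMn.
    by rewrite ler_wpM2r ?sqr_ge0 // ler_pXn2r ?nnegrE ?cmod_ge0.
- exact: measurable_cmod2.
- by move=> x _; rewrite lee_fin sqr_ge0.
- by rewrite lee_fin sqr_ge0.
Qed.

Lemma ebounded_ge0 p : ebounded p ->
  exists2 M : R, 0 <= M & {ae mu, forall x, cmod (p x) <= M}.
Proof.
move=> [_ [M hM]]; exists (Num.max M 0); first by rewrite le_max lexx orbT.
by apply: filterS hM => x h; rewrite le_max h.
Qed.

Lemma sqi_mult p f : ebounded p -> cLfun mu 2%:E f -> cLfun mu 2%:E (fun x => p x * f x).
Proof.
move=> bp /sqiP [mf sf]; have [mp _] := bp; have [M M0 hM] := ebounded_ge0 bp.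
apply/sqiP; split; first exact: cmeasurableM.
apply: le_lt_trans (sint_mult mp mf M0 hM) _.
by rewrite lte_mul_pinfty // lee_fin sqr_ge0.
Qed.

Lemma MultE p u : ebounded p -> {ae mu, forall x, L2_repr (Mult p u) x = p x * L2_repr u x}.
Proof. by move=> bp; apply: L2_ofK; apply: sqi_mult => //; exact: L2_reprP. Qed.

Lemma nrm_Mult p u (M : R) : cmeasurable p -> 0 <= M ->
  {ae mu, forall x, cmod (p x) <= M} -> nrm (Mult p u) <= M * nrm u.
Proof.
move=> mp M0 hM; have bp : ebounded p by split => //; exists M.
rewrite -(@ler_pXn2r _ 2) ?nnegrE ?nrm_ge0 ?mulr_ge0 ?nrm_ge0 // -lee_fin nrm_L2_of.
  rewrite exprMn EFinM nrm_sint; apply: sint_mult => //; exact: cmeasurable_repr.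
by apply: sqi_mult => //; exact: L2_reprP.
Qed.

Lemma bop_Mult p : ebounded p -> bop (Mult p).
Proof.
move=> bp; have [mp _] := bp; have [M M0 hM] := ebounded_ge0 bp; split.
  move=> a u v; apply: L2_ext.
  have h := ae_and (MultE (a *: u + v) bp) (ae_and (MultE u bp) (MultE v bp)).
  have h2 := ae_and (L2_addE (a *: u) v) (L2_scaleE a u).
  have h3 := ae_and (L2_addE (a *: Mult p u) (Mult p v)) (L2_scaleE a (Mult p u)).
  apply: filterS (ae_and h (ae_and h2 h3)) => x [[-> [e1 e2]] [[-> ->] [-> ->]]].
  by rewrite e1 e2 mulrDr mulrCA.
by exists M => // u; exact: nrm_Mult.
Qed.

Lemma Mult_ae p q u : ebounded p -> ebounded q -> {ae mu, forall x, p x = q x} ->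
  Mult p u = Mult q u.
Proof.
move=> bp bq h; apply: L2_ext.
by apply: filterS3 h (MultE u bp) (MultE u bq) => x -> -> ->.
Qed.

Lemma eboundedM p q : ebounded p -> ebounded q -> ebounded (fun x => p x * q x).
Proof.
move=> bp bq; have [M M0 hM] := ebounded_ge0 bp; have [N N0 hN] := ebounded_ge0 bq.
split; first by apply: cmeasurableM; [case: bp|case: bq].
exists (M * N); apply: filterS2 hM hN => x h1 h2.
by rewrite cmodM ler_pM ?cmod_ge0.
Qed.

Lemma eboundedD p q : ebounded p -> ebounded q -> ebounded (fun x => p x + q x).
Proof.
move=> [mp [M hM]] [mq [N hN]]; split; first exact: cmeasurableD.
exists (M + N); apply: filterS2 hM hN => x h1 h2.
by apply: le_trans (cmodD _ _) _; exact: lerD.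
Qed.

Lemma ebounded_cst c : ebounded (fun=> c).
Proof. by split; [exact: cmeasurable_cst|exists (cmod c); exact: aeW]. Qed.

Lemma eboundedB p q : ebounded p -> ebounded q -> ebounded (fun x => p x - q x).
Proof.
move=> bp bq; have := eboundedD bp (eboundedM (ebounded_cst (-1)) bq).
by rewrite (_ : (fun x => _) = (fun x => p x - q x)) //; apply/funext => x; rewrite mulN1r.
Qed.

Lemma ebounded_conj p : ebounded p -> ebounded (fun x => (p x)^*).
Proof.
move=> [mp [M hM]]; split; first exact: cmeasurable_conj.
by exists M; apply: filterS hM => x; rewrite cmod_conj.
Qed.

Lemma Mult_comp p q u : ebounded p -> ebounded q ->
  Mult p (Mult q u) = Mult (fun x => p x * q x) u.
Proof.
move=> bp bq; apply: L2_ext.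
apply: filterS3 (MultE (Mult q u) bp) (MultE u bq) (MultE u (eboundedM bp bq)) => x -> -> ->.
by rewrite mulrA.
Qed.

Lemma MultD p q u : ebounded p -> ebounded q ->
  Mult (fun x => p x + q x) u = Mult p u + Mult q u.
Proof.
move=> bp bq; apply: L2_ext.
have h := ae_and (MultE u (eboundedD bp bq)) (L2_addE (Mult p u) (Mult q u)).
apply: filterS3 h (MultE u bp) (MultE u bq) => x [-> ->] -> ->.
by rewrite mulrDl.
Qed.

Lemma Mult_cst c u : Mult (fun=> c) u = c *: u.
Proof.
apply: L2_ext; apply: filterS2 (MultE u (ebounded_cst c)) (L2_scaleE c u) => x -> ->.
by [].
Qed.

Lemma dot_Mult p u v : ebounded p ->
  dot (Mult p u) v = dot u (Mult (fun x => (p x)^*) v).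
Proof.
move=> bp; have bp' := ebounded_conj bp; have [mp _] := bp.
apply: cint_ae.
- by apply: cmeasurableM; [|apply: cmeasurable_conj]; exact: cmeasurable_repr.
- by apply: cmeasurableM; [|apply: cmeasurable_conj]; exact: cmeasurable_repr.
- apply: filterS2 (MultE u bp) (MultE v bp') => x -> ->.
  by rewrite conjM conjcK mulrCA mulrA.
Qed.

End multiplication_operators.

Section step_functions.
Context (R : realType).
Local Notation mu := (@lebesgue_measure R).
Local Notation V := (L2 mu).

Lemma weak_zero (u : V) : (forall a, dot u (chi a) = 0) -> u = 0.
Proof.
move=> h; have mc c := cmeasurable_real (@measurable_chif R c).
have mr := cmeasurable_repr u.
have cb c : cintble mu (fun x : R => L2_repr u x * ((chif c x)%:C)^*).
  by apply: sqi_mul; [exact: L2_reprP|exact: sqi_chif].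
have h0 c : cint mu (fun x : R => L2_repr u x * ((chif c x)%:C)^*) = 0.
  by rewrite -(h c) (@dot_ae _ _ _ mu _ _ _ _ mr (mc c) (aeW _ (fun=> erefl)) (chiE c)).
have key (p : R[i] -> R) : measurable_fun setT (fun x : R => p (L2_repr u x)) ->
   (forall z (r : R), p (z * (r%:C)^*) = r * p z) ->
   (forall f, cintble mu f -> mu.-integrable setT (EFin \o (fun x : R => p (f x)))) ->
   (forall c, \int[mu]_x p (L2_repr u x * ((chif c x)%:C)^*) = 0) ->
   {ae mu, forall x : R, p (L2_repr u x) = 0}.
  move=> mp pZ pI p0.
  have ip c : mu.-integrable setT (EFin \o (fun x : R => chif c x * p (L2_repr u x))).
    by have := pI _ (cb c); apply: eq_integrable => // x _ /=; rewrite pZ.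
  apply: real_weak_zero => //.
    move=> a b; have [ab|ba] := leP a b; last first.
      by rewrite set_itv_ge ?bnd_simp -?leNgt ?ltW //; exact: integrable_set0.
    apply: (iffRL (@integrable_mkcond _ _ _ mu _ _ (measurable_itv `]a, b]))).
    have := integrableB measurableT (ip b) (ip a).
    apply: eq_integrable => // x _ /=; rewrite -EFinB -mulrBl chif_sub // patchE mem_setE in_itv /=.
    by case: (_ && _); rewrite ?mul1r ?mul0r.
  move=> a; rewrite -(p0 a); congr fine; apply: eq_integral => x _.
  by rewrite pZ.
have aR : {ae mu, forall x : R, complex.Re (L2_repr u x) = 0}.
  apply: key; [exact: mr.1| |exact: cintble_Re|].
    by move=> z r; rewrite conjc_real mulrC ReZ.
  by move=> c; have := congr1 (@complex.Re R) (h0 c).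
have aI : {ae mu, forall x : R, complex.Im (L2_repr u x) = 0}.
  apply: key; [exact: mr.2| |exact: cintble_Im|].
    by move=> z r; rewrite conjc_real mulrC ImM /= mul0r addr0.
  by move=> c; have := congr1 (@complex.Im R) (h0 c).
apply: L2_ext; apply: filterS (ae_and (ae_and aR aI) (@L2_zeroE _ _ _ mu)).
by move=> x [[e1 e2] ->]; exact: complexP.
Qed.

Inductive stepf : V -> Prop :=
| step0 : stepf 0
| stepS a c s : stepf s -> stepf (c *: chi a + s).

Lemma stepD s t : stepf s -> stepf t -> stepf (s + t).
Proof.
elim=> [|a c s' _ IH] ht; first by rewrite add0r.
by rewrite -addrA; apply: stepS; exact: IH.
Qed.

Lemma stepZ a s : stepf s -> stepf (a *: s).
Proof.
elim=> [|b c s' _ IH]; first by rewrite scaler0; exact: step0.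
by rewrite scalerDr scalerA; exact: stepS.
Qed.

Lemma step_chi a : stepf (chi a).
Proof. by rewrite -[chi a]addr0 -[chi a]scale1r; apply: stepS; exact: step0. Qed.

Lemma step_dense u (e : R) : 0 < e -> exists2 s, stepf s & nrm (u - s) <= e.
Proof.
apply: (total_dense (L2_inner mu)); [exact: L2_complete|exact: step0|exact: stepD|exact: stepZ|].
by move=> w h; apply: weak_zero => a; apply: h; exact: step_chi.
Qed.

(** By density of step functions. Operator identities on L^2(R), such as the inversion formula, are
    checked through it on the functions chi a alone. *)
Lemma bop_ext (Y : normedModType R[i]) (A : V -> Y) : bop A ->
  (forall a, A (chi a) = 0) -> forall u, A u = 0.
Proof.
move=> bA h u; apply: nrm_small => e e0; have [C C0 hC] := bop_bound bA.
have [s ss hs] := step_dense u (divr_gt0 e0 C0).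
have As : A s = 0.
  elim: ss => [|a c t _ IH]; first exact: bop0.
  by rewrite (bopD _ _ bA) (bopZ _ _ bA) h scaler0 IH addr0.
rewrite -[A u]subr0 -As -(bopB _ _ bA); apply: le_trans (hC _) _.
by rewrite mulrC -ler_pdivlMr.
Qed.

End step_functions.

(** * Complex differentiability and boundary integrals *)

Section complex_exponential.
Context (R : realType).
Implicit Types (x y t : R) (z w : R[i]).

Lemma sin_le_abs t : `|sin t| <= `|t|.
Proof.
have h x : 0 < x -> `|sin x| <= x.
  move=> x0; have [c _] : exists2 c, c \in `]0, x[ & sin x - sin 0 = cos c * (x - 0).
    apply: MVT => //; last by apply: continuous_subspaceT => ?; exact: continuous_sin.
  rewrite sin0 !subr0 => ->; rewrite normrM [`|x|]gtr0_norm // ler_piMl ?(ltW x0) //.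
  by rewrite ler_norml cos_geN1 cos_le1.
have [t0|t0|->] := ltgtP t 0; last by rewrite sin0.
  by rewrite -normrN -sinN -[`|t|]normrN [`|- t|]gtr0_norm ?oppr_gt0 // h ?oppr_gt0.
by rewrite [`|t|]gtr0_norm // h.
Qed.

Lemma one_sub_cos t : 1 - cos t = 2 * sin (t / 2) ^+ 2.
Proof.
have -> : cos t = cos (t / 2 + t / 2) by rewrite -splitr.
by rewrite cosD; have := cos2Dsin2 (t / 2); rewrite -!expr2; lra.
Qed.

Lemma one_sub_cos_le t : 1 - cos t <= t ^+ 2 / 2.
Proof.
rewrite one_sub_cos; have := sin_le_abs (t / 2).
rewrite -(@ler_pXn2r _ 2) ?nnegrE // !real_normK ?num_real // => h.
have -> : t ^+ 2 / 2 = 2 * (t / 2) ^+ 2 by field.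
by rewrite ler_pM2l.
Qed.

Lemma expiD x y : expi (x + y) = expi x * expi y.
Proof.
apply: complexP; rewrite ?(ReM, ImM) /= ?cosD ?sinD //.
by rewrite addrC [sin x * _]mulrC [cos x * sin _]mulrC; ring.
Qed.

Lemma cmod_expi x : cmod (expi x) = 1.
Proof. by rewrite /= cos2Dsin2 sqrtr1. Qed.

Lemma conj_expi x : (expi x)^* = expi (- x).
Proof. by rewrite /expi cosN sinN. Qed.

Lemma expi0 : expi (0 : R) = 1.
Proof. by rewrite /expi cos0 sin0. Qed.

Lemma cmod_expi_sub1 x : cmod (expi x - 1) ^+ 2 = 2 * (1 - cos x).
Proof.
rewrite cmod_sqr ReD ImD ReN ImN /=; have := cos2Dsin2 x; rewrite !expr2; nra.
Qed.

Definition cexp z : R[i] := (expR (complex.Re z))%:C * expi (complex.Im z).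

Lemma cexpD z w : cexp (z + w) = cexp z * cexp w.
Proof.
by rewrite /cexp ReD ImD expRD expiD rmorphM /= mulrACA.
Qed.

Lemma cmod_cexp z : cmod (cexp z) = expR (complex.Re z).
Proof. by rewrite cmodM cmod_expi mulr1 cmod_real ger0_norm ?expR_ge0. Qed.

Lemma cexp0 : cexp 0 = 1.
Proof. by rewrite /cexp /= expR0 expi0 mulr1. Qed.

(** With z = x + i y, e^z - 1 = e^x (e^(i y) - 1) + (e^x - 1), and for x <= 0 the summands are at
    most |y| and |x|. *)
Lemma cexp_sub1_le z : complex.Re z <= 0 -> cmod (cexp z - 1) <= 2 * cmod z.
Proof.
move=> z0; have -> : cexp z - 1 =
    (expR (complex.Re z))%:C * (expi (complex.Im z) - 1) + ((expR (complex.Re z))%:C - 1).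
  by rewrite /cexp mulrBr mulr1 addrA subrK.
apply: le_trans (cmodD _ _) _; rewrite mulr_natl mulr2n lerD //.
  rewrite cmodM cmod_real ger0_norm ?expR_ge0 //.
  apply: (@le_trans _ _ (cmod (expi (complex.Im z) - 1))).
    by rewrite ler_piMl ?cmod_ge0 // -expR0 ler_expR.
  apply: le_trans _ (Im_le_cmod z).
  rewrite -(@ler_pXn2r _ 2) ?nnegrE ?cmod_ge0 // cmod_expi_sub1.
  rewrite real_normK ?num_real //; have := one_sub_cos_le (complex.Im z); lra.
rewrite -(rmorph1 (real_complex R)) -rmorphB cmod_real.
apply: le_trans _ (Re_le_cmod z); rewrite distrC ger0_norm; last first.
  by rewrite subr_ge0 -expR0 ler_expR.
by rewrite ler0_norm //; have := expR_ge1Dx (complex.Re z); lra.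
Qed.

End complex_exponential.

Section complex_derivative.
Context (R : realType).
Implicit Types (f g : R[i] -> R[i]) (z w : R[i]).

(** The first-order remainder form is the one that Goursat's argument estimates; [derivable_cdiff]
    obtains it from difference quotients. *)
Definition cdiff f z (D : R[i]) : Prop := forall e : R, 0 < e ->
  exists2 r : R, 0 < r & forall w, cmod (w - z) < r ->
    cmod (f w - f z - D * (w - z)) <= e * cmod (w - z).

Lemma derivable_cdiff f z : derivable (f : R[i]^o -> R[i]^o) z 1 ->
  exists D, cdiff f z D.
Proof.
move=> /cvg_ex [/= D hD]; exists D => e e0.
have e1 : 0 < e%:C :> R[i] by rewrite -(rmorph0 (real_complex R)) ltcR.
move/cvgrPdist_le: hD => /(_ _ e1); rewrite /prop_near1 /= => h.
have [r /= r0 hr] : nbhs_ball (0 : R[i]^o) (fun h => h != 0 -> `|D - h^-1 *: (f (h *: 1 + z) - f z)| <= e%:C).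
  exact: h.
move: r0; rewrite ltcE /= => /andP[/eqP ri r0].
exists (complex.Re r) => // w wr.
have [->|wz] := eqVneq w z; first by rewrite !subrr mulr0 subr0 cmod0 mulr0.
have := hr (w - z); rewrite subr_eq0 wz => /(_ _ isT).
rewrite -ball_normE /ball_ /= sub0r normrN normcE_cmod.
have -> : r = (complex.Re r)%:C by case: (r) ri => a b /= ->.
rewrite ltcR => /(_ wr).
rewrite normcE_cmod lecr -[_ *: 1]/(_ * 1) mulr1 subrK => hh.
have -> : f w - f z - D * (w - z) = - ((D - (w - z)^-1 * (f w - f z)) * (w - z)).
  by field; rewrite subr_eq0.
by rewrite cmodN cmodM ler_wpM2r ?cmod_ge0.
Qed.

Lemma cdiff_cont f z D : cdiff f z D -> forall e : R, 0 < e ->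
  exists2 r : R, 0 < r & forall w, cmod (w - z) < r -> cmod (f w - f z) <= e.
Proof.
move=> h e e0; have [r r0 hr] := h 1 ltr01.
pose C := cmod D + 1; have C0 : 0 < C by have := cmod_ge0 D; rewrite /C; lra.
exists (Num.min r (e / C)); first by rewrite lt_min r0 divr_gt0.
move=> w; rewrite lt_min => /andP[wr we].
have -> : f w - f z = (f w - f z - D * (w - z)) + D * (w - z) by rewrite subrK.
apply: le_trans (cmodD _ _) _; rewrite cmodM.
have := hr w wr; move: we; rewrite ltr_pdivlMr // /C.
by have := cmod_ge0 (w - z); have := cmod_ge0 D; nra.
Qed.

Lemma cdiff_cst (c : R[i]) z : cdiff (fun=> c) z 0.
Proof.
by move=> e e0; exists 1 => // w _; rewrite mul0r !subrr cmod0 mulr_ge0 ?cmod_ge0 ?ltW.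
Qed.

Lemma cdiff_id z : cdiff (fun w => w) z 1.
Proof.
by move=> e e0; exists 1 => // w _; rewrite mul1r subrr cmod0 mulr_ge0 ?cmod_ge0 ?ltW.
Qed.

Lemma cdiffD f g z D E : cdiff f z D -> cdiff g z E ->
  cdiff (fun w => f w + g w) z (D + E).
Proof.
move=> hf hg e e0; have e2 : 0 < e / 2 by rewrite divr_gt0.
have [r r0 hr] := hf _ e2; have [s s0 hs] := hg _ e2.
exists (Num.min r s); first by rewrite lt_min r0.
move=> w; rewrite lt_min => /andP[wr ws].
have -> : f w + g w - (f z + g z) - (D + E) * (w - z) =
  (f w - f z - D * (w - z)) + (g w - g z - E * (w - z)) by ring.
apply: le_trans (cmodD _ _) _.
by have := hr w wr; have := hs w ws; lra.
Qed.

Lemma cdiffM f g z D E : cdiff f z D -> cdiff g z E ->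
  cdiff (fun w => f w * g w) z (D * g z + f z * E).
Proof.
move=> hf hg e e0.
have bf := cmod_ge0 (f z); have bg := cmod_ge0 (g z); have bE := cmod_ge0 E.
have bD := cmod_ge0 D.
(* K dominates |f z|, |g z| and 1 + |D|; the remainder of the product splits into three terms, each
   allotted a third of [e]. *)
pose K := cmod (f z) + cmod (g z) + cmod D + 1.
have K0 : 0 < K by rewrite /K; lra.
have e2 : 0 < e / (3 * K) by rewrite divr_gt0 // mulr_gt0.
have [r r0 hr] := hf _ e2; have [s s0 hs] := hg _ e2.
have [p p0 hp] := cdiff_cont hg e2; have [q q0 hq] := hf 1 ltr01.
exists (Num.min (Num.min r s) (Num.min p q)); first by rewrite !lt_min r0 s0 p0 q0.
move=> w; rewrite !lt_min => /andP[/andP[wr ws] /andP[wp wq]].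
have -> : f w * g w - f z * g z - (D * g z + f z * E) * (w - z) =
  (f w - f z - D * (w - z)) * g z + f z * (g w - g z - E * (w - z)) +
  (f w - f z) * (g w - g z) by ring.
have h1 := hr w wr; have h2 := hs w ws; have h3 := hp w wp; have h4 := hq w wq.
have h5 : cmod (f w - f z) <= (1 + cmod D) * cmod (w - z).
  have -> : f w - f z = (f w - f z - D * (w - z)) + D * (w - z) by rewrite subrK.
  by apply: le_trans (cmodD _ _) _; rewrite cmodM mulrDl lerD2r.
apply: le_trans (cmodD _ _) _; apply: le_trans (lerD (cmodD _ _) (lexx _)) _.
rewrite !cmodM.
have bw := cmod_ge0 (w - z).
have i1 : cmod (f w - f z - D * (w - z)) * cmod (g z) <= e / (3 * K) * cmod (w - z) * K.
  by apply: ler_pM; rewrite ?cmod_ge0 // /K; lra.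
have i2 : cmod (f z) * cmod (g w - g z - E * (w - z)) <= K * (e / (3 * K) * cmod (w - z)).
  by apply: ler_pM; rewrite ?cmod_ge0 // /K; lra.
have i3 : cmod (f w - f z) * cmod (g w - g z) <= (K * cmod (w - z)) * (e / (3 * K)).
  apply: ler_pM; rewrite ?cmod_ge0 //; apply: le_trans h5 _.
  by rewrite ler_wpM2r // /K; lra.
apply: le_trans (lerD (lerD i1 i2) i3) _.
by rewrite le_eqVlt; apply/orP; left; apply/eqP; field; rewrite gt_eqF.
Qed.

Lemma cdiffV z : z != 0 -> cdiff (fun w => w^-1) z (- (z ^- 2)).
Proof.
move=> z0 e e0; have zp := cmod_gt0 z0.
(* The first bound keeps |w| >= |z| / 2; the second then absorbs the remainder (w - z)^2 / (w
   z^2). *)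
pose r := Num.min (cmod z / 2) (e * cmod z ^+ 3 / 2).
have z3 : 0 < cmod z ^+ 3 by rewrite exprn_gt0.
have r0 : 0 < r by rewrite lt_min !divr_gt0 // mulr_gt0.
exists r => // w; rewrite lt_min => /andP[w1 w2].
have wl : cmod z / 2 <= cmod w.
  have := cmodD w (z - w); rewrite addrC subrK cmodC; lra.
have w0 : w != 0 by apply: contraTneq wl => ->; rewrite cmod0 -ltNge divr_gt0.
have wp := cmod_gt0 w0.
have -> : w^-1 - z^-1 - - z ^- 2 * (w - z) = (w - z) * (w - z) / (w * z ^+ 2).
  by field; rewrite z0.
rewrite !cmodM cmodV !cmodM mulrAC ler_wpM2r ?cmod_ge0 // ler_pdivrMr ?mulr_gt0 //.
apply: (@le_trans _ _ (e * (cmod z / 2 * (cmod z * cmod z)))).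
  by move: w2; rewrite !exprS expr0 mulr1; lra.
by rewrite ler_pM2l // ler_pM2r ?mulr_gt0.
Qed.

Lemma cdiff_cexp (c : R[i]) z : cdiff (fun w => cexp (c * w)) z (c * cexp (c * z)).
Proof.
(* reduction to the derivatives of expR, cos and sin at 0 *)
have der0 (u : R -> R) (l : R) : is_derive (0 : R) 1 u l -> forall e : R, 0 < e ->
    exists2 r : R, 0 < r & forall t, `|t| < r -> `|u t - u 0 - l * t| <= e * `|t|.
  move=> [du ul] e e0; move/cvg_ex: du => [m hm].
  have ml : m = l by rewrite -ul; apply/esym/cvg_lim.
  move/cvgrPdist_le: hm => /(_ e e0); rewrite /prop_near1 /= => h.
  have [r /= r0 hr] : nbhs_ball (0 : R) (fun h => h != 0 -> `|m - h^-1 *: (u (h *: 1 + 0) - u 0)| <= e).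
    exact: h.
  exists r => // t tr; have [->|t0] := eqVneq t 0.
    by rewrite mulr0 subrr subr0 normr0 mulr0.
  have := hr t; rewrite /ball /= sub0r normrN => /(_ tr t0).
  rewrite -[_ *: 1]/(_ * 1) mulr1 addr0 ml => hh.
  have -> : u t - u 0 - l * t = - ((l - t^-1 * (u t - u 0)) * t) by field.
  by rewrite normrN normrM ler_wpM2r.
have h0 e : 0 < e -> exists2 r : R, 0 < r & forall w, cmod w < r ->
    cmod (cexp w - 1 - w) <= e * cmod w.
  move=> e0; have e9 : 0 < e / 9 by rewrite divr_gt0.
  have m1 : 0 < Num.min 1 (e / 9) by rewrite lt_min ltr01.
  have [r1 r10 h1] := @der0 _ _ (is_derive_expR 0) _ m1.
  have [r2 r20 h2] := @der0 _ _ (is_derive_cos 0) _ e9.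
  have [r3 r30 h3] := @der0 _ _ (is_derive_sin 0) _ e9.
  exists (Num.min 1 (Num.min (Num.min r1 (e / 9)) (Num.min r2 r3))).
    by rewrite !lt_min ltr01 r10 e9 r20 r30.
  move=> [x y]; rewrite !lt_min => /andP[wl1 /andP[/andP[w1 we] /andP[w2 w3]]].
  have lx : `|x| <= cmod (x +i* y) by exact: Re_le_cmod (x +i* y).
  have ly : `|y| <= cmod (x +i* y) by exact: Im_le_cmod (x +i* y).
  set W := cmod (x +i* y) in wl1 w1 we w2 w3 lx ly *.
  have := h1 x (le_lt_trans lx w1); rewrite expR0 mul1r => k1.
  have := h2 y (le_lt_trans ly w2); rewrite cos0 sin0 oppr0 mul0r subr0 => k2.
  have := h3 y (le_lt_trans ly w3); rewrite sin0 subr0 cos0 mul1r => k3.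
  have W0 : 0 <= W by exact: cmod_ge0.
  have k1a : `|expR x - 1 - x| <= e / 9 * W.
    by apply: le_trans k1 _; apply: ler_pM; rewrite ?(ltW m1) ?ge_min ?lexx ?orbT.
  have k1b : `|expR x - 1 - x| <= `|x|.
    by apply: le_trans k1 _; rewrite ler_piMl // ge_min lexx.
  have ex3 : expR x <= 3.
    by have := ler_norm (expR x - 1 - x); have := ler_norm x; lra.
  have ex0 := expR_ge0 x.
  have ex1 : `|expR x - 1| <= 2 * W.
    have -> : expR x - 1 = (expR x - 1 - x) + x by rewrite subrK.
    by apply: le_trans (ler_normD _ _) _; lra.
  apply: le_trans (cmod_le_ReIm _) _; rewrite !(ReD, ImD, ReN, ImN) /cexp ReZ ImM /=.
  rewrite mul0r addr0.
  have -> : expR x * cos y - 1 - x = (expR x - 1 - x) + expR x * (cos y - 1) by ring.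
  have -> : expR x * sin y - 0 - y = expR x * (sin y - y) + y * (expR x - 1) by ring.
  apply: le_trans (lerD (ler_normD _ _) (ler_normD _ _)) _; rewrite !normrM.
  rewrite (ger0_norm ex0).
  have k2' : `|cos y - 1| <= e / 9 * W by apply: le_trans k2 _; rewrite ler_pM2l.
  have k3' : `|sin y - y| <= e / 9 * W by apply: le_trans k3 _; rewrite ler_pM2l.
  have j1 : expR x * `|cos y - 1| <= 3 * (e / 9 * W) by apply: ler_pM.
  have j2 : expR x * `|sin y - y| <= 3 * (e / 9 * W) by apply: ler_pM.
  have j3 : `|y| * `|expR x - 1| <= W * (2 * (e / 9)).
    apply: ler_pM => //; apply: le_trans ex1 _; lra.
  lra.
move=> e e0.
pose K := cmod (cexp (c * z)) * cmod c + 1.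
have K1 : 0 < K by rewrite /K ltr_wpDl // mulr_ge0 ?cmod_ge0.
have [r r0 hr] := h0 (e / K) (divr_gt0 e0 K1).
exists (r / (cmod c + 1)); first by rewrite divr_gt0 // ltr_wpDl ?cmod_ge0.
move=> w; rewrite ltr_pdivlMr ?ltr_wpDl ?cmod_ge0 // => wr.
have cw : c * w = c * z + c * (w - z) by ring.
rewrite {1}cw cexpD.
have -> : cexp (c * z) * cexp (c * (w - z)) - cexp (c * z) - c * cexp (c * z) * (w - z) =
   cexp (c * z) * (cexp (c * (w - z)) - 1 - c * (w - z)) by ring.
rewrite cmodM; apply: (@le_trans _ _ (cmod (cexp (c * z)) * (e / K * cmod (c * (w - z))))).
  rewrite ler_wpM2l ?cmod_ge0 //; apply: hr; rewrite cmodM.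
  by have := cmod_ge0 c; have := cmod_ge0 (w - z); nra.
rewrite cmodM (_ : _ * _ = (cmod (cexp (c * z)) * cmod c / K) * (e * cmod (w - z))); last by ring.
rewrite ler_piMl ?mulr_ge0 ?cmod_ge0 ?(ltW e0) // ler_pdivrMr // mul1r /K.
by rewrite lerDl.
Qed.

End complex_derivative.

Lemma aeS d (T : measurableType d) (R : realType) (mu : {measure set T -> \bar R})
  (P Q : T -> Prop) : (forall x, P x -> Q x) -> {ae mu, forall x, P x} ->
  {ae mu, forall x, Q x}.
Proof. by move=> h hP; apply: filterS hP. Qed.

Lemma Re_cint d (T : measurableType d) (R : realType) (mu : {measure set T -> \bar R})
  (f : T -> R[i]) : complex.Re (cint mu f) = \int[mu]_x complex.Re (f x).
Proof. by []. Qed.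

Lemma Im_cint d (T : measurableType d) (R : realType) (mu : {measure set T -> \bar R})
  (f : T -> R[i]) : complex.Im (cint mu f) = \int[mu]_x complex.Im (f x).
Proof. by []. Qed.

(** * Transforms of the signed indicators and their Gram matrix *)

Section gram_matrix.
Context (R : realType).
Local Notation mu := (@lebesgue_measure R).

Lemma integrable_oneDsqrV : mu.-integrable setT (EFin \o (fun x : R => (1 + x ^+ 2)^-1)).
Proof.
have c : continuous (fun x : R => (1 + x ^+ 2)^-1) by exact: continuous_oneDsqrV.
have p x : 0 <= (1 + x ^+ 2)^-1 :> R by rewrite invr_ge0 addr_ge0 ?sqr_ge0.
apply/integrableP; split; first by apply/measurable_EFinP; exact: continuous_measurable_fun.
rewrite (_ : (\int[mu]_x _)%E = (2%:E * (pi / 2)%:E)%E); first by rewrite -EFinM ltry.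
rewrite -integral0y_oneDsqr set_itvcy -ge0_symfun_integralT //.
- by apply: eq_integral => x _; rewrite /= ger0_norm.
- by move=> x; rewrite /= /oneDsqr sqrrN.
Qed.

(** Half of |hatf a x|^2 ([cmod_hatf]), with the default value 0 at x = 0. *)
Definition fej (a x : R) : R := (1 - cos (a * x)) / x ^+ 2.

Lemma fej_ge0 a x : 0 <= fej a x.
Proof. by rewrite divr_ge0 ?sqr_ge0 // subr_ge0 cos_le1. Qed.

Lemma measurable_inv : measurable_fun setT (fun x : R => x^-1).
Proof.
rewrite (_ : (fun x => _) = (fun x : R => x * ((x ^+ 2) `^ (-1)))).
  apply: measurable_funM => //.
  apply: (measurableT_comp (f := fun y : R => y `^ (-1))); first exact: measurable_powR.
  exact: measurable_funX.
apply/funext => x; rewrite powR_inv1 ?sqr_ge0 //.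
have [->|x0] := eqVneq x 0; first by rewrite invr0 mul0r.
by field.
Qed.

Lemma measurable_cosM a : measurable_fun setT (fun x : R => cos (a * x)).
Proof.
apply: (measurableT_comp (f := @cos R)); last exact: measurable_funM.
by apply: continuous_measurable_fun; exact: continuous_cos.
Qed.

Lemma measurable_sinM a : measurable_fun setT (fun x : R => sin (a * x)).
Proof.
apply: (measurableT_comp (f := @sin R)); last exact: measurable_funM.
by apply: continuous_measurable_fun; exact: continuous_sin.
Qed.

Lemma measurable_fej a : measurable_fun setT (fej a).
Proof.
rewrite /fej (_ : (fun x => _) = fun x => (1 - cos (a * x)) * (x^-1 * x^-1)).
  apply: measurable_funM; last by apply: measurable_funM; exact: measurable_inv.
  by apply: measurable_funB => //; exact: measurable_cosM.
by apply/funext => x; rewrite expr2 invfM.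
Qed.

Lemma fej_le a x : fej a x <= (a ^+ 2 / 2 + 2) * (1 + x ^+ 2)^-1.
Proof.
have [->|x0] := eqVneq x 0.
  by rewrite /fej expr0n invr0 mulr0 addr0 invr1 mulr1; have := sqr_ge0 a; lra.
have x2 : 0 < x ^+ 2 by rewrite exprn_even_gt0.
have x3 : 0 < 1 + x ^+ 2 by lra.
rewrite ler_pdivlMr // mulrDr mulr1.
have h1 := one_sub_cos_le (a * x).
have h2 : fej a x <= a ^+ 2 / 2 by rewrite ler_pdivrMr //; move: h1; rewrite exprMn; lra.
have h3 : fej a x * x ^+ 2 <= 2 by rewrite divfK ?gt_eqF //; have := cos_geN1 (a * x); lra.
lra.
Qed.

Lemma integrable_fej a : mu.-integrable setT (EFin \o fej a).
Proof.
have i := integrableZl measurableT (a ^+ 2 / 2 + 2) integrable_oneDsqrV.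
apply: le_integrable i => //; first by apply/measurable_EFinP; exact: measurable_fej.
move=> x _ /=; rewrite lee_fin (ger0_norm (fej_ge0 _ _)).
by apply: le_trans (fej_le a x) _; exact: ler_norm.
Qed.

(* The constant of Plancherel's theorem, equal to 2 pi; only its positivity
   matters. *)
Definition kap : R := 2 * \int[mu]_x fej 1 x.

(** The substitution of a x for x shows that the integral is homogeneous of degree one in a > 0, and
    [fej] is even in a; only the value at a = 1 enters, through [kap]. *)
Lemma Rint_fej a : \int[mu]_x fej a x = `|a| * (kap / 2).
Proof.
have pos b : 0 < b -> \int[mu]_x fej b x = b * (kap / 2).
  move=> b0.
  have i1 : (\int[mu]_x (fej 1 x)%:E = (kap / 2)%:E)%E.
    rewrite (_ : kap / 2 = \int[mu]_x fej 1 x); last by rewrite /kap; field.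
    by rewrite /Rintegral fineK //; exact: integrable_fin_num (integrable_fej 1).
  have := ge0_integral_scale b0 (f := EFin \o fej 1).
  move=> /(_ (iffRL (measurable_EFinP _ _) (measurable_fej 1)) (fun x => ltac:(by rewrite lee_fin fej_ge0))).
  rewrite i1 (_ : (\int[mu]_x _)%E = (b ^- 2)%:E * \int[mu]_x (fej b x)%:E)%E; last first.
    rewrite -ge0_integralZl //; first last.
    - by rewrite lee_fin invr_ge0 sqr_ge0.
    - by move=> x _; rewrite lee_fin fej_ge0.
    - by apply/measurable_EFinP; exact: measurable_fej.
    apply: eq_integral => x _; rewrite -EFinM; congr (_%:E).
    by rewrite /fej mul1r exprMn invfM mulrCA.
  move=> h; have h2 : (\int[mu]_x (fej b x)%:E = (b * (kap / 2))%:E)%E.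
    rewrite EFinM h muleA muleA -!EFinM.
    by rewrite (_ : b * b * b ^- 2 = 1) ?mul1e //; field; rewrite gt_eqF.
  by rewrite /Rintegral h2.
have [a0|a0|->] := ltgtP a 0.
- rewrite (ltr0_norm a0) -pos ?oppr_gt0 //; congr fine; apply: eq_integral => x _.
  by rewrite /fej mulNr cosN.
- by rewrite (gtr0_norm a0) pos.
- rewrite normr0 mul0r (_ : (fun x => _) = cst 0) ?Rintegral_cst ?mul0r //.
  by apply/funext => x; rewrite /fej mul0r cos0 subrr mul0r.
Qed.

(** If it vanished, [fej 1] would be zero almost everywhere, but it is nonzero on ]1, 2], which has
    measure 1. *)
Lemma kap_gt0 : 0 < kap.
Proof.
rewrite /kap mulr_gt0 // lt_def; apply/andP; split; last first.
  by apply: Rintegral_ge0 => x _; exact: fej_ge0.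
apply/negP => /eqP h0.
have i0 : (\int[mu]_x (fej 1 x)%:E = 0)%E.
  by rewrite -(fineK (integrable_fin_num measurableT (integrable_fej 1))) -[fine _]/(\int[mu]_x fej 1 x) h0.
have ae0 : {ae mu, forall x : R, fej 1 x = 0}.
  have m : measurable_fun setT (EFin \o fej 1) by apply/measurable_EFinP; exact: measurable_fej.
  have [h _] := @ae_eq_integral_abs _ _ _ mu _ measurableT _ m.
  apply: aeS (h _) => [x /(_ I) [] //|]; rewrite -i0.
  by apply: eq_integral => x _; rewrite /= ger0_norm ?fej_ge0.
have key (y : R) : 1 < y -> y <= 2 -> fej 1 y <> 0.
  move=> y1 y2; apply/eqP; rewrite /fej mul1r mulf_neq0 //; last first.
    by rewrite invr_eq0 sqrf_eq0; lra.
  rewrite one_sub_cos mulf_neq0 // sqrf_eq0 gt_eqF // sin_gt0_pi //.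
  by have := pi_ge2 R; lra.
move: ae0 => [N [mN N0 hN]].
have : (mu `]1%R, 2%R] <= mu N)%E.
  apply: le_measure; rewrite ?inE //.
  by move=> x /=; rewrite in_itv /= => /andP[x1 x2]; apply: hN => /=; exact: key.
rewrite N0 lebesgue_measure_itv /= lte_fin ltr1n /= -EFinB lee_fin; lra.
Qed.

Lemma ii_neq0 : (0 +i* 1) != 0 :> R[i].
Proof. by rewrite eq_complex /= oner_eq0 andbF. Qed.

(** The transform of [chif a] continued to complex z, that is, the signed integral of e^(i z t) for
    t from 0 to a. At z = 0, where that integral is a, division by zero gives the default value
    0. *)
Definition chat (a : R) (z : R[i]) : R[i] :=
  (cexp ((0 +i* a) * z) - 1) / ((0 +i* 1) * z).

Definition hatf (a x : R) : R[i] := chat a x%:C.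

Lemma hatfE a x : hatf a x = (sin (a * x) / x) +i* ((1 - cos (a * x)) / x).
Proof.
rewrite /hatf /chat; have [->|x0] := eqVneq x 0.
  by rewrite mulr0 invr0 !mulr0 invr0 mulr0.
have -> : cexp ((0 +i* a) * x%:C) = expi (a * x).
  rewrite /cexp ReM ImM /= !mulr0 !mul0r subrr expR0 mul1r add0r.
  by [].
apply: (mulIf (x := (0 +i* 1) * x%:C)); first by rewrite mulf_neq0 ?ii_neq0 ?fmorph_eq0.
rewrite mulfVK ?mulf_neq0 ?ii_neq0 ?fmorph_eq0 //.
by apply: complexP; rewrite !(ReD, ImD, ReM, ImM, ReN, ImN) /=; field.
Qed.

Lemma cmeasurable_hatf a : cmeasurable (hatf a).
Proof.
have m (f : R -> R) : measurable_fun setT f -> measurable_fun setT (fun x => f x / x).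
  by move=> mf; apply: measurable_funM => //; exact: measurable_inv.
split.
  rewrite (_ : _ \o _ = (fun x => sin (a * x) / x)); last by apply/funext => x; rewrite /comp hatfE.
  by apply: m; exact: measurable_sinM.
rewrite (_ : _ \o _ = (fun x => (1 - cos (a * x)) / x)); last by apply/funext => x; rewrite /comp hatfE.
by apply: m; apply: measurable_funB => //; exact: measurable_cosM.
Qed.

Lemma Re_hatf a b x :
  complex.Re (hatf a x * (hatf b x)^*) = fej a x + fej b x - fej (a - b) x.
Proof.
rewrite !hatfE /fej (mulrBl x a b) cosB ReM Re_conj Im_conj /=.
have [->|x0] := eqVneq x 0; first by rewrite !expr0n !invr0 !mulr0; ring.
by field.
Qed.

Lemma cmod_hatf a x : cmod (hatf a x) ^+ 2 = 2 * fej a x.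
Proof.
have := Re_hatf a a x; rewrite mul_conj /= => ->.
by rewrite subrr {3}/fej mul0r cos0 subrr mul0r; ring.
Qed.

Lemma sqi_hatf a : cLfun mu 2%:E (hatf a).
Proof.
apply/sqiP; split; first exact: cmeasurable_hatf.
rewrite /sint; under eq_integral do rewrite cmod_hatf.
have i := integrableZl measurableT 2 (integrable_fej a).
by have /integrableP[_] := i; apply: le_lt_trans; apply: ge0_le_integral => //;
   [move=> x _; rewrite lee_fin mulr_ge0 // fej_ge0
   |by case/integrableP: i
   |by apply: measurableT_comp => //; case/integrableP: i
   |move=> x _; rewrite lee_abs].
Qed.

Definition hat a : L2 mu := L2_of mu (hatf a).

Lemma hatE a : {ae mu, forall x, L2_repr (hat a) x = hatf a x}.
Proof. exact: L2_ofK (sqi_hatf a). Qed.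

(** As in [dot_chi], the real part of the product is a polarization, here of [fej], whose integral
    is proportional to |a|; the imaginary part is odd in x. This is Plancherel's identity on step
    functions. *)
Lemma dot_hat a b : dot (hat a) (hat b) = kap%:C * dot (chi a) (chi b).
Proof.
rewrite dot_chi (@dot_ae _ _ _ mu _ _ _ _ (cmeasurable_hatf a) (cmeasurable_hatf b) (hatE a) (hatE b)).
have cb := sqi_mul (sqi_hatf a) (sqi_hatf b).
rewrite -rmorphM; apply: complexP; rewrite ?Re_cint ?Im_cint.
  transitivity (\int[mu]_x (fej a x + fej b x - fej (a - b) x)).
    by congr fine; apply: eq_integral => x _; rewrite Re_hatf.
  have iD := integrableD measurableT (integrable_fej a) (integrable_fej b).
  rewrite RintegralB //; last exact: integrable_fej.
  rewrite RintegralD //; [|exact: integrable_fej|exact: integrable_fej].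
  by rewrite !Rint_fej /=; field.
have [cm _] := cb; have mI := cm.2.
have odd (x : R) : complex.Im (hatf a (- x) * (hatf b (- x))^*) = - complex.Im (hatf a x * (hatf b x)^*).
  rewrite !hatfE !ImM !Re_conj !Im_conj /= !mulrN !sinN !cosN invrN; ring.
have e : \int[mu]_x complex.Im (hatf a x * (hatf b x)^*) = - \int[mu]_x complex.Im (hatf a x * (hatf b x)^*).
  rewrite -[RHS]mulN1r -RintegralZl //; last exact: (cintble_Im cb).
  rewrite {1}/Rintegral integral_oppr; last exact/measurable_EFinP.
  by congr fine; apply: eq_integral => x _; rewrite odd mulN1r.
by move: e; move: (\int[mu]_x _) => t /=; lra.
Qed.

End gram_matrix.

Section interval_integrals.
Context (R : realType).
Local Notation mu := (@lebesgue_measure R).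
Implicit Types (g : R -> R[i]) (f : R[i] -> R[i]).

Definition iv (a b t : R) : R[i] := ((a <= t <= b)%R%:R)%:C.

(** The indicator factor turns an integral over [a, b] into one over R, so that the lemmas on [cint]
    apply. *)
Definition cI a b g : R[i] := cint mu (fun t => iv a b t * g t).

Definition okI a b g : Prop := cintble mu (fun t => iv a b t * g t).

Lemma cmod_iv a b t : cmod (iv a b t) = (a <= t <= b)%R%:R.
Proof. by rewrite cmod_real ger0_norm. Qed.

Lemma measurable_ind a b : measurable_fun setT (fun t : R => (a <= t <= b)%R%:R : R).
Proof.
rewrite (_ : (fun x => _) = \1_`[a, b]); first exact: measurable_indic.
by apply/funext => x; rewrite indicE mem_setE in_itv.
Qed.

Lemma cmeasurable_iv a b : cmeasurable (iv a b).
Proof. by apply: cmeasurable_real; exact: measurable_ind. Qed.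

Lemma integral_cc (p q : R) : p <= q ->
  (\int[mu]_x ((p <= x <= q)%R%:R)%:E = (q - p)%:E)%E.
Proof.
move=> pq; transitivity (\int[mu]_x (\1_`[p, q] x)%:E)%E.
  by apply: eq_integral => x _; rewrite indicE mem_setE in_itv.
transitivity (mu `[p, q]); first by rewrite integral_indic // setIT.
rewrite lebesgue_measure_itv /= lte_fin.
by case: ltP => // qp; congr (_%:E); lra.
Qed.

Lemma integrable_cc (p q : R) : mu.-integrable setT (EFin \o (fun x : R => (p <= x <= q)%R%:R)).
Proof.
apply/integrableP; split; first by apply/measurable_EFinP; exact: measurable_ind.
have [pq|qp] := leP p q.
  rewrite (_ : (\int[mu]_x _)%E = (q - p)%:E) ?ltry // -(integral_cc pq).
  by apply: eq_integral => x _; rewrite /= ger0_norm.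
rewrite (_ : (\int[mu]_x _)%E = 0%E) ?ltry //.
apply: integral0_eq => x _ /=; rewrite (_ : _ && _ = false) ?normr0 //.
by apply/negbTE/negP => /andP[h1 h2]; move: (le_trans h1 h2); rewrite leNgt qp.
Qed.

Lemma cintble_ReIm (h : R -> R[i]) :
  mu.-integrable setT (EFin \o (fun x => complex.Re (h x))) ->
  mu.-integrable setT (EFin \o (fun x => complex.Im (h x))) -> cintble mu h.
Proof.
move=> i1 i2; apply: (@cintble_le _ _ _ mu _ (fun x => `|complex.Re (h x)| + `|complex.Im (h x)|)).
- by split; apply/measurable_EFinP; [case/integrableP: i1|case/integrableP: i2].
- have := integrableD measurableT (integrable_abse i1) (integrable_abse i2).
  by apply: eq_integrable => // x _ /=; rewrite EFinD.
- by move=> x; exact: cmod_le_ReIm.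
Qed.

Definition ccont g (t : R) : Prop := forall e : R, 0 < e ->
  exists2 r : R, 0 < r & forall s, `|s - t| < r -> cmod (g s - g t) <= e.

Lemma okI_cont a b g : (forall t, a <= t <= b -> ccont g t) -> okI a b g.
Proof.
move=> h.
have key (p : R[i] -> R) : (forall z w, p z - p w = p (z - w)) -> (forall z, `|p z| <= cmod z) ->
    (forall (r : R) z, p (r%:C * z) = r * p z) ->
    mu.-integrable setT (EFin \o (fun x : R => p (iv a b x * g x))).
  move=> pB pl pZ.
  have c : {within `[a, b], continuous (p \o g)}.
    apply: continuous_in_subspaceT => t; rewrite inE /= in_itv /= => tab.
    apply/cvgrPdist_le => e e0; have [r r0 hr] := h t tab e e0.
    exists r => // s /= st; rewrite pB; apply: le_trans (pl _) _.
    by rewrite cmodC; apply: hr; rewrite distrC.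
  have i := continuous_compact_integrable (@segment_compact R a b) c.
  have := iffLR (@integrable_mkcond _ _ _ mu _ _ (measurable_itv `[a, b])) i.
  apply: eq_integrable => // x _; rewrite /= patchE mem_setE in_itv /= pZ.
  by case: (_ && _); rewrite ?mul1r ?mul0r.
apply: cintble_ReIm.
- by apply: key => [z w|z|r z]; [rewrite ReD ReN|exact: Re_le_cmod|rewrite ReZ].
- apply: key => [z w|z|r z]; [by rewrite ImD ImN|exact: Im_le_cmod|].
  by rewrite ImM /= mul0r addr0.
Qed.

Lemma cI_bound a b g (M : R) : a <= b -> okI a b g -> 0 <= M ->
  (forall t, a <= t <= b -> cmod (g t) <= M) -> cmod (cI a b g) <= M * (b - a).
Proof.
move=> ab ok M0 h; apply: le_trans (cmod_cint ok) _.
have -> : M * (b - a) = \int[mu]_x (M * (a <= x <= b)%R%:R).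
  rewrite RintegralZl //; last exact: integrable_cc.
  by rewrite /Rintegral integral_cc.
apply: le_Rintegral => //.
- by case: ok.
- exact: (integrableZl measurableT M (integrable_cc a b)).
- move=> x _; rewrite cmodM cmod_iv.
  by case: (boolP (a <= x <= b)) => hx; rewrite ?mul1r ?mulr1 ?mul0r ?mulr0 // h.
Qed.

Lemma ae_neq (b : R) : {ae mu, forall x : R, x <> b}.
Proof.
exists [set b]; split; [exact: measurable_set1|exact: lebesgue_measure_set1|].
by move=> x /= /contrapT.
Qed.

Lemma cI_split a b c g : a <= b -> b <= c -> okI a c g -> okI a b g -> okI b c g ->
  cI a c g = cI a b g + cI b c g.
Proof.
move=> ab bc o1 o2 o3; rewrite /cI -cintD //; apply: cint_ae.
- by case: o1.
- by apply: cmeasurableD; [case: o2|case: o3].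
- apply: aeS (ae_neq b) => x xb.
  suff key (y : R) : y <> b -> iv a c y = iv a b y + iv b c y by rewrite (key x xb) mulrDl.
  move=> yb; rewrite /iv -rmorphD -natrD; congr (_%:R%:C).
  case: (ltgtP y b) yb => // yb _; rewrite ?andbT ?andbF ?addn0 ?add0n.
    by rewrite (le_trans (ltW yb) bc) andbT.
  by rewrite (le_trans ab (ltW yb)).
Qed.

Lemma cI_sub a b g h : okI a b g -> okI a b h ->
  cI a b (fun t => g t - h t) = cI a b g - cI a b h.
Proof.
move=> og oh; rewrite /cI -[X in _ = _ + X]mulN1r -cintZ // -cintD //; last exact: cintbleZ.
by apply: eq_cint => t; rewrite mulN1r mulrBr.
Qed.

Lemma cI_cst a b (c : R[i]) : a <= b -> cI a b (fun=> c) = c * (b - a)%:C.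
Proof.
move=> ab; rewrite /cI.
have ii : cintble mu (iv a b).
  split; first exact: cmeasurable_iv.
  have := integrable_cc a b; apply: eq_integrable => // x _.
  by rewrite /comp cmod_iv.
rewrite (_ : (fun t => _) = (fun t => c * iv a b t)); last by apply/funext => t; rewrite mulrC.
rewrite cintZ //; congr (_ * _); apply: complexP => /=.
  by rewrite /Rintegral integral_cc.
by rewrite (_ : (fun t => _) = cst 0) // Rintegral_cst ?mul0r.
Qed.

End interval_integrals.

(** * Goursat's theorem for rectangles in the upper half-plane *)

Section goursat.
Context (R : realType).
Variable f : R[i] -> R[i].
Hypothesis df : forall z, 0 < complex.Im z -> exists D, cdiff f z D.

(** The contour integral of g counterclockwise around the boundary of [a, b] x [c, d]. *)
Definition rect (g : R[i] -> R[i]) (a b c d : R) : R[i] :=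
  cI a b (fun x => g (x +i* c)) - cI a b (fun x => g (x +i* d)) +
  (0 +i* 1) * (cI c d (fun y => g (b +i* y)) - cI c d (fun y => g (a +i* y))).

Lemma cdiff_cont_hor (g : R[i] -> R[i]) D x y : cdiff g (x +i* y) D ->
  ccont (fun t => g (t +i* y)) x.
Proof.
move=> h e e0; have [r r0 hr] := cdiff_cont h e0; exists r => // s hs.
apply: hr; have -> : (s +i* y) - (x +i* y) = (s - x)%:C.
  by apply: complexP; rewrite /= ?subrr.
by rewrite cmod_real.
Qed.

Lemma cdiff_cont_ver (g : R[i] -> R[i]) D x y : cdiff g (x +i* y) D ->
  ccont (fun t => g (x +i* t)) y.
Proof.
move=> h e e0; have [r r0 hr] := cdiff_cont h e0; exists r => // s hs.
apply: hr; have -> : (x +i* s) - (x +i* y) = (0 +i* 1) * (s - y)%:C.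
  by apply: complexP; rewrite ?(ReM, ImM) /=; ring.
by rewrite cmodM cmod_real /= expr0n expr1n add0r sqrtr1 mul1r.
Qed.

Let okh (a b c : R) : 0 < c -> okI a b (fun x => f (x +i* c)).
Proof.
by move=> c0; apply: okI_cont => t _; have [D hD] := @df (t +i* c) c0; exact: cdiff_cont_hor hD.
Qed.

Let okv (a c d : R) : 0 < c -> okI c d (fun y => f (a +i* y)).
Proof.
move=> c0; apply: okI_cont => t /andP[ct _].
by have [D hD] := @df (a +i* t) (lt_le_trans c0 ct); exact: cdiff_cont_ver hD.
Qed.

Lemma rect_split_hor a m b c d : a <= m -> m <= b -> 0 < c -> c <= d ->
  rect f a b c d = rect f a m c d + rect f m b c d.
Proof.
move=> am mb c0 cd; have d0 := lt_le_trans c0 cd.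
rewrite /rect (cI_split am mb (okh a b c0) (okh a m c0) (okh m b c0)).
rewrite (cI_split am mb (okh a b d0) (okh a m d0) (okh m b d0)).
move: (cI a m _) (cI m b _) (cI a m _) (cI m b _) (cI c d _) (cI c d _) (cI c d _).
by move=> *; ring.
Qed.

Lemma rect_split_ver a b c m d : c <= m -> m <= d -> 0 < c ->
  rect f a b c d = rect f a b c m + rect f a b m d.
Proof.
move=> cm md c0; have m0 := lt_le_trans c0 cm.
rewrite /rect (cI_split cm md (okv b _ c0) (okv b _ c0) (okv b _ m0)).
rewrite (cI_split cm md (okv a _ c0) (okv a _ c0) (okv a _ m0)).
move: (cI c m _) (cI m d _) (cI c m _) (cI m d _) (cI a b _) (cI a b _) (cI a b _).
by move=> *; ring.
Qed.

Lemma four_sum (z1 z2 z3 z4 : R[i]) (K := cmod (z1 + z2 + (z3 + z4))) :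
  [\/ K / 4 <= cmod z1, K / 4 <= cmod z2, K / 4 <= cmod z3 | K / 4 <= cmod z4].
Proof.
have := cmodD (z1 + z2) (z3 + z4); rewrite -/K; have := cmodD z1 z2; have := cmodD z3 z4.
move: (cmod (z1 + z2)) (cmod (z3 + z4)) (cmod z1) (cmod z2) (cmod z3) (cmod z4) K.
move=> u v x1 x2 x3 x4 K h1 h2 h3.
have [h|k1] := leP (K / 4) x1; first exact: Or41.
have [h|k2] := leP (K / 4) x2; first exact: Or42.
have [h|k3] := leP (K / 4) x3; first exact: Or43.
by apply: Or44; lra.
Qed.

Lemma rect_bisect a b c d : a <= b -> 0 < c -> c <= d ->
  exists a' b' c' d', [/\ a <= a', b' <= b, c <= c', d' <= d &
    [/\ b' - a' = (b - a) / 2, d' - c' = (d - c) / 2 &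
      cmod (rect f a b c d) / 4 <= cmod (rect f a' b' c' d')]].
Proof.
move=> ab c0 cd; pose m := (a + b) / 2; pose n := (c + d) / 2.
have [am mb cn nd] : [/\ a <= m, m <= b, c <= n & n <= d] by rewrite /m /n; split; lra.
have n0 := lt_le_trans c0 cn.
have E : rect f a b c d = rect f a m c n + rect f a m n d + (rect f m b c n + rect f m b n d).
  by rewrite (rect_split_hor am mb c0 cd) !(rect_split_ver _ _ cn nd c0).
rewrite E; case: (four_sum (rect f a m c n) (rect f a m n d) (rect f m b c n) (rect f m b n d)) => h.
- by exists a, m, c, n; split=> //; split=> //; rewrite /m /n; field.
- by exists a, m, n, d; split=> //; split=> //; rewrite /m /n; field.
- by exists m, b, c, n; split=> //; split=> //; rewrite /m /n; field.
- by exists m, b, n, d; split=> //; split=> //; rewrite /m /n; field.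
Qed.

(** An affine function has contour integral zero: its differences across opposite sides are constant
    and cancel. Hence a first-order approximation at z0 can be subtracted. *)
Lemma rect_affine (z0 w D : R[i]) a b c d : a <= b -> 0 < c -> c <= d ->
  rect (fun z => f z - w - D * (z - z0)) a b c d = rect f a b c d.
Proof.
move=> ab c0 cd; have d0 := lt_le_trans c0 cd.
pose L z := w + D * (z - z0).
have dL z : cdiff L z (0 + (0 * (z - z0) + D * (1 + 0))).
  apply: cdiffD; first exact: cdiff_cst.
  by apply: (@cdiffM _ (fun=> D)); [exact: cdiff_cst|apply: (@cdiffD _ id (fun=> - z0)); [exact: cdiff_id|exact: cdiff_cst]].
have lh y : okI a b (fun x => L (x +i* y)).
  by apply: okI_cont => t _; exact: cdiff_cont_hor (dL _).
have lv x : okI c d (fun y => L (x +i* y)).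
  by apply: okI_cont => t _; exact: cdiff_cont_ver (dL _).
have -> : rect (fun z => f z - w - D * (z - z0)) a b c d = rect (fun z => f z - L z) a b c d.
  by rewrite (_ : (fun z => _) = (fun z => f z - L z)) //; apply/funext => z; rewrite /L opprD addrA.
rewrite /rect (cI_sub (okh a b c0) (lh c)) (cI_sub (okh a b d0) (lh d)).
rewrite (cI_sub (okv b d c0) (lv b)) (cI_sub (okv a d c0) (lv a)).
suff : rect L a b c d = 0.
  rewrite /rect => h; rewrite -[RHS]subr0 -h.
  move: (cI a b _) (cI a b _) (cI c d _) (cI c d _) (cI a b _) (cI a b _) (cI c d _) (cI c d _).
  by move=> *; ring.
rewrite /rect -(cI_sub (lh c) (lh d)) -(cI_sub (lv b) (lv a)).
rewrite (_ : (fun t => _) = (fun=> D * (0 +i* (c - d)))); last first.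
  apply/funext => t; rewrite /L (_ : 0 +i* (c - d) = (t +i* c) - (t +i* d)); first by ring.
  by apply: complexP; rewrite /= ?subrr.
rewrite [X in _ + _ * cI c d X](_ : _ = (fun=> D * (b - a)%:C)); last first.
  apply/funext => t; rewrite /L (_ : (b - a)%:C = (b +i* t) - (a +i* t)); first by ring.
  by apply: complexP; rewrite /= ?subrr.
rewrite !cI_cst //.
by apply: complexP; rewrite !(ReD, ImD, ReM, ImM) /=; ring.
Qed.

(** Bisection keeps a rectangle carrying at least a quarter of the integral. On the n-th one, f
    differs from its first-order approximation at the common point by at most e times the distance,
    so the integral is at most 2 e (S / 2^n)^2, with S half of the initial perimeter. *)
Theorem goursat a b c d : a <= b -> 0 < c -> c <= d -> rect f a b c d = 0.
Proof.
move=> ab c0 cd; apply: cmod_eq0; apply/eqP; rewrite eq_le cmod_ge0 andbT leNgt.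
apply/negP; set K := cmod _ => K0.
pose valid (q : (R * R) * (R * R)) := [/\ q.1.1 <= q.1.2, 0 < q.2.1 & q.2.1 <= q.2.2].
pose Bq (q : (R * R) * (R * R)) := cmod (rect f q.1.1 q.1.2 q.2.1 q.2.2).
(* For a quadruple that is not a rectangle the claim is void, so a total bisection map can be chosen
   and iterated. *)
have ex (q : (R * R) * (R * R)) : exists q' : (R * R) * (R * R), valid q ->
   [/\ valid q', q.1.1 <= q'.1.1 & q'.1.2 <= q.1.2] /\
   [/\ q.2.1 <= q'.2.1, q'.2.2 <= q.2.2, q'.1.2 - q'.1.1 = (q.1.2 - q.1.1) / 2,
    q'.2.2 - q'.2.1 = (q.2.2 - q.2.1) / 2 & Bq q / 4 <= Bq q'].
  have [[h1 h2 h3]|nv] := pselect (valid q); last by exists q.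
  have [a' [b' [c' [d' [i1 i2 i3 i4 [i5 i6 i7]]]]]] := rect_bisect h1 h2 h3.
  exists ((a', b'), (c', d')) => _; split; split => //=; split => /=; lra.
have [s hs] := choice ex.
pose q n := iter n s ((a, b), (c, d)).
have vq n : valid (q n) by elim: n => [|n IH]; [split|case: (hs _ IH) => -[]].
have st n := hs _ (vq n).
have wq n : (q n).1.2 - (q n).1.1 = (b - a) / 2 ^+ n.
  elim: n => [|n IH]; first by rewrite expr0 divr1.
  have [_ [_ _ -> _ _]] := st n; rewrite IH exprS; field; rewrite expf_neq0 //.
have hq n : (q n).2.2 - (q n).2.1 = (d - c) / 2 ^+ n.
  elim: n => [|n IH]; first by rewrite expr0 divr1.
  have [_ [_ _ _ -> _]] := st n; rewrite IH exprS; field; rewrite expf_neq0 //.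
have Kq n : K / 4 ^+ n <= Bq (q n).
  elim: n => [|n IH]; first by rewrite expr0 divr1.
  have [_ [_ _ _ _ h]] := st n; apply: le_trans _ h; rewrite exprS.
  by rewrite invfM mulrCA [X in _ <= X]mulrC ler_pM2l ?invr_gt0.
have nest (l r : nat -> R) : (forall n, l n <= l n.+1) -> (forall n, r n.+1 <= r n) ->
    (forall n, l n <= r n) -> exists x, forall n, l n <= x <= r n.
  move=> hl hr lr.
  have lm n k : l n <= l (n + k)%N by elim: k => [|k IH]; rewrite ?addn0 // addnS (le_trans IH).
  have rm n k : r (n + k)%N <= r n by elim: k => [|k IH]; rewrite ?addn0 // addnS (le_trans _ IH).
  have ub n m : l m <= r n.
    apply: le_trans (lm m n) _; apply: le_trans (lr _) _; rewrite addnC; exact: rm.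
  have hsup : has_sup (range l) by split; [exists (l 0%N); exists 0%N|exists (r 0%N) => _ [m _ <-]; exact: ub].
  exists (sup (range l)) => n; apply/andP; split.
    by apply: ub_le_sup; [case: hsup|exists n].
  by apply: ge_sup; [case: hsup|move=> _ [m _ <-]; exact: ub].
have [x0 hx0] : exists x, forall n, (q n).1.1 <= x <= (q n).1.2.
  by apply: nest => n; [case: (st n) => -[]|case: (st n) => -[]|case: (vq n)].
have [y0 hy0] : exists x, forall n, (q n).2.1 <= x <= (q n).2.2.
  by apply: nest => n; [case: (st n) => _ []|case: (st n) => _ []|case: (vq n)].
have y00 : 0 < y0 by have /andP[/= h _] := hy0 0%N; exact: lt_le_trans c0 h.
have [D hD] := @df (x0 +i* y0) y00.
pose S := (b - a) + (d - c); have S0 : 0 <= S by rewrite /S; lra.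
(* With this tolerance e one has 2 e S^2 <= K / 2, which contradicts K <= 2 e S^2; the added 1 keeps
   the denominator positive when S = 0. *)
have [r r0 hr] := hD (K / (4 * (S ^+ 2 + 1))) ltac:(by rewrite divr_gt0 // mulr_gt0 // ltr_wpDl ?sqr_ge0).
have [n hn] : exists n, S / 2 ^+ n < r.
  have /cvgrPdist_lt /(_ r r0) [N _ hN] : geometric S 2^-1 n @[n --> \oo] --> (0 : R).
    by apply: cvg_geometric; rewrite ger0_norm ?invf_lt1 ?ltr1n.
  exists N; have := hN N (leqnn N); rewrite /= sub0r normrN exprVn.
  exact: le_lt_trans (ler_norm _).
have [v1 v2 v3] := vq n.
set e := K / _ in hr; have e0 : 0 <= e by rewrite divr_ge0 ?(ltW K0) // mulr_ge0 // addr_ge0 ?sqr_ge0.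
pose h z := f z - f (x0 +i* y0) - D * (z - (x0 +i* y0)).
have [[hx1 hx2] [hy1 hy2]] := (andP (hx0 n), andP (hy0 n)).
have hb x y : (q n).1.1 <= x <= (q n).1.2 -> (q n).2.1 <= y <= (q n).2.2 ->
    cmod (h (x +i* y)) <= e * (S / 2 ^+ n).
  move=> /andP[x1 x2] /andP[y1 y2].
  have dz : cmod ((x +i* y) - (x0 +i* y0)) <= S / 2 ^+ n.
    apply: le_trans (cmod_le_ReIm _) _; rewrite /= /S mulrDl -wq -hq.
    by apply: lerD; rewrite ler_norml; lra.
  apply: le_trans (hr _ (le_lt_trans dz hn)) _.
  by rewrite ler_wpM2l.
have d1 := lt_le_trans v2 v3.
have oh y : 0 < y -> okI (q n).1.1 (q n).1.2 (fun x => h (x +i* y)).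
  move=> y1; apply: okI_cont => t _; have [E hE] := @df (t +i* y) y1.
  apply: (@cdiff_cont_hor _ (E + 0 + (0 * (t +i* y + - (x0 +i* y0)) + (- D) * (1 + 0)))).
  rewrite /h (_ : (fun z => _) = (fun z => f z + (- f (x0 +i* y0)) + (- D) * (z + - (x0 +i* y0)))); last first.
    by apply/funext => z; rewrite mulNr.
  apply: (@cdiffD _ (fun z => f z + _)); first by apply: cdiffD => //; exact: cdiff_cst.
  by apply: (@cdiffM _ (fun=> - D)); [exact: cdiff_cst|apply: (@cdiffD _ id); [exact: cdiff_id|exact: cdiff_cst]].
have ov x : okI (q n).2.1 (q n).2.2 (fun y => h (x +i* y)).
  apply: okI_cont => t /andP[t1 _]; have [E hE] := @df (x +i* t) (lt_le_trans v2 t1).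
  apply: (@cdiff_cont_ver _ (E + 0 + (0 * (x +i* t + - (x0 +i* y0)) + (- D) * (1 + 0)))).
  rewrite /h (_ : (fun z => _) = (fun z => f z + (- f (x0 +i* y0)) + (- D) * (z + - (x0 +i* y0)))); last first.
    by apply/funext => z; rewrite mulNr.
  apply: (@cdiffD _ (fun z => f z + _)); first by apply: cdiffD => //; exact: cdiff_cst.
  by apply: (@cdiffM _ (fun=> - D)); [exact: cdiff_cst|apply: (@cdiffD _ id); [exact: cdiff_id|exact: cdiff_cst]].
have p2 : 0 < 2 ^+ n :> R by rewrite exprn_gt0.
have eS : 0 <= e * (S / 2 ^+ n) by rewrite mulr_ge0 // divr_ge0 // ltW.
have BK : Bq (q n) <= 2 * (e * (S / 2 ^+ n)) * (S / 2 ^+ n).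
  rewrite /Bq -(rect_affine (x0 +i* y0) (f (x0 +i* y0)) D v1 v2 v3) -/h /rect.
  have c1 : (q n).1.1 <= (q n).1.1 <= (q n).1.2 by rewrite lexx v1.
  have c2 : (q n).1.1 <= (q n).1.2 <= (q n).1.2 by rewrite lexx v1.
  have c3 : (q n).2.1 <= (q n).2.1 <= (q n).2.2 by rewrite lexx v3.
  have c4 : (q n).2.1 <= (q n).2.2 <= (q n).2.2 by rewrite lexx v3.
  have b1 := cI_bound v1 (oh _ v2) eS (fun t ht => hb t _ ht c3).
  have b2 := cI_bound v1 (oh _ d1) eS (fun t ht => hb t _ ht c4).
  have b3 := cI_bound v3 (ov (q n).1.2) eS (fun t ht => hb _ t c2 ht).
  have b4 := cI_bound v3 (ov (q n).1.1) eS (fun t ht => hb _ t c1 ht).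
  rewrite wq in b1 b2; rewrite hq in b3 b4.
  apply: le_trans (cmodD _ _) _; apply: le_trans (lerD (cmodB _ _) (lexx _)) _.
  rewrite cmodM (_ : cmod (0 +i* 1) = 1); last by rewrite /= expr0n expr1n add0r sqrtr1.
  rewrite mul1r; apply: le_trans (lerD (lexx _) (cmodB _ _)) _.
  apply: le_trans (lerD (lerD b1 b2) (lerD b3 b4)) _.
  by rewrite /S le_eqVlt; apply/orP; left; apply/eqP; ring.
have := le_trans (Kq n) BK.
rewrite (_ : 2 * (e * (S / 2 ^+ n)) * (S / 2 ^+ n) = 2 * e * S ^+ 2 / 4 ^+ n); last first.
  have -> : 4 ^+ n = 2 ^+ n * 2 ^+ n :> R by rewrite -exprMn; congr (_ ^+ _); ring.
  by field; rewrite gt_eqF.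
rewrite ler_pM2r ?invr_gt0 ?exprn_gt0 //.
have Sp : 0 < S ^+ 2 + 1 by rewrite ltr_wpDl ?sqr_ge0.
have -> : 2 * e * S ^+ 2 = K / 2 * (S ^+ 2 / (S ^+ 2 + 1)).
  by rewrite /e; field; rewrite gt_eqF.
have : S ^+ 2 / (S ^+ 2 + 1) <= 1 by rewrite ler_pdivrMr // mul1r lerDl.
suff alg (k t : R) : 0 < k -> t <= 1 -> k <= k / 2 * t -> False by exact: alg.
by nra.
Qed.

End goursat.

Section dominated.
Context d (T : measurableType d) (R : realType).
Variable mu : {measure set T -> \bar R}.

Lemma cint_dominated (g_ : nat -> T -> R[i]) g (h : T -> R) :
  (forall n, cmeasurable (g_ n)) -> cmeasurable g ->
  mu.-integrable setT (EFin \o h) -> (forall n x, cmod (g_ n x) <= h x) ->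
  {ae mu, forall x, cmod (g_ n x - g x) @[n --> \oo] --> (0 : R)} ->
  cmod (cint mu (g_ n) - cint mu g) @[n --> \oo] --> (0 : R).
Proof.
move=> mg_ mg ih gh cg.
have key (p : R[i] -> R) : (forall f : T -> R[i], cmeasurable f -> measurable_fun setT (fun x => p (f x))) ->
   (forall z w, p z - p w = p (z - w)) -> (forall z, `|p z| <= cmod z) ->
   \int[mu]_x p (g_ n x) @[n --> \oo] --> \int[mu]_x p (g x).
  move=> mp pB pl.
  have m_ n : measurable_fun setT (EFin \o (fun x => p (g_ n x))) by apply/measurable_EFinP; exact: mp.
  have m0 : measurable_fun setT (EFin \o (fun x => p (g x))) by apply/measurable_EFinP; exact: mp.
  have cv : {ae mu, forall x, setT x -> (p (g_ n x))%:E @[n --> \oo] --> (p (g x))%:E}.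
    apply: filterS cg => x hx _; apply: cvg_EFin; first exact: nearW.
    apply/cvgrPdist_le => e e0; move/cvgrPdist_le: hx => /(_ e e0); apply: filterS => n /=.
    rewrite sub0r normrN ger0_norm ?cmod_ge0 // => hn; rewrite pB.
    by apply: le_trans (pl _) _; rewrite cmodC.
  have dom : {ae mu, forall x n, setT x -> (`|(p (g_ n x))%:E| <= (h x)%:E)%E}.
    by apply: aeW => x n _; rewrite lee_fin (le_trans (pl _)).
  have [i _ c] := dominated_convergence measurableT m_ m0 cv ih dom.
  by apply: fine_cvg; rewrite fineK //; exact: integrable_fin_num i.
have cR := key (@complex.Re R) (fun f mf => mf.1) (fun z w => ltac:(by rewrite ReD ReN)) (@Re_le_cmod R).
have cI := key (@complex.Im R) (fun f mf => mf.2) (fun z w => ltac:(by rewrite ImD ImN)) (@Im_le_cmod R).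
apply: (@squeeze_cvgr _ _ _ _ (cst 0) (fun n =>
   `|\int[mu]_x complex.Re (g_ n x) - \int[mu]_x complex.Re (g x)| +
   `|\int[mu]_x complex.Im (g_ n x) - \int[mu]_x complex.Im (g x)|)).
- apply: nearW => n; apply/andP; split; first exact: cmod_ge0.
  apply: le_trans (cmod_le_ReIm _) _.
  by rewrite ReD ReN ImD ImN !Re_cint !Im_cint.
- exact: cvg_cst.
- by rewrite -[0]addr0; apply: cvgD; exact: cvg_dist0.
Qed.

End dominated.

(** * Boundary integrals of analytic functions with quadratic decay *)

Section boundary_values.
Context (R : realType).
Local Notation mu := (@lebesgue_measure R).

Lemma ccont_measurable (g : R -> R[i]) : (forall t, ccont g t) -> cmeasurable g.
Proof.
move=> h.
have key (p : R[i] -> R) : (forall z w, p z - p w = p (z - w)) -> (forall z, `|p z| <= cmod z) ->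
    measurable_fun setT (p \o g).
  move=> pB pl; apply: continuous_measurable_fun => t.
  apply/cvgrPdist_le => e e0; have [r r0 hr] := h t e e0.
  exists r => // s /= st; rewrite pB; apply: le_trans (pl _) _.
  by rewrite cmodC; apply: hr; rewrite distrC.
split; apply: key => [z w|z]; rewrite ?ReD ?ReN ?ImD ?ImN //.
  exact: Re_le_cmod.
exact: Im_le_cmod.
Qed.

Lemma cmod0_small (z : R[i]) : (forall e, 0 < e -> cmod z <= e) -> z = 0.
Proof.
move=> h; apply: cmod_eq0; apply/eqP; rewrite eq_le cmod_ge0 andbT.
by apply/ler_addgt0Pr => e e0; rewrite add0r h.
Qed.

Variables (G : R[i] -> R[i]) (C : R).
Hypothesis C0 : 0 <= C.
Hypothesis dG : forall z, 0 < complex.Im z -> exists D, cdiff G z D.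
Hypothesis bG : forall z, 0 < complex.Im z -> cmod (G z) <= C / (1 + cmod z ^+ 2).

Let hor (e x : R) : 0 < e -> cmod (G (x +i* e)) <= C * (1 + x ^+ 2)^-1.
Proof.
move=> e0; apply: le_trans (bG _) _ => //; rewrite ler_wpM2l //.
have x0 := sqr_ge0 x; have e2 := sqr_ge0 e.
rewrite lef_pV2 ?posrE ?cmod_sqr /=; lra.
Qed.

Let ihor : mu.-integrable setT (EFin \o (fun x : R => C * (1 + x ^+ 2)^-1)).
Proof. exact: (integrableZl measurableT C (@integrable_oneDsqrV R)). Qed.

Let mhor (e : R) : 0 < e -> cmeasurable (fun x => G (x +i* e)).
Proof.
by move=> e0; apply: ccont_measurable => t; have [D hD] := dG (z := t +i* e) e0; exact: cdiff_cont_hor hD.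
Qed.

(** Goursat's theorem on the square with opposite corners - m + i e and m + i (e + m): the other
    three sides have total length 4 m, and the integrand there is at most C / (1 + m^2). *)
Lemma line_integral_zero (e : R) : 0 < e -> cint mu (fun x => G (x +i* e)) = 0.
Proof.
move=> e0; have mG := mhor e0.
pose g_ (N : nat) (x : R) := iv (- N%:R) N%:R x * G (x +i* e).
have gb N x : cmod (g_ N x) <= C * (1 + x ^+ 2)^-1.
  apply: le_trans (hor x e0); rewrite cmodM cmod_iv ler_piMl ?cmod_ge0 //.
  by case: (_ && _).
have mg_ N : cmeasurable (g_ N) by apply: cmeasurableM => //; exact: cmeasurable_iv.
have cv : {ae mu, forall x : R, cmod (g_ n x - G (x +i* e)) @[n --> \oo] --> (0 : R)}.
  apply: aeW => x; apply/cvgrPdist_le => r r0.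
  exists (Num.truncn `|x|).+1 => // n /= hn.
  have xn : `|x| <= n%:R by apply: le_trans (ltW (truncnS_gt _)) _; rewrite ler_nat.
  by rewrite /g_ /iv -ler_norml xn mul1r subrr cmod0 subrr normr0 ltW.
have lim := @cint_dominated _ _ _ mu _ _ _ mg_ mG ihor gb cv.
apply: cmod0_small => r r0.
move/cvgrPdist_le: lim => /(_ (r / 2) ltac:(by rewrite divr_gt0)) [N _ hN].
(* M >= N controls the truncation error, and M >= 8 C / r makes the other three sides contribute at
   most 4 C / M <= r / 2. *)
pose M := (N + (Num.truncn (8 * C / r)).+1)%N.
have M1 : 1 <= M%:R :> R by rewrite /M addnS ler1n.
have MC : 4 * C / M%:R <= r / 2.
  rewrite ler_pdivrMr; last by rewrite (lt_le_trans ltr01).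
  have : 8 * C / r <= M%:R.
    apply: le_trans (ltW (truncnS_gt _)) _; rewrite ler_nat /M; exact: leq_addl.
  by rewrite ler_pdivrMr //; lra.
have := hN M (leq_addr _ _); rewrite sub0r normrN (ger0_norm (cmod_ge0 _)) => hM.
have hI : cmod (cint mu (g_ M)) <= r / 2.
  apply: le_trans _ MC; set m := M%:R in M1 *.
  have m0 : 0 <= m by apply: le_trans ler01 M1.
  have eM : e <= e + m by rewrite lerDl.
  have eM0 : 0 < e + m by apply: lt_le_trans eM.
  have mm : - m <= m by lra.
  have := @goursat _ _ dG (- m) m e (e + m) mm e0 eM.
  rewrite /rect -/(cI (- m) m _) => /eqP; rewrite addrAC subr_eq0 => /eqP.
  rewrite -[cI (- m) m (fun x => G (x +i* e))]/(cint mu (g_ M)) => /eqP.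
  rewrite eq_sym -subr_eq => /eqP <-.
  have b x y : 0 < y -> m ^+ 2 <= x ^+ 2 + y ^+ 2 -> cmod (G (x +i* y)) <= C / (1 + m ^+ 2).
    move=> y0 h; apply: le_trans (bG _) _ => //; rewrite ler_wpM2l //.
    have m2 := sqr_ge0 m; rewrite lef_pV2 ?posrE ?cmod_sqr /=; lra.
  have Cm : 0 <= C / (1 + m ^+ 2) by rewrite divr_ge0 // addr_ge0 ?sqr_ge0.
  have okh y : 0 < y -> okI (- m) m (fun x => G (x +i* y)).
    move=> y0; apply: okI_cont => t _; have [D hD] := dG (z := t +i* y) y0.
    exact: cdiff_cont_hor hD.
  have okv x : okI e (e + m) (fun y => G (x +i* y)).
    apply: okI_cont => t /andP[t1 _]; have [D hD] := dG (z := x +i* t) (lt_le_trans e0 t1).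
    exact: cdiff_cont_ver hD.
  have b1 : cmod (cI (- m) m (fun x => G (x +i* (e + m)))) <= C / (1 + m ^+ 2) * (m - - m).
    apply: cI_bound => //; [exact: okh|move=> t _; apply: b => //].
    by have := sqr_ge0 t; nra.
  have b2 x : x ^+ 2 = m ^+ 2 -> cmod (cI e (e + m) (fun y => G (x +i* y))) <= C / (1 + m ^+ 2) * (e + m - e).
    move=> xm; apply: cI_bound => // t /andP[t1 _]; apply: b; first exact: lt_le_trans t1.
    by rewrite xm lerDl sqr_ge0.
  have b3 := b2 m erefl; have b4 := b2 (- m) (sqrrN _).
  apply: le_trans (cmodB _ _) _; rewrite cmodM (_ : cmod (0 +i* 1) = 1); last first.
    by rewrite /= expr0n expr1n add0r sqrtr1.
  rewrite mul1r; apply: le_trans (lerD (lexx _) (cmodB _ _)) _.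
  apply: le_trans (lerD b1 (lerD b3 b4)) _.
  have -> : C / (1 + m ^+ 2) * (m - - m) + (C / (1 + m ^+ 2) * (e + m - e) + C / (1 + m ^+ 2) * (e + m - e)) =
    4 * C * (m / (1 + m ^+ 2)) by ring.
  rewrite ler_wpM2l ?mulr_ge0 // ler_pdivrMr ?ltr_wpDr ?sqr_ge0 //.
  by rewrite -ler_pdivrMl ?invr_gt0 ?(lt_le_trans ltr01) // invrK -expr2 lerDr.
have := cmodB (cint mu (g_ M)) (cint mu (g_ M) - cint mu (fun x => G (x +i* e))).
rewrite opprB addrC subrK => h; apply: le_trans h _; rewrite [leRHS]splitr lerD //.
Qed.

(** The lines at heights 1 / (n + 1) share the integrable majorant C / (1 + x^2), so dominated
    convergence carries the vanishing integrals to the boundary. *)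
Lemma boundary_integral_zero (g : R -> R[i]) : cmeasurable g ->
  {ae mu, forall x : R, cmod (G (x +i* n.+1%:R^-1) - g x) @[n --> \oo] --> (0 : R)} ->
  cint mu g = 0.
Proof.
move=> mg cv.
have e0 n : 0 < n.+1%:R^-1 :> R by rewrite invr_gt0.
have := @cint_dominated _ _ _ mu _ _ _ (fun n => mhor (e0 n)) mg ihor (fun n x => hor x (e0 n)) cv.
under eq_fun do rewrite line_integral_zero // sub0r cmodN.
move=> /cvg_lim; rewrite lim_cst // => h.
by apply: cmod_eq0; rewrite h.
Qed.

End boundary_values.

(** * Bounded analytic functions integrated against two transforms *)

Section hardy_pairing.
Context (R : realType).
Local Notation mu := (@lebesgue_measure R).

Lemma ctends_eps (f : R -> R[i]) l :
  (forall e : R, 0 < e -> exists2 r : R, 0 < r & forall y, 0 < y < r -> cmod (f y - l) <= e) ->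
  cmod (f n.+1%:R^-1 - l) @[n --> \oo] --> (0 : R).
Proof.
move=> h; apply/cvgrPdist_le => e e0; have [r r0 hr] := h e e0.
have /cvgrPdist_lt /(_ r r0) := @cvg_harmonic R; apply: filterS => n.
rewrite sub0r normrN ger0_norm ?invr_ge0 ?ler0n // => hn.
by rewrite sub0r normrN ger0_norm ?cmod_ge0 // hr // invr_gt0 ltr0Sn.
Qed.

Lemma ctendsM (z w : nat -> R[i]) z0 w0 :
  cmod (z n - z0) @[n --> \oo] --> (0 : R) -> cmod (w n - w0) @[n --> \oo] --> (0 : R) ->
  cmod (z n * w n - z0 * w0) @[n --> \oo] --> (0 : R).
Proof.
move=> hz hw; have hw' := cmod_tends hw.
apply: (@squeeze_cvgr _ _ _ _ (cst 0) (fun n => cmod (z n - z0) * cmod (w n) + cmod z0 * cmod (w n - w0))).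
- apply: nearW => n; apply/andP; split; first exact: cmod_ge0.
  have -> : z n * w n - z0 * w0 = (z n - z0) * w n + z0 * (w n - w0) by ring.
  by apply: le_trans (cmodD _ _) _; rewrite !cmodM.
- exact: cvg_cst.
- rewrite (_ : 0 = 0 * cmod w0 + cmod z0 * 0); last by rewrite mul0r mulr0 addr0.
  by apply: cvgD; apply: cvgM => //; exact: cvg_cst.
Qed.

Lemma chatE a (z : R[i]) : chat a z = (cexp ((0 +i* a) * z) - 1) * ((0 +i* 1)^-1 * z^-1).
Proof. by rewrite /chat invfM. Qed.

Lemma cdiff_chat a (z : R[i]) : z != 0 -> exists D, cdiff (chat a) z D.
Proof.
move=> z0.
have d1 : cdiff (fun w => cexp ((0 +i* a) * w) + -1) z _ := cdiffD (cdiff_cexp _ z) (cdiff_cst _ z).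
have d2 : cdiff (fun w => (0 +i* 1)^-1 * w^-1) z _ := cdiffM (cdiff_cst _ z) (cdiffV z0).
have := cdiffM d1 d2.
rewrite (_ : (fun w => _) = chat a); first by move=> h; eexists; exact: h.
by apply/funext => w; rewrite chatE.
Qed.

Lemma cmod_ii : cmod (0 +i* 1 : R[i]) = 1.
Proof. by rewrite /= expr0n expr1n add0r sqrtr1. Qed.

(** For a >= 0, Re (i a z) <= 0 on the closed upper half-plane, so [cexp_sub1_le] bounds the
    quotient near 0; [chat_le2] provides the decay at infinity. *)
Lemma chat_le1 a (z : R[i]) : 0 <= a -> 0 <= complex.Im z -> cmod (chat a z) <= 2 * a.
Proof.
move=> a0 z0; rewrite /chat cmodM cmodV cmodM cmod_ii mul1r.
have [->|zn] := eqVneq z 0; first by rewrite cmod0 invr0 mulr0 mulr_ge0.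
rewrite ler_pdivrMr ?cmod_gt0 //; apply: le_trans (cexp_sub1_le _) _.
  by rewrite ReM /= mul0r sub0r oppr_le0 mulr_ge0.
rewrite cmodM -mulrA (_ : cmod (0 +i* a) = a) //.
by rewrite /= expr0n add0r sqrtr_sqr ger0_norm.
Qed.

Lemma chat_le2 a (z : R[i]) : 0 <= a -> 0 <= complex.Im z -> cmod (chat a z) * cmod z <= 2.
Proof.
move=> a0 z0; rewrite /chat cmodM cmodV cmodM cmod_ii mul1r.
have [->|zn] := eqVneq z 0; first by rewrite cmod0 mulr0.
rewrite divfK ?gt_eqF ?cmod_gt0 //; apply: le_trans (cmodB _ _) _.
rewrite cmod1 cmod_cexp -lerBrDr (_ : 2 - 1 = 1); last by ring.
by rewrite -expR0 ler_expR ReM /= mul0r sub0r oppr_le0 mulr_ge0.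
Qed.

(** Both indices are nonnegative, so both [chat] factors are bounded and decay in the upper
    half-plane; their product supplies the quadratic decay that the merely bounded F lacks. *)
Lemma hardy_cint (F : R[i] -> R[i]) (h : R -> R[i]) (M a b : R) :
  (forall z, 0 < complex.Im z -> exists D, cdiff F z D) ->
  (forall z, 0 < complex.Im z -> cmod (F z) <= M) -> cmeasurable h ->
  {ae mu, forall x : R, forall e : R, 0 < e ->
    exists2 r : R, 0 < r & forall y, 0 < y < r -> cmod (F (x +i* y) - h x) <= e} ->
  0 <= a -> 0 <= b -> cint mu (fun x => h x * (hatf a x * hatf b x)) = 0.
Proof.
move=> dF bF mh lim a0 b0.
have M0 : 0 <= M by apply: le_trans (bF (0 +i* 1) _) => //=; exact: cmod_ge0.
(* The constant adds the bound 4 a b near 0 to the bound 4 at infinity: |chat a z chat b z| (1 +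
   |z|^2) <= 4 a b + 4. *)
apply: (@boundary_integral_zero _ (fun z => F z * (chat a z * chat b z)) (M * (4 * a * b + 4))).
- by rewrite mulr_ge0 // addr_ge0 // !mulr_ge0.
- move=> z z0; have zn : z != 0 by apply: contraTneq z0 => ->; rewrite ltxx.
  have [D hD] := dF z z0; have [Da ha] := cdiff_chat a zn; have [Db hb] := cdiff_chat b zn.
  by eexists; apply: cdiffM hD (cdiffM ha hb).
- move=> z z0; have zz := ltW z0; rewrite cmodM -mulrA.
  apply: ler_pM; rewrite ?cmod_ge0 ?bF // cmodM.
  have k1 := chat_le1 a0 zz; have k2 := chat_le2 a0 zz.
  have l1 := chat_le1 b0 zz; have l2 := chat_le2 b0 zz.
  rewrite ler_pdivlMr ?ltr_wpDr ?sqr_ge0 // mulrDr mulr1 lerD //.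
    apply: le_trans (ler_pM _ _ k1 l1) _; rewrite ?cmod_ge0 //.
    by rewrite le_eqVlt; apply/orP; left; apply/eqP; ring.
  rewrite expr2 mulrACA; apply: le_trans (ler_pM _ _ k2 l2) _; rewrite ?mulr_ge0 ?cmod_ge0 //.
  by lra.
- apply: cmeasurableM => //; apply: cmeasurableM; exact: cmeasurable_hatf.
(* The point 0 is set aside: there [chat c] has the default value 0 instead of its limit c. *)
- apply: aeS (ae_and lim (ae_neq 0)) => x [hx x0].
  have xn : x%:C != 0 :> R[i] by rewrite (fmorph_eq0 (real_complex R)); apply/eqP.
  have hc c : cmod (chat c (x +i* n.+1%:R^-1) - hatf c x) @[n --> \oo] --> (0 : R).
    apply: (ctends_eps (f := fun y => chat c (x +i* y))) => e e0.
    have [D hD] := cdiff_chat c xn; have [r r0 hr] := cdiff_cont hD e0.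
    exists r => // y /andP[y0 yr]; apply: hr.
    have -> : (x +i* y) - x%:C = (0 +i* 1) * y%:C.
      by apply: complexP; rewrite ?(ReM, ImM) /=; ring.
    by rewrite cmodM cmod_ii mul1r cmod_real gtr0_norm.
  apply: ctendsM; last exact: ctendsM.
  exact: (ctends_eps (f := fun y => F (x +i* y))).
Qed.

End hardy_pairing.

(** * Plancherel's theorem *)

Section complex_ftc.
Context (R : realType).
Local Notation mu := (@lebesgue_measure R).

(** [p] stands for the real and for the imaginary part, so that one argument serves both. *)
Lemma cdiff_is_derive (f : R[i] -> R[i]) (t : R) D (p : R[i] -> R) :
  (forall z w, p z - p w = p (z - w)) -> (forall z, `|p z| <= cmod z) ->
  (forall (r : R) z, p (r%:C * z) = r * p z) ->
  cdiff f t%:C D -> is_derive t (1 : R) (fun s => p (f s%:C)) (p D).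
Proof.
move=> pB pl pZ h.
have c : (fun k : R => k^-1 *: (p (f (k *: 1 + t)%:C) - p (f t%:C))) @ 0^' --> p D.
  apply/cvgrPdist_le => e e0; have [r r0 hr] := h e e0.
  exists r => //= k; rewrite /ball_ /= sub0r normrN => kr k0.
  rewrite -[_ *: 1]/(_ * 1) mulr1 -[_ *: _]/(_ * _) pB -pZ pB.
  apply: le_trans (pl _) _.
  have kk : (k + t)%:C - t%:C = k%:C by rewrite -rmorphB addrK.
  have := hr (k + t)%:C; rewrite kk cmod_real => /(_ kr) h2.
  have kC : k%:C != 0 :> R[i] by rewrite (fmorph_eq0 (real_complex R)).
  have -> : D - (k^-1)%:C * (f (k + t)%:C - f t%:C) =
     - ((k^-1)%:C * (f (k + t)%:C - f t%:C - D * k%:C)).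
    by rewrite (fmorphV (real_complex R)); field.
  rewrite cmodN cmodM cmod_real normfV.
  by rewrite ler_pdivrMl ?normr_gt0 // [_ * e]mulrC.
by split; [exact: (cvgP _ c)|exact: cvg_lim c].
Qed.

Lemma cI_ftc (p q : R) (g : R -> R[i]) (f : R[i] -> R[i]) : p <= q ->
  (forall t, cdiff f t%:C (g t)) -> (forall t, ccont g t) ->
  cI p q g = f q%:C - f p%:C.
Proof.
move=> pq df cg; have ok : okI p q g by apply: okI_cont => t _.
have [pq'|pq'] := eqVneq p q.
  rewrite -pq' subrr; apply: cmod_eq0; apply/eqP; rewrite eq_le cmod_ge0 andbT.
  have := @cI_bound _ p p g (cmod (g p)) (lexx p) _ (cmod_ge0 _); rewrite subrr mulr0; apply.
    by apply: okI_cont => t _.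
  by move=> t; rewrite -eq_le => /eqP ->.
have {}pq : p < q by rewrite lt_neqAle pq' pq.
have key (r : R[i] -> R) : (forall z w, r z - r w = r (z - w)) -> (forall z, `|r z| <= cmod z) ->
    (forall (k : R) z, r (k%:C * z) = k * r z) ->
    \int[mu]_x r (iv p q x * g x) = r (f q%:C - f p%:C).
  move=> rB rl rZ.
  have der t := cdiff_is_derive rB rl rZ (df t).
  have cont : {within `[p, q], continuous (r \o g)}.
    apply: continuous_in_subspaceT => t _.
    apply/cvgrPdist_le => e e0; have [k k0 hk] := cg t e e0.
    exists k => // s /= st; rewrite rB; apply: le_trans (rl _) _.
    by rewrite cmodC; apply: hk; rewrite distrC.
  have cF : continuous (fun s : R => r (f s%:C)).
    by move=> t; apply/differentiable_continuous/derivable1_diffP; case: (der t).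
  have := @continuous_FTC2 R (r \o g) (fun s : R => r (f s%:C)) p q pq cont _ _.
  move=> H; transitivity (\int[mu]_(x in `[p, q]) (r \o g) x).
    rewrite [RHS]Rintegral_mkcond; congr fine; apply: eq_integral => x _.
    by rewrite patchE mem_setE in_itv /= rZ; case: (_ && _); rewrite ?mul1r ?mul0r.
  rewrite /Rintegral H //= ?rB //.
    split; first by move=> x _; case: (der x).
      by apply: cvg_at_right_filter; exact: cF.
    by apply: cvg_at_left_filter; exact: cF.
  by move=> x _; rewrite derive1E; case: (der x).
apply: complexP; rewrite ?Re_cint ?Im_cint; apply: key => *.
- by rewrite ReD ReN.
- exact: Re_le_cmod.
- by rewrite ReZ.
- by rewrite ImD ImN.
- exact: Im_le_cmod.
- by rewrite ImM /= mul0r addr0.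
Qed.

Lemma cI_cexp (p q : R) (l : R[i]) : p <= q -> l != 0 ->
  cI p q (fun t => cexp (l * t%:C)) = (cexp (l * q%:C) - cexp (l * p%:C)) / l.
Proof.
move=> pq l0; rewrite (@cI_ftc p q _ (fun z => l^-1 * cexp (l * z))) //.
- by rewrite -mulrBr mulrC.
- move=> t; have := @cdiffM _ (fun=> l^-1) _ t%:C _ _ (cdiff_cst _ _) (cdiff_cexp l t%:C).
  by rewrite mul0r add0r mulKf.
- move=> t e e0; have [r r0 hr] := cdiff_cont (cdiff_cexp l t%:C) e0.
  by exists r => // s hs; apply: hr; rewrite -rmorphB cmod_real.
Qed.

Lemma cint_chif (a : R) (g : R -> R[i]) : (forall p q, okI p q g) ->
  cint mu (fun t => (chif a t)%:C * g t) = if 0 <= a then cI 0 a g else - cI a 0 g.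
Proof.
move=> ok.
have mg p q : cmeasurable (fun t : R => iv p q t * g t) by case: (ok p q).
have e1 (t : R) : t <> 0 -> 0 <= a -> (chif a t)%:C * g t = iv 0 a t * g t.
  move=> t0 a0; congr (_%:C * _); rewrite /chif.
  case: (ltgtP t 0) t0 => // t0 _; rewrite /= ?andbT ?andbF.
    by rewrite (_ : a < t = false) ?subr0 // ltNge (le_trans (ltW t0) a0).
  by rewrite subr0.
have e2 (t : R) : t <> a -> a < 0 -> (chif a t)%:C * g t = -1 * (iv a 0 t * g t).
  move=> ta a0; rewrite mulN1r -mulNr -rmorphN; congr (_%:C * _); rewrite /chif.
  have -> : 0 < t <= a = false by apply/negbTE/negP => /andP[h1 h2]; lra.
  by rewrite sub0r; congr (- (_ && _)%:R); rewrite lt_neqAle eq_sym; case: eqP.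
have mc : cmeasurable (fun t : R => (chif a t)%:C * g t).
  have [a0|a0] := leP 0 a.
    rewrite (_ : (fun t => _) = (fun t : R => (chif a t)%:C * (iv 0 a t * g t) )).
      by apply: cmeasurableM => //; apply: cmeasurable_real; exact: measurable_chif.
    apply/funext => t; rewrite mulrA; congr (_ * _); rewrite /iv -rmorphM; congr (_%:C).
    rewrite /chif (_ : a < t <= 0 = false) ?subr0.
      by case: (ltP 0 t) => t0 /=; rewrite ?mul0r // (ltW t0) /=; case: (t <= a); rewrite ?mulr1 ?mul0r.
    by apply/negbTE/negP => /andP[h1 h2]; lra.
  rewrite (_ : (fun t => _) = (fun t : R => (chif a t)%:C * (iv a 0 t * g t) )).
    by apply: cmeasurableM => //; apply: cmeasurable_real; exact: measurable_chif.
  apply/funext => t; rewrite mulrA; congr (_ * _); rewrite /iv -rmorphM; congr (_%:C).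
  rewrite /chif (_ : 0 < t <= a = false) ?sub0r.
    by case: (ltP a t) => t0 /=; rewrite ?oppr0 ?mul0r // (ltW t0) /=; case: (t <= 0); rewrite ?mulr1 ?oppr0 ?mul0r.
  by apply/negbTE/negP => /andP[h1 h2]; lra.
have [a0|a0] := leP 0 a.
  by apply: (@cint_ae _ _ _ mu _ _ mc (mg 0 a)); apply: aeS (ae_neq 0) => t t0; exact: e1.
rewrite /cI -mulN1r -cintZ; last exact: ok.
apply: (@cint_ae _ _ _ mu _ _ mc).
  by apply: cmeasurableM; [exact: cmeasurable_cst|exact: mg].
by apply: aeS (ae_neq a) => t t0; exact: e2.
Qed.

Lemma okI_cexp p q (l : R[i]) : okI p q (fun t => cexp (l * t%:C)).
Proof.
apply: okI_cont => t _ e e0; have [r r0 hr] := cdiff_cont (cdiff_cexp l t%:C) e0.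
by exists r => // s hs; apply: hr; rewrite -rmorphB cmod_real.
Qed.

Lemma expi_cexp (x t : R) : expi (x * t) = cexp ((0 +i* x) * t%:C).
Proof. by rewrite /cexp ReM ImM /= !mulr0 !mul0r subrr expR0 mul1r add0r. Qed.

(** At x = 0 the integral is a, while [hatf a 0] has the default value 0; hence the exclusion. *)
Lemma cint_chif_expi (a x : R) : x != 0 ->
  cint mu (fun t => (chif a t)%:C * expi (x * t)) = hatf a x.
Proof.
move=> x0; under eq_cint => t do rewrite expi_cexp.
rewrite cint_chif; last by move=> *; exact: okI_cexp.
have l0 : (0 +i* x) != 0 :> R[i] by rewrite eq_complex /= eqxx.
have -> : hatf a x = (cexp ((0 +i* x) * a%:C) - 1) / (0 +i* x).
  rewrite /hatf /chat; congr ((cexp _ - 1) / _); apply: complexP; rewrite ?ReM ?ImM /=; ring.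
case: leP => a0; rewrite cI_cexp ?(ltW a0) // mulr0 cexp0 //.
by rewrite -mulNr opprB.
Qed.

End complex_ftc.

(** * Truncated Fourier transforms as inner products *)

Section fourier_transform.
Context (R : realType).
Local Notation mu := (@lebesgue_measure R).
Local Notation V := (L2 mu).

(** The conjugate of the truncated Fourier kernel, so that [ftf N u x] is the inner product of u
    with it. *)
Definition kern (N : nat) (x t : R) : R[i] := iv (- N%:R) N%:R t * expi (- (x * t)).

Lemma cmeasurable_expi (x : R) : cmeasurable (fun t : R => expi (x * t)).
Proof. by split; [exact: measurable_cosM|exact: measurable_sinM]. Qed.

Lemma cmeasurable_kern N x : cmeasurable (kern N x).
Proof.
apply: cmeasurableM; first exact: cmeasurable_iv.
have := cmeasurable_expi (- x).
by rewrite (_ : (fun t => _) = (fun t : R => expi (- (x * t)))) //; apply/funext => t; rewrite mulNr.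
Qed.

Lemma sint_iv (p q c : R) : p <= q -> sint mu (fun t : R => iv p q t * c%:C) = (c ^+ 2 * (q - p))%:E.
Proof.
move=> pq; rewrite EFinM -(integral_cc pq) -ge0_integralZl //; first last.
- by rewrite lee_fin sqr_ge0.
- by apply/measurable_EFinP; exact: measurable_ind.
apply: eq_integral => x _; rewrite cmodM cmod_iv cmod_real exprMn real_normK ?num_real //.
by case: (_ && _); rewrite /= ?expr1n ?mul1r ?mulr1 ?expr0n ?mul0r ?mulr0 -?EFinM ?mulr1 ?mulr0.
Qed.

Lemma sqi_kern N x : cLfun mu 2%:E (kern N x).
Proof.
have NN : - N%:R <= N%:R :> R by have := ler0n R N; lra.
apply/sqiP; split; first exact: cmeasurable_kern.
apply: (@le_lt_trans _ _ (sint mu (fun t : R => iv (- N%:R) N%:R t * 1%:C))).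
  apply: sint_le; first exact: cmeasurable_kern.
    by apply: cmeasurableM; [exact: cmeasurable_iv|exact: cmeasurable_cst].
  by move=> t; rewrite !cmodM cmod_expi cmod1.
by rewrite sint_iv // ltry.
Qed.

Definition kernL2 N x : V := L2_of mu (kern N x).

Definition ftf (N : nat) (u : V) (x : R) : R[i] :=
  cintegral `[- N%:R, N%:R] (fun t => expi (x * t) * L2_repr u t).

Lemma ftf_dot N u x : ftf N u x = dot u (kernL2 N x).
Proof.
rewrite (@dot_ae _ _ _ mu _ _ _ _ (cmeasurable_repr u) (cmeasurable_kern N x) (aeW _ (fun=> erefl)) (L2_ofK (sqi_kern N x))).
have E t : L2_repr u t * (kern N x t)^* = iv (- N%:R) N%:R t * (expi (x * t) * L2_repr u t).
  by rewrite /kern conjM conj_expi opprK /iv conjc_real mulrC mulrA.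
rewrite /ftf /cintegral; apply: complexP; rewrite ?Re_cint ?Im_cint /=.
  rewrite Rintegral_mkcond; congr fine; apply: eq_integral => t _.
  rewrite E patchE mem_setE in_itv /= ReZ.
  by case: (_ && _); rewrite ?mul1r ?mul0r.
rewrite Rintegral_mkcond; congr fine; apply: eq_integral => t _.
rewrite E patchE mem_setE in_itv /= [in RHS]ImM /= mul0r addr0.
by case: (_ && _); rewrite ?mul1r ?mul0r.
Qed.

(** Lipschitz dependence on x, from |e^(i s) - 1| <= |s| and |t| <= N on an interval of length 2 N.
    It makes the truncated transforms continuous, hence measurable. *)
Lemma nrm_kernL2_sub N x y : nrm (kernL2 N x - kernL2 N y) <= N%:R * `|x - y| * Num.sqrt (2 * N%:R).
Proof.
have NN : - N%:R <= N%:R :> R by have := ler0n R N; lra.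
apply: nrm_L2_le; first by rewrite !mulr_ge0 ?sqrtr_ge0 ?ler0n.
have mk : cmeasurable (fun t : R => kern N x t - kern N y t).
  by apply: cmeasurableB; exact: cmeasurable_kern.
rewrite (@sint_ae _ _ _ mu _ (fun t : R => kern N x t - kern N y t)) //; first last.
- apply: aeS (ae_and (L2_subE (kernL2 N x) (kernL2 N y)) (ae_and (L2_ofK (sqi_kern N x)) (L2_ofK (sqi_kern N y)))).
  by move=> t [-> [-> ->]].
- exact: cmeasurable_repr.
apply: (@le_trans _ _ (sint mu (fun t : R => iv (- N%:R) N%:R t * (N%:R * `|x - y|)%:C))).
  apply: sint_le => //.
    by apply: cmeasurableM; [exact: cmeasurable_iv|exact: cmeasurable_cst].
  move=> t; rewrite /kern -mulrBr !cmodM cmod_iv cmod_real.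
  case: (boolP (- N%:R <= t <= N%:R)) => [ht|_]; last by rewrite !mul0r.
  rewrite !mul1r ger0_norm ?mulr_ge0 ?ler0n //.
  have -> : expi (- (x * t)) - expi (- (y * t)) = expi (- (y * t)) * (expi ((y - x) * t) - 1).
    by rewrite mulrBr mulr1 -expiD; congr (expi _ - _); ring.
  rewrite cmodM cmod_expi mul1r.
  apply: (@le_trans _ _ (`|(y - x) * t|)).
    rewrite -(@ler_pXn2r _ 2) ?nnegrE ?cmod_ge0 // cmod_expi_sub1.
    rewrite real_normK ?num_real //; have := one_sub_cos_le ((y - x) * t); lra.
  by rewrite normrM distrC mulrC ler_wpM2r // ler_norml.
rewrite sint_iv // lee_fin [leRHS]exprMn sqr_sqrtr ?mulr_ge0 ?ler0n //.
by rewrite ler_wpM2l ?sqr_ge0 //; lra.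
Qed.

Lemma cmeasurable_ftf N u : cmeasurable (ftf N u).
Proof.
apply: ccont_measurable => x e e0.
pose C := nrm u * (N%:R * Num.sqrt (2 * N%:R)) + 1.
have C0 : 0 < C by rewrite /C ltr_wpDl // !mulr_ge0 ?nrm_ge0 ?sqrtr_ge0 ?ler0n.
exists (e / C); first exact: divr_gt0.
move=> y; rewrite ltr_pdivlMr // => h; rewrite !ftf_dot -(ipBr (L2_inner mu)).
apply: le_trans (cauchy_schwarz (L2_inner mu) _ _) _.
apply: le_trans (ler_wpM2l (nrm_ge0 u) (nrm_kernL2_sub N y x)) _.
apply: le_trans _ (ltW h); rewrite /C mulrDr mulr1.
rewrite (_ : nrm u * (_ * _) = `|y - x| * (nrm u * (N%:R * Num.sqrt (2 * N%:R)))); last by ring.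
by rewrite lerDl.
Qed.

End fourier_transform.

Section plancherel.
Context (R : realType).
Local Notation mu := (@lebesgue_measure R).
Local Notation V := (L2 mu).
Let ip := L2_inner mu.
Local Notation MR := (@Mult _ _ R mu).

Definition clip (N : nat) (a : R) : R := Num.max (- N%:R) (Num.min a N%:R).

(** Truncation to [- N, N] only moves the endpoint of a signed indicator. For a < - N the closed
    interval keeps the point - N, which [chif (clip N a)] leaves out. *)
Lemma chif_clip N a t : t <> - N%:R ->
  iv (- N%:R) N%:R t * (chif a t)%:C = (chif (clip N a) t)%:C.
Proof.
have n0 := ler0n R N; set n := N%:R in n0 *; move=> tn.
rewrite /iv -rmorphM; congr (_%:C); rewrite /chif /clip -/n le_max le_min gt_max gt_min.
have -> : (- n <= t) = (- n < t) by rewrite le_eqVlt eq_sym; case: eqP.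
case: (ltP 0 t) => t0; rewrite /= ?andbF ?andbT ?subr0 ?sub0r.
  have -> : - n < t by lra.
  have -> : t <= - n = false by apply/negbTE; lra.
  by case: (t <= a); case: (t <= n); rewrite /= ?mulr1 ?mulr0.
have -> : t <= n by lra.
have -> : n < t = false by apply/negbTE; lra.
by rewrite andbT orbF; case: (- n < t); rewrite /= ?mul1r ?mul0r ?oppr0.
Qed.

Lemma ebounded_iv p q : ebounded mu (iv p q).
Proof.
split; first exact: cmeasurable_iv.
by exists 1; apply: aeW => x; rewrite cmod_iv; case: (_ && _).
Qed.

Lemma Mult_iv_chi N a : MR (iv (- N%:R) N%:R) (chi a) = chi (clip N a) :> V.
Proof.
apply: L2_ext.
apply: aeS (ae_and (ae_and (MultE (chi a) (ebounded_iv (- N%:R) N%:R)) (chiE a))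
  (ae_and (chiE (clip N a)) (ae_neq (- N%:R)))) => x [[-> ->] [-> xn]].
exact: chif_clip.
Qed.

Lemma ftf_chi N a x : x != 0 -> ftf N (chi a) x = hatf (clip N a) x.
Proof.
move=> x0; rewrite ftf_dot -cint_chif_expi //.
have mc c := cmeasurable_real (@measurable_chif R c).
rewrite (@dot_ae _ _ _ mu _ _ _ _ (mc a) (cmeasurable_kern N x) (chiE a) (L2_ofK (sqi_kern N x))).
apply: cint_ae.
- by apply: cmeasurableM; [exact: mc|apply: cmeasurable_conj; exact: cmeasurable_kern].
- by apply: cmeasurableM; [exact: mc|exact: cmeasurable_expi].
- apply: aeS (ae_neq (- N%:R)) => t tn; rewrite -(chif_clip a tn).
  by rewrite /kern conjM conj_expi opprK /iv conjc_real mulrCA mulrA.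
Qed.

Lemma ftfP N c (u v : V) x : ftf N (c *: u + v) x = c * ftf N u x + ftf N v x.
Proof. by rewrite !ftf_dot (ipDl ip) (ipZl ip). Qed.

(** Pairs a step function with its transform. It is a relation because a step function has many
    representations by the functions chi a. *)
Inductive fstep : V -> V -> Prop :=
| fstep0 : fstep 0 0
| fstepS a c s g : fstep s g -> fstep (c *: chi a + s) (c *: hat a + g).

Lemma fstep_dot s g t h : fstep s g -> fstep t h -> dot g h = (kap R)%:C * dot s t.
Proof.
move=> fs ft.
have one a : dot (hat a) h = (kap R)%:C * dot (chi a) t.
  elim: ft => [|b c t' h' _ IH]; first by rewrite !(ip0r ip) mulr0.
  by rewrite !(ipDr ip) !(ipZr ip) IH dot_hat mulrDr mulrCA.
elim: fs => [|a c s' g' _ IH]; first by rewrite !(ip0l ip) mulr0.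
by rewrite !(ipDl ip) !(ipZl ip) IH one mulrDr mulrCA.
Qed.

Lemma nrm_fstep s g : fstep s g -> nrm g ^+ 2 = kap R * nrm s ^+ 2.
Proof.
move=> fs; have := fstep_dot fs fs; rewrite !(ip_nrm ip) -rmorphM.
by move=> /(congr1 (@complex.Re R)).
Qed.

Lemma step_ft N (s : V) : stepf s -> exists2 g, fstep (MR (iv (- N%:R) N%:R) s) g &
  {ae mu, forall x, ftf N s x = L2_repr g x}.
Proof.
have bM := bop_Mult (ebounded_iv (- N%:R) N%:R).
elim=> [|a c s' _ [g fg hg]].
  exists 0; first by rewrite (bop0 bM); exact: fstep0.
  by apply: aeS (@L2_zeroE _ _ _ mu) => x ->; rewrite ftf_dot (ip0l ip).
exists (c *: hat (clip N a) + g).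
  by rewrite (bopD _ _ bM) (bopZ _ _ bM) Mult_iv_chi; exact: fstepS.
have h2 := ae_and (L2_addE (c *: hat (clip N a)) g) (ae_and (L2_scaleE c (hat (clip N a))) (hatE (clip N a))).
apply: aeS (ae_and (ae_and hg (ae_neq 0)) h2) => x [[e1 /eqP x0] [-> [-> ->]]].
by rewrite ftfP e1 ftf_chi.
Qed.

(** Step functions s k of norm at most 2 |u| tend to u. Their truncated transforms tend pointwise to
    that of u, being inner products with a fixed kernel, and Fatou's lemma passes the bound for step
    functions to the limit. *)
Lemma sint_ftf N (u : V) : (sint mu (ftf N u) <= (kap R * (2 * nrm u) ^+ 2)%:E)%E.
Proof.
have [->|u0] := eqVneq u 0.
  rewrite nrm0 mulr0 expr0n mulr0 (_ : ftf N 0 = fun=> 0); last first.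
    by apply/funext => x; rewrite ftf_dot (ip0l ip).
  by rewrite /sint cmod0 expr0n integral0.
have nu : 0 < nrm u.
  by rewrite lt_def nrm_ge0 andbT; apply: contra u0 => /eqP /nrm_eq0 ->.
have ex (k : nat) : exists s, stepf s /\ nrm (u - s) <= nrm u * k.+1%:R^-1.
  have := @step_dense R u (nrm u * k.+1%:R^-1); rewrite mulr_gt0 ?invr_gt0 ?ltr0n //.
  by move=> /(_ isT) [s s1 s2]; exists s.
have [s hs] := choice ex.
apply: (@fatou_sint _ _ _ mu (fun k => ftf N (s k))).
- by move=> k; exact: cmeasurable_ftf.
- exact: cmeasurable_ftf.
- apply: aeW => x.
  apply: (@squeeze_cvgr _ _ _ _ (cst 0) (fun k => nrm u * nrm (kernL2 N x) * harmonic k)).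
  + apply: nearW => k; apply/andP; split; first exact: cmod_ge0.
    rewrite !ftf_dot -(ipBl ip); apply: le_trans (cauchy_schwarz ip _ _) _.
    rewrite mulrAC ler_wpM2r ?nrm_ge0 // nrmC; by case: (hs k).
  + exact: cvg_cst.
  + rewrite -[X in _ --> X](mulr0 (nrm u * nrm (kernL2 N x))).
    by apply: cvgM; [exact: cvg_cst|exact: cvg_harmonic].
- apply: nearW => k; have [sk nk] := hs k; have [g fg hg] := step_ft N sk.
  rewrite (@sint_ae _ _ _ mu _ (L2_repr g)); first last.
  + exact: hg.
  + exact: cmeasurable_repr.
  + exact: cmeasurable_ftf.
  rewrite -nrm_sint lee_fin (nrm_fstep fg) ler_pM2l ?kap_gt0 //.
  rewrite ler_pXn2r ?nnegrE ?nrm_ge0 ?mulr_ge0 ?nrm_ge0 //.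
  apply: (@le_trans _ _ (1 * nrm (s k))).
    apply: nrm_Mult => //; first exact: cmeasurable_iv.
    by apply: aeW => x; rewrite cmod_iv; case: (_ && _).
  rewrite mul1r; apply: le_trans (nrm_subr _ u) _; rewrite mulr_natl mulr2n lerD2l nrmC.
  by apply: le_trans nk _; apply: ler_piMr; [exact: ltW|rewrite invf_le1 ?ltr0n // ler1n].
Qed.

Lemma sqi_ftf N (u : V) : cLfun mu 2%:E (ftf N u).
Proof.
apply/sqiP; split; first exact: cmeasurable_ftf.
by apply: le_lt_trans (sint_ftf N u) _; rewrite ltry.
Qed.

Definition ft N (u : V) : V := L2_of mu (ftf N u).

(** The factor 2 is left over from the approximation in [sint_ftf]; the sharp value sqrt kap comes
    with [nrm_fourier]. *)
Definition ft_bound : R := Num.sqrt (kap R) * 2.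

Lemma ft_bound_gt0 : 0 < ft_bound.
Proof. by rewrite mulr_gt0 // sqrtr_gt0 kap_gt0. Qed.

Lemma nrm_ft N (u : V) : nrm (ft N u) <= ft_bound * nrm u.
Proof.
rewrite -(@ler_pXn2r _ 2) ?nnegrE ?nrm_ge0 ?mulr_ge0 ?nrm_ge0 ?sqrtr_ge0 //.
rewrite -lee_fin (nrm_L2_of (sqi_ftf N u)) /ft_bound -mulrA exprMn sqr_sqrtr ?(ltW (kap_gt0 R)) //.
exact: sint_ftf.
Qed.

Lemma bop_ft N : bop (ft N).
Proof.
split; last by exists ft_bound; [exact: ltW ft_bound_gt0|exact: nrm_ft].
move=> a u v; apply: L2_ext.
have h1 := ae_and (L2_addE (a *: ft N u) (ft N v)) (L2_scaleE a (ft N u)).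
have h2 := ae_and (L2_ofK (sqi_ftf N u)) (L2_ofK (sqi_ftf N v)).
apply: aeS (ae_and (L2_ofK (sqi_ftf N (a *: u + v))) (ae_and h1 h2)).
move=> x [e1 [[e2 e3] [e4 e5]]]; transitivity (ftf N (a *: u + v) x); first exact: e1.
transitivity (L2_repr (a *: ft N u) x + L2_repr (ft N v) x); last by symmetry; exact: e2.
by rewrite ftfP; congr (_ + _); [rewrite -e4; symmetry; exact: e3|symmetry; exact: e5].
Qed.

Lemma ft_chi (N : nat) a : `|a| <= N%:R -> ft N (chi a) = hat a.
Proof.
move=> aN; apply: L2_of_ae; [exact: sqi_ftf|exact: sqi_hatf|].
apply: aeS (ae_neq 0) => x /eqP x0; rewrite ftf_chi //; congr (hatf _ x).
by move: aN; rewrite ler_norml /clip => /andP[h1 h2]; rewrite min_l // max_r.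
Qed.

(** Once [- N, N] contains all endpoints, truncation no longer changes a step function. *)
Lemma step_stable (s : V) : stepf s -> exists N0, forall N, (N0 <= N)%N -> ft N s = ft N0 s.
Proof.
elim=> [|a c s' _ [N0 h]]; first by exists 0%N => N _; rewrite !(bop0 (bop_ft _)).
pose A := (Num.truncn `|a|).+1.
have aA N : (A <= N)%N -> `|a| <= N%:R.
  by move=> AN; apply: le_trans (ltW (truncnS_gt _)) _; rewrite ler_nat.
exists (N0 + A)%N => N hN; have [l1 _] := bop_ft N; have [l2 _] := bop_ft (N0 + A)%N.
have e1 : ft N (chi a) = hat a by apply: ft_chi; apply: aA; exact: leq_trans (leq_addl _ _) hN.
have e2 : ft (N0 + A)%N (chi a) = hat a by apply: ft_chi; apply: aA; exact: leq_addl.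
have e3 := h N (leq_trans (leq_addr _ _) hN); have e4 := h (N0 + A)%N (leq_addr _ _).
by rewrite l1 l2 e1 e2 e3 e4.
Qed.

(** The sequence is Cauchy by the uniform bound [nrm_ft] and the density of step functions, on which
    it is eventually constant. *)
Lemma fourier_tends (u : V) : tends (fun N => ft N u) (fourier u).
Proof.
have [l hl] : exists l, tends (fun N => ft N u) l.
  apply: cauchy_complete; first exact: L2_complete.
  move=> e e0; have d0 : 0 < e / 2 / ft_bound by rewrite !divr_gt0 // ft_bound_gt0.
  have [s ss hs] := step_dense u d0; have [N0 hN] := step_stable ss.
  exists N0 => n m hn hm.
  have -> : ft n u - ft m u = ft n (u - s) - ft m (u - s).
    have tri (W : zmodType) (a b c : W) : a - b = (a - c) - (b - c) by rewrite opprB addrA subrK.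
    have e1 := bopB u s (bop_ft n); have e2 := bopB u s (bop_ft m).
    by rewrite e1 e2 (hN n hn) (hN m hm); exact: tri.
  apply: le_trans (nrmB _ _) _; rewrite [leRHS]splitr.
  by apply: lerD; apply: le_trans (nrm_ft _ _) _; rewrite mulrC -ler_pdivlMr ?ft_bound_gt0.
by rewrite (_ : fourier u = l) //; exact: (tends_lim hl).
Qed.

Lemma tendsD (W : normedModType R[i]) (a b : nat -> W) x y c :
  tends a x -> tends b y -> tends (fun n => c *: a n + b n) (c *: x + y).
Proof.
move=> ha hb e e0; pose D := cmod c + 1.
have D0 : 0 < D by rewrite /D ltr_wpDl ?cmod_ge0.
have [N hN] := ha (e / 2 / D) ltac:(by rewrite !divr_gt0).
have [M hM] := hb (e / 2) ltac:(by rewrite divr_gt0).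
exists (N + M)%N => n hn.
rewrite opprD addrACA -scalerBr; apply: le_trans (nrmD _ _) _; rewrite [leRHS]splitr.
apply: lerD; last by apply: hM; exact: leq_trans (leq_addl _ _) hn.
rewrite nrmZ; have := hN n (leq_trans (leq_addr _ _) hn); rewrite ler_pdivlMr // => h.
apply: le_trans _ h; rewrite mulrC ler_wpM2l ?nrm_ge0 // /D; lra.
Qed.

Lemma bop_fourier : bop (@fourier R : V -> V).
Proof.
split.
  move=> a u v; apply: tends_unique (fourier_tends (a *: u + v)) _.
  have := tendsD a (fourier_tends u) (fourier_tends v).
  rewrite (_ : (fun n => _) = (fun N => ft N (a *: u + v))) //.
  by apply/funext => N; case: (bop_ft N).
exists ft_bound; first exact: ltW ft_bound_gt0.
move=> u; apply/ler_addgt0Pr => e e0; have [N hN] := fourier_tends u e0.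
apply: le_trans (nrm_subr _ (ft N u)) _; apply: lerD; first exact: nrm_ft.
by rewrite nrmC hN.
Qed.

Lemma fourier_chi a : fourier (chi a) = hat a :> V.
Proof.
apply: tends_unique (fourier_tends _) _ => e e0.
exists (Num.truncn `|a|).+1 => n hn; rewrite ft_chi ?subrr ?nrm0 ?ltW //.
by apply: lt_le_trans (truncnS_gt _) _; rewrite ler_nat.
Qed.

Local Notation J := (@reflection R : V -> V).

Lemma sqi_oppr (f : R -> R[i]) : cLfun mu 2%:E f -> cLfun mu 2%:E (fun x : R => f (- x)).
Proof.
move=> /sqiP [mf sf]; apply/sqiP; split; first exact: cmeasurable_oppr.
by rewrite -sint_oppr.
Qed.

Lemma reflectionE (u : V) : {ae mu, forall x : R, L2_repr (J u) x = L2_repr u (- x)}.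
Proof. by apply: L2_ofK; apply: sqi_oppr; exact: L2_reprP. Qed.

Lemma nrm_reflection (u : V) : nrm (J u) = nrm u.
Proof.
apply/eqP; rewrite -(@eqrXn2 _ 2) ?nrm_ge0 //; apply/eqP; apply: EFin_inj.
rewrite nrm_L2_of; last by apply: sqi_oppr; exact: L2_reprP.
by rewrite nrm_sint; symmetry; exact: (sint_oppr (cmeasurable_repr u)).
Qed.

Lemma bop_reflection : bop J.
Proof.
split; last by exists 1 => // u; rewrite nrm_reflection mul1r.
move=> a u v; apply: L2_ext.
have h1 := ae_and (reflectionE (a *: u + v)) (ae_oppr (ae_and (L2_addE (a *: u) v) (L2_scaleE a u))).
have h2 := ae_and (L2_addE (a *: J u) (J v)) (L2_scaleE a (J u)).
apply: aeS (ae_and h1 (ae_and h2 (ae_and (reflectionE u) (reflectionE v)))).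
by move=> x [[-> [-> ->]] [[-> ->] [-> ->]]].
Qed.

Lemma reflectionK (u : V) : J (J u) = u.
Proof.
apply: L2_ext; apply: aeS (ae_and (reflectionE (J u)) (ae_oppr (reflectionE u))) => x [-> ->].
by rewrite opprK.
Qed.

Lemma chifN (a y : R) : y <> 0 -> y <> - a -> chif a (- y) = - chif (- a) y.
Proof.
move=> /eqP y0 /eqP ya; rewrite /chif opprB; congr (_%:R - _%:R).
  by rewrite oppr_gt0 lerNl; rewrite [- a <= y]le_eqVlt [y <= 0]le_eqVlt eq_sym (negbTE ya) (negbTE y0) andbC.
by rewrite ltrNr oppr_le0; rewrite [y <= - a]le_eqVlt [0 <= y]le_eqVlt (negbTE ya) eq_sym (negbTE y0) andbC.
Qed.

Lemma reflection_chi a : J (chi a) = - chi (- a).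
Proof.
rewrite -scaleN1r; apply: L2_ext.
have h := ae_and (reflectionE (chi a)) (ae_oppr (chiE a)).
have h2 := ae_and (L2_scaleE (-1) (chi (- a))) (chiE (- a)).
apply: aeS (ae_and (ae_and h h2) (ae_and (ae_neq 0) (ae_neq (- a)))) => x [[[-> ->] [-> ->]] [x0 xa]].
rewrite mulN1r -rmorphN; congr (_%:C).
exact: chifN.
Qed.

Lemma hatfN (a x : R) : hatf a (- x) = - hatf (- a) x.
Proof.
by rewrite !hatfE; apply: complexP; rewrite /= !mulrN !mulNr ?sinN ?cosN invrN ?mulrN ?mulNr ?opprK.
Qed.

Lemma reflection_hat a : J (hat a) = - hat (- a).
Proof.
rewrite -scaleN1r; apply: L2_ext.
have h := ae_and (reflectionE (hat a)) (ae_oppr (hatE a)).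
have h2 := ae_and (L2_scaleE (-1) (hat (- a))) (hatE (- a)).
apply: aeS (ae_and h h2) => x [[-> ->] [-> ->]].
by rewrite hatfN mulN1r.
Qed.

Lemma fourier_reflection (u : V) : fourier (J u) = J (fourier u) :> V.
Proof.
apply/eqP; rewrite -subr_eq0; apply/eqP; move: u; apply: bop_ext.
  by apply: bop_sub; [exact: (bop_comp bop_reflection bop_fourier)|exact: (bop_comp bop_fourier bop_reflection)].
move=> a; rewrite reflection_chi (bopN _ bop_fourier) !fourier_chi reflection_hat.
by rewrite subrr.
Qed.

Lemma Rintegral_scale (a : R) (g : R -> R) : 0 < a -> mu.-integrable setT (EFin \o g) ->
  \int[mu]_x g x = a * \int[mu]_x g (a * x).
Proof.
move=> a0 ig; have [mg _] := integrableP _ _ _ ig.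
have mg' : measurable_fun setT (EFin \o (fun x => g (a * x))).
  apply: (measurableT_comp mg); exact: measurable_funM.
have hp := ge0_integral_scale a0 (measurable_funepos mg) (fun x => funepos_ge0 _ x).
have hn := ge0_integral_scale a0 (measurable_funeneg mg) (fun x => funeneg_ge0 _ x).
have fp : (\int[mu]_x (EFin \o g)^\+ x)%E \is a fin_num.
  exact: (integrable_fin_num measurableT (integrable_funepos measurableT ig)).
have fn : (\int[mu]_x (EFin \o g)^\- x)%E \is a fin_num.
  exact: (integrable_fin_num measurableT (integrable_funeneg measurableT ig)).
have E (k : R -> R) : (\int[mu]_x (k x)%:E = \int[mu]_x (EFin \o k)^\+ x - \int[mu]_x (EFin \o k)^\- x)%E.
  exact: integralE.
have ep : ((EFin \o (fun x : R => (g (a * x))%R))^\+%E = (fun x : R => (EFin \o g)^\+%E (a * x)%R)).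
  by apply/funext => x; rewrite !funeposE.
have en : ((EFin \o (fun x : R => (g (a * x))%R))^\-%E = (fun x : R => (EFin \o g)^\-%E (a * x)%R)).
  by apply/funext => x; rewrite !funenegE.
have f0 (X : \bar R) : (a%:E * X)%E \is a fin_num -> X \is a fin_num.
  by case: X => // ; rewrite ?gt0_muley ?gt0_muleNy ?lte_fin.
rewrite /Rintegral (E g) (E (fun x => g (a * x))) ep en.
have fp' : (\int[mu]_x (EFin \o g)^\+%E (a * x)%R)%E \is a fin_num by apply: f0; rewrite -hp.
have fn' : (\int[mu]_x (EFin \o g)^\-%E (a * x)%R)%E \is a fin_num by apply: f0; rewrite -hn.
have gen (X Y X' Y' : \bar R) : X = (a%:E * X')%E -> Y = (a%:E * Y')%E ->
    X' \is a fin_num -> Y' \is a fin_num -> fine (X - Y) = a * fine (X' - Y').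
  by move=> -> ->; case: X' => // x _; case: Y' => //= y; rewrite mulrBr.
exact: gen hp hn fp' fn'.
Qed.

Let cb a b : cintble mu (fun x : R => hatf a x * ((chif b x)%:C)^*).
Proof. by apply: sqi_mul; [exact: sqi_hatf|exact: sqi_chif]. Qed.

Let Psi c := cint mu (fun y : R => hatf 1 y * ((chif c y)%:C)^*).

(** Scaling x by a turns the pairing of hat a with chi b into that of hat 1 with chi (a b). The
    pairing is therefore symmetric in a and b, and this symmetry makes J F the adjoint of F. *)
Let PsiE a b : cint mu (fun x : R => hatf a x * ((chif b x)%:C)^*) = Psi (a * b).
Proof.
have pos a' b' : 0 < a' -> cint mu (fun x : R => hatf a' x * ((chif b' x)%:C)^*) = Psi (a' * b').
  move=> a0.
  have E (x : R) : hatf a' x * ((chif b' x)%:C)^* =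
     a'%:C * (hatf 1 (a' * x) * ((chif (a' * b') (a' * x))%:C)^*).
    rewrite mulrA; congr (_ * _).
      rewrite !hatfE mul1r; have [->|x0] := eqVneq x 0.
        by rewrite mulr0 invr0 !mulr0; apply: complexP; rewrite ?ReM ?ImM /=; ring.
      by apply: complexP; rewrite ?ReM ?ImM /=; field; rewrite x0 gt_eqF.
    congr ((_%:C)^*); rewrite /chif; congr (_%:R - _%:R).
      by rewrite pmulr_rgt0 // ler_pM2l.
    by rewrite ltr_pM2l // pmulr_rle0.
  have cbs := cb 1 (a' * b').
  have ER (x : R) : a'^-1 * complex.Re (hatf a' x * ((chif b' x)%:C)^*) =
      complex.Re (hatf 1 (a' * x) * ((chif (a' * b') (a' * x))%:C)^*).
    by rewrite E ReZ mulKf // gt_eqF.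
  have ER' (x : R) : complex.Re (hatf a' x * ((chif b' x)%:C)^*) =
      a' * complex.Re (hatf 1 (a' * x) * ((chif (a' * b') (a' * x))%:C)^*).
    by rewrite E ReZ.
  have EI' (x : R) : complex.Im (hatf a' x * ((chif b' x)%:C)^*) =
      a' * complex.Im (hatf 1 (a' * x) * ((chif (a' * b') (a' * x))%:C)^*).
    by rewrite E ImM [complex.Im _%:C]/= mul0r addr0.
  have EI (x : R) : a'^-1 * complex.Im (hatf a' x * ((chif b' x)%:C)^*) =
      complex.Im (hatf 1 (a' * x) * ((chif (a' * b') (a' * x))%:C)^*).
    by rewrite E ImM [complex.Im _%:C]/= mul0r addr0 [complex.Re _%:C]/= mulKf // gt_eqF.
  apply: complexP; rewrite ?Re_cint ?Im_cint.
    rewrite (Rintegral_scale a0 (cintble_Re cbs)) -RintegralZl //.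
      by congr fine; apply: eq_integral => x _; congr (_%:E); exact: ER'.
    have := integrableZl measurableT a'^-1 (cintble_Re (cb a' b')).
    by apply: eq_integrable => // x _; congr (_%:E); exact: ER.
  rewrite (Rintegral_scale a0 (cintble_Im cbs)) -RintegralZl //.
    by congr fine; apply: eq_integral => x _; congr (_%:E); exact: EI'.
  have := integrableZl measurableT a'^-1 (cintble_Im (cb a' b')).
  by apply: eq_integrable => // x _; congr (_%:E); exact: EI.
have [a0|a0|->] := ltgtP a 0; last 1 first.
- have h0 (x : R) : hatf 0 x = 0.
    by rewrite hatfE mul0r sin0 cos0 subrr; apply: complexP; rewrite /= mul0r.
  have c0 (x : R) : (chif 0 x)%:C^* = 0 :> R[i].
    by rewrite conjc_real /chif; case: (ltgtP 0 x) => _; rewrite subrr.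
  by rewrite mul0r /Psi; apply: eq_cint => x; rewrite h0 mul0r c0 mulr0.
- rewrite -mulrNN -pos ?oppr_gt0 // cint_oppr; last by case: (cb a b).
  apply: cint_ae.
  + by have [m _] := cb a b; exact: cmeasurable_oppr m.
  + by case: (cb (- a) (- b)).
  + apply: aeS (ae_and (ae_neq 0) (ae_neq (- b))) => x [x0 xb].
    suff key (y : R) : y <> 0 -> y <> - b ->
      hatf a (- y) * ((chif b (- y))%:C)^* = hatf (- a) y * ((chif (- b) y)%:C)^* by exact: key.
    by move=> y0 yb; rewrite hatfN chifN // !conjc_real rmorphN mulrNN.
- exact: pos.
Qed.

Lemma conj_hatfN (a x : R) : (hatf a (- x))^* = hatf a x.
Proof.
rewrite !hatfE mulrN sinN cosN invrN.
by apply: complexP; rewrite /= ?mulrNN // mulrN opprK.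
Qed.

Let dot_fourier_chi a b : dot (fourier (chi a) : V) (chi b) = dot (chi a) (J (fourier (chi b))).
Proof.
rewrite !fourier_chi.
have mc c := cmeasurable_real (@measurable_chif R c).
have mh c := @cmeasurable_hatf R c.
rewrite (@dot_ae _ _ _ mu _ _ _ _ (mh a) (mc b) (hatE a) (chiE b)) PsiE.
have h : {ae mu, forall x : R, L2_repr (J (hat b)) x = hatf b (- x)}.
  by apply: aeS (ae_and (reflectionE (hat b)) (ae_oppr (hatE b))) => x [-> ->].
rewrite (@dot_ae _ _ _ mu _ _ _ _ (mc a) (cmeasurable_oppr (mh b)) (chiE a) h).
rewrite mulrC -PsiE; apply: eq_cint => x; rewrite conj_hatfN mulrC; congr (_ * _).
by rewrite conjc_real.
Qed.

Lemma bop_dot (w : V) : bop (fun u : V => dot u w : R[i]^o).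
Proof.
split; first by move=> a u v; rewrite (ipDl ip) (ipZl ip).
exists (nrm w); first exact: nrm_ge0.
move=> u; rewrite mulrC; apply: le_trans (cauchy_schwarz ip u w).
by rewrite -lecr -nrmE normcE_cmod.
Qed.

(** The identity on pairs of signed indicators extends by density, first in v after conjugation and
    then in u. *)
Lemma dot_fourier (u v : V) : dot (fourier u : V) v = dot u (J (fourier v)).
Proof.
have bFJ := bop_comp bop_fourier bop_reflection.
have h a : dot (fourier (chi a) : V) v = dot (chi a) (J (fourier v)).
  have := bop_ext (bop_sub (bop_dot (fourier (chi a))) (bop_comp bFJ (bop_dot (chi a)))) _ v.
  have hb b : dot (chi b) (fourier (chi a)) - dot (J (fourier (chi b))) (chi a) = 0.
    by rewrite (ipC ip) dot_fourier_chi -(ipC ip) subrr.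
  move=> /(_ hb) /eqP; rewrite subr_eq0 => /eqP e.
  by rewrite (ipC ip) e -(ipC ip).
have := bop_ext (bop_sub (bop_comp bop_fourier (bop_dot v)) (bop_dot (J (fourier v)))) _ u.
have ha a : dot (fourier (chi a) : V) v - dot (chi a) (J (fourier v)) = 0 by rewrite h subrr.
by move=> /(_ ha) /eqP; rewrite subr_eq0 => /eqP.
Qed.

(** By the adjoint relation, the matrix of J F F on signed indicators is the Gram matrix of their
    transforms, that is, kap times their own. *)
Lemma fourier_fourier (u : V) : J (fourier (fourier u)) = (kap R)%:C *: u.
Proof.
apply/eqP; rewrite -subr_eq0; apply/eqP; move: u.
apply: (bop_ext (bop_sub (bop_comp (bop_comp bop_fourier bop_fourier) bop_reflection)
  (bop_scale (kap R)%:C (@bop_id R V)))) => b.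
apply: weak_zero => a; rewrite (ipC ip) (ipBr ip) (ipZr ip) -dot_fourier !fourier_chi dot_hat.
by rewrite conjc_real subrr conjc0.
Qed.

Let kap_neq0 : (kap R)%:C != 0 :> R[i].
Proof. by rewrite eq_complex /= eqxx andbT gt_eqF // kap_gt0. Qed.

(** A preimage exists, namely kap^-1 J F g. Whichever preimage f the choice operator returns, J F g
    = J F F f = kap f identifies it. *)
Lemma fourier_invE (g : V) : fourier_inv g = ((kap R)^-1)%:C *: J (fourier g) :> V.
Proof.
have kV : ((kap R)^-1)%:C * (kap R)%:C = 1 :> R[i].
  by rewrite -rmorphM mulVf ?gt_eqF ?kap_gt0.
have ex : exists f, fourier f = g.
  exists (((kap R)^-1)%:C *: J (fourier g) : V).
  by rewrite (bopZ _ _ bop_fourier) fourier_reflection fourier_fourier scalerA kV scale1r.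
have /= h := xgetPex 0 ex.
rewrite -{2}h.
by rewrite fourier_fourier scalerA kV scale1r.
Qed.

Lemma dot_fourier2 (u v : V) : dot (fourier u : V) (fourier v) = (kap R)%:C * dot u v.
Proof. by rewrite dot_fourier fourier_fourier (ipZr ip) conjc_real. Qed.

Lemma nrm_fourier (u : V) : nrm (fourier u : V) = Num.sqrt (kap R) * nrm u.
Proof.
apply/eqP; rewrite -(@eqrXn2 _ 2) ?mulr_ge0 ?sqrtr_ge0 ?nrm_ge0 //; apply/eqP.
rewrite exprMn sqr_sqrtr ?(ltW (kap_gt0 R)) //.
have := dot_fourier2 u u; rewrite !(ip_nrm ip) -rmorphM.
by move=> /(congr1 (@complex.Re R)).
Qed.

End plancherel.

(** * Rational approximation on the projective line *)

Section uniform_closure.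
Context (R : realType).

(** Compactness of [a, b] makes the radius uniform in x; y ranges over all reals near x, also
    outside the interval. *)
Lemma ccont_unif (g : R -> R[i]) (a b e : R) : (forall t, ccont g t) -> 0 < e ->
  exists2 r : R, 0 < r & forall x y, a <= x <= b -> `|y - x| < r -> cmod (g y - g x) <= e.
Proof.
move=> h e0.
have /compact_near_coveringP nc := @segment_compact R a b.
have := nc R (0^'+) (fun r x => forall y, `|y - x| < r -> cmod (g y - g x) <= e) _.
have hx x : `[a, b]%classic x -> \forall x' \near x & r \near (0 : R)^'+,
    forall y, `|y - x'| < r -> cmod (g y - g x') <= e.
  move=> _; have e2 : 0 < e / 2 by rewrite divr_gt0.
  have [r r0 hr] := h x (e / 2) e2.
  have r2 : 0 < r / 2 by rewrite divr_gt0.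
  exists ([set x' | `|x' - x| < r / 2], [set s | 0 < s < r / 2]) => /=.
    split; first by exists (r / 2) => //= y /=; rewrite distrC.
    exists (r / 2) => //= s /=; rewrite sub0r normrN => s1 s2.
    by rewrite s2 (le_lt_trans (ler_norm _)).
  move=> [x' s] /= [h1 /andP[s0 s1]] y ys.
  have k1 : cmod (g x' - g x) <= e / 2 by apply: hr; lra.
  have k2 : cmod (g y - g x) <= e / 2.
    apply: hr; have -> : y - x = (y - x') + (x' - x) by rewrite addrA subrK.
    by apply: le_lt_trans (ler_normD _ _) _; lra.
  have -> : g y - g x' = (g y - g x) - (g x' - g x) by rewrite opprB addrA subrK.
  by apply: le_trans (cmodB _ _) _; lra.
move=> /(_ _ hx) [r /= r0 hr].
exists (r / 2); first by rewrite divr_gt0.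
move=> x y xab; apply: (hr (r / 2)) => /=.
- by rewrite sub0r normrN gtr0_norm ?divr_gt0 //; lra.
- by rewrite divr_gt0.
- by rewrite in_itv.
Qed.

(** In [Cdot_up], Q holds of the bounded symbols whose Hankel operator is approximable. The
    hypotheses describe an algebra closed under uniform limits that contains the constants and the
    two poles. *)
Variable Q : (R -> R[i]) -> Prop.
Hypothesis Qm : forall f, Q f -> cmeasurable f.
Hypothesis Qc : forall c, Q (fun=> c).
Hypothesis QD : forall f g, Q f -> Q g -> Q (fun x => f x + g x).
Hypothesis QM : forall f g, Q f -> Q g -> Q (fun x => f x * g x).
Hypothesis Qp : Q (fun x => (x -i* 1)^-1).
Hypothesis Qq : Q (fun x => (x +i* 1)^-1).
Hypothesis Qlim : forall f, cmeasurable f ->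
  (forall e : R, 0 < e -> exists2 g, Q g & forall x, cmod (f x - g x) <= e) -> Q f.

(** A bound accompanies membership because absolute values are approximated on [-1, 1], after
    rescaling. *)
Let Qr (r : R -> R) : Prop := Q (fun x => (r x)%:C) /\ exists B : R, forall x, `|r x| <= B.

Let Qr_cst c : Qr (fun=> c).
Proof. by split; [exact: Qc|exists `|c|]. Qed.

Let QrD r s : Qr r -> Qr s -> Qr (fun x => r x + s x).
Proof.
move=> [q1 [B hB]] [q2 [D hD]]; split.
  by have := QD q1 q2; rewrite (_ : (fun x => _) = (fun x => (r x + s x)%:C)) //; apply/funext => x; rewrite rmorphD.
by exists (B + D) => x; apply: le_trans (ler_normD _ _) _; exact: lerD.
Qed.

Let QrM r s : Qr r -> Qr s -> Qr (fun x => r x * s x).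
Proof.
move=> [q1 [B hB]] [q2 [D hD]]; split.
  by have := QM q1 q2; rewrite (_ : (fun x => _) = (fun x => (r x * s x)%:C)) //; apply/funext => x; rewrite rmorphM.
by exists (B * D) => x; rewrite normrM ler_pM.
Qed.

(* The iteration p <- p + (t^2 - p^2) / 2 approximates |t| uniformly on [-1, 1]
   by polynomials in t. *)
Lemma abs_iteration (t : R) (p := fun n => iter n (fun p => p + (t ^+ 2 - p ^+ 2) / 2) 0) :
  `|t| <= 1 -> forall n, 0 <= `|t| - p n.+1 <= 2 / n.+1%:R.
Proof.
move=> t1 n.
have h k : 0 <= p k <= `|t| /\ `|t| - p k <= `|t| * (1 - `|t| / 2) ^+ k.
  elim: k => [|k [/andP[p0 pt] IH]]; first by rewrite expr0 mulr1 /p /= subr0 lexx normr_ge0 lexx.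
  have -> : p k.+1 = p k + (`|t| ^+ 2 - p k ^+ 2) / 2 by rewrite /p /= real_normK ?num_real.
  move: (p k) p0 pt IH => q q0 qt IH.
  have a0 := normr_ge0 t; move: (`|t|) t1 a0 qt IH => s s1 s0 qt IH.
  have E : s - (q + (s ^+ 2 - q ^+ 2) / 2) = (s - q) * (1 - (s + q) / 2) by field.
  have l1 : 0 <= s - q by lra.
  have l2 : 0 <= 1 - (s + q) / 2 by lra.
  have l3 : 0 <= (s - q) * (1 - (s + q) / 2) by exact: mulr_ge0.
  split; first by apply/andP; split; [nra|lra].
  rewrite E exprSr mulrA; apply: ler_pM => //; lra.
have [/andP[p0 pt] le] := h n.+1; apply/andP; split; first by rewrite subr_ge0.
apply: le_trans le _.
(* A Bernoulli-type inequality, (1 - y)^k (1 + k y) <= 1 with y = |t| / 2, which bounds |t| (1 -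
   y)^k by 2 / k. *)
have bern k : (1 - `|t| / 2) ^+ k * (1 + k%:R * (`|t| / 2)) <= 1.
  elim: k => [|k IH]; first by rewrite expr0 mul0r addr0 mulr1.
  apply: le_trans _ IH; rewrite exprSr -mulrA; apply: ler_wpM2l.
    by rewrite exprn_ge0 //; have := normr_ge0 t; lra.
  have k0 := ler0n R k; have := normr_ge0 t; rewrite -[k.+1%:R]natr1.
  by move: (`|t|) t1 (k%:R) k0 => s s1 m m0 s0; nra.
have := bern n.+1; have x0 : 0 <= (1 - `|t| / 2) ^+ n.+1.
  by rewrite exprn_ge0 //; have := normr_ge0 t; lra.
move: ((1 - _) ^+ _) x0 => y y0; rewrite ler_pdivlMr ?ltr0n //.
by move: (n.+1%:R) => m; lra.
Qed.

Let QrZ c r : Qr r -> Qr (fun x => c * r x).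
Proof. by move=> h; apply: (QrM (Qr_cst c)). Qed.

Let Qr_abs r : Qr r -> Qr (fun x => `|r x|).
Proof.
move=> [qr [B hB]].
have B0 : 0 < `|B| + 1 by rewrite ltr_wpDl.
pose s x := (`|B| + 1)^-1 * r x.
have qs : Qr s by apply: QrZ; split => //; exists B.
have s1 x : `|s x| <= 1.
  rewrite normrM normfV (gtr0_norm B0) ler_pdivrMl // mulr1.
  by apply: le_trans (hB x) _; have := ler_norm B; lra.
have qp n : Qr (fun x => iter n (fun p => p + (s x ^+ 2 - p ^+ 2) / 2) 0).
  elim: n => [|n IH]; first exact: Qr_cst.
  have := QrD IH (QrZ 2^-1 (QrD (QrM qs qs) (QrZ (-1) (QrM IH IH)))).
  rewrite (_ : (fun x => _) = (fun x => iter n.+1 (fun p => p + (s x ^+ 2 - p ^+ 2) / 2) 0)) //.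
  by apply/funext => x /=; rewrite !expr2; field.
have qa : Qr (fun x => `|s x|).
  split; last by exists 1 => x; rewrite normr_id.
  apply: Qlim.
    have [_ _] := qs; have [m _] := Qm qs.1; apply: cmeasurable_real.
    exact: measurableT_comp.
  move=> e e0.
  have [n hn] : exists n : nat, 2 / n.+1%:R <= e.
    exists (Num.truncn (2 / e)); rewrite ler_pdivrMr ?ltr0n // mulrC -ler_pdivrMr //.
    exact: ltW (truncnS_gt _).
  exists (fun x => (iter n.+1 (fun p => p + (s x ^+ 2 - p ^+ 2) / 2) 0)%:C); first exact: (qp _).1.
  move=> x; rewrite -rmorphB cmod_real.
  have /andP[h1 h2] := abs_iteration (s1 x) n.
  by rewrite ger0_norm // (le_trans h2).
have := QrZ (`|B| + 1) qa.
rewrite (_ : (fun x => _) = (fun x => `|r x|)) //; apply/funext => x.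
by rewrite /s normrM normfV (gtr0_norm B0) mulVKf // gt_eqF.
Qed.

Let Qr_max r s : Qr r -> Qr s -> Qr (fun x => Num.max (r x) (s x)).
Proof.
move=> qr qs; have := QrZ 2^-1 (QrD (QrD qr qs) (Qr_abs (QrD qr (QrZ (-1) qs)))).
rewrite (_ : (fun x => _) = (fun x => Num.max (r x) (s x))) //; apply/funext => x.
rewrite mulN1r; case: leP => h.
  by rewrite ler0_norm ?subr_le0 //; field.
by rewrite gtr0_norm ?subr_gt0 //; field.
Qed.

Let Qr_min r s : Qr r -> Qr s -> Qr (fun x => Num.min (r x) (s x)).
Proof.
move=> qr qs; have := QrZ (-1) (Qr_max (QrZ (-1) qr) (QrZ (-1) qs)).
rewrite (_ : (fun x => _) = (fun x => Num.min (r x) (s x))) //; apply/funext => x.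
by rewrite !mulN1r oppr_max !opprK.
Qed.

(** The product of the two given poles; as a factor of the ramps below it supplies the decay at
    infinity. *)
Let w (x : R) : R := (1 + x ^+ 2)^-1.

Let w_gt0 x : 0 < w x.
Proof. by rewrite invr_gt0 ltr_wpDr ?sqr_ge0. Qed.

Let wE x : w x * (1 + x ^+ 2) = 1.
Proof. by rewrite mulVf // gt_eqF // ltr_wpDr ?sqr_ge0. Qed.

Let pole_p (x : R) : (x -i* 1)^-1 = (w x)%:C * (x +i* 1).
Proof.
have nz : (x -i* 1) != 0 by rewrite eq_complex /= oppr_eq0 oner_eq0 andbF.
apply: (mulIf nz); rewrite mulVf // -mulrA.
have -> : (x +i* 1) * (x -i* 1) = (1 + x ^+ 2)%:C.
  by apply: complexP; rewrite ?(ReM, ImM) /=; ring.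
by rewrite -rmorphM wE.
Qed.

Let pole_q (x : R) : (x +i* 1)^-1 = (w x)%:C * (x -i* 1).
Proof.
have nz : (x +i* 1) != 0 by rewrite eq_complex /= oner_eq0 andbF.
apply: (mulIf nz); rewrite mulVf // -mulrA.
have -> : (x -i* 1) * (x +i* 1) = (1 + x ^+ 2)%:C.
  by apply: complexP; rewrite ?(ReM, ImM) /=; ring.
by rewrite -rmorphM wE.
Qed.

Let w_le1 x : w x <= 1.
Proof. by rewrite invf_le1 ?lerDl ?sqr_ge0 // ltr_wpDr ?sqr_ge0. Qed.

Let Qr_w : Qr w.
Proof.
split; last by exists 1 => x; rewrite gtr0_norm.
have := QM Qp Qq; rewrite (_ : (fun x => _) = (fun x => (w x)%:C)) //.
apply/funext => x; rewrite pole_q mulrCA mulVf ?mulr1 //.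
by rewrite eq_complex /= oppr_eq0 oner_eq0 andbF.
Qed.

Let Qr_xw : Qr (fun x => x * w x).
Proof.
split; last first.
  exists 1 => x; rewrite normrM (gtr0_norm (w_gt0 x)).
  have := wE x; have := w_gt0 x; have := sqr_ge0 (`|x| - 1).
  have -> : x ^+ 2 = `|x| ^+ 2 by rewrite real_normK ?num_real.
  have := normr_ge0 x; move: (`|x|) (w x) => t v; nra.
have := QM (Qc (2^-1)%:C) (QD Qp Qq); rewrite (_ : (fun x => _) = (fun x => (x * w x)%:C)) //.
apply/funext => x; rewrite pole_p pole_q.
by apply: complexP; rewrite !(ReM, ImM, ReD, ImD) /=; field.
Qed.

(** A ramp alone has different limits at the two infinities. Since w > 0 can be moved inside max and
    min, w times a ramp is a lattice expression in constants, w and x w. *)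
Let ramp (d a x : R) : R := Num.max 0 (Num.min 1 ((x - a) / d)).

Let Qr_ramp d a : 0 < d -> Qr (fun x => w x * ramp d a x).
Proof.
move=> d0.
have := Qr_max (Qr_cst 0) (Qr_min Qr_w (QrZ d^-1 (QrD Qr_xw (QrZ (- a) Qr_w)))).
rewrite (_ : (fun x => _) = (fun x => w x * ramp d a x)) //; apply/funext => x.
rewrite /ramp maxr_pMr ?(ltW (w_gt0 x)) // minr_pMr ?(ltW (w_gt0 x)) // mulr0 mulr1.
by congr (Num.max _ (Num.min _ _)); ring.
Qed.

Let ramp01 d a x : 0 <= ramp d a x <= 1.
Proof. by rewrite /ramp le_max lexx /= ge_max ler01 ge_min lexx. Qed.

Let ramp1 d a x : 0 < d -> a + d <= x -> ramp d a x = 1.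
Proof.
move=> d0 h; rewrite /ramp min_l ?max_r //.
by rewrite ler_pdivlMr // mul1r; lra.
Qed.

Let ramp0 d a x : 0 < d -> x <= a -> ramp d a x = 0.
Proof.
move=> d0 h; rewrite /ramp max_l // ge_min; apply/orP; right.
by rewrite pmulr_lle0 ?invr_gt0 // subr_le0.
Qed.

Let ramp_le d a b x : 0 < d -> a <= b -> ramp d b x <= ramp d a x.
Proof.
move=> d0 ab; rewrite /ramp ge_max le_max lexx /= le_max; apply/orP; right.
rewrite le_min ge_min lexx /= ge_min; apply/orP; right.
by rewrite ler_pM2r ?invr_gt0 // lerD2l lerN2.
Qed.

Lemma cmod_sum n (F : nat -> R[i]) : cmod (\sum_(k < n) F k) <= \sum_(k < n) cmod (F k).
Proof.
elim: n => [|n IH]; first by rewrite !big_ord0 cmod0.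
by rewrite !big_ord_recr /=; apply: le_trans (cmodD _ _) _; rewrite lerD2r.
Qed.

Lemma cdiff_ccont (g : R[i] -> R[i]) (t : R) D : cdiff g t%:C D -> ccont (fun s => g s%:C) t.
Proof.
move=> h e e0; have [r r0 hr] := cdiff_cont h e0; exists r => // s hs.
by apply: hr; rewrite -rmorphB cmod_real.
Qed.

Lemma ccontM (f g : R -> R[i]) t : ccont f t -> ccont g t -> ccont (fun s => f s * g s) t.
Proof.
move=> hf hg e e0; pose D := cmod (f t) + cmod (g t) + 1.
have D0 : 0 < D by rewrite /D ltr_wpDl // addr_ge0 ?cmod_ge0.
pose m := Num.min 1 (e / (2 * D)).
have m0 : 0 < m by rewrite lt_min ltr01 divr_gt0 // mulr_gt0.
have [r r0 hr] := hf m m0; have [s s0 hs] := hg m m0.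
exists (Num.min r s); first by rewrite lt_min r0.
move=> x; rewrite lt_min => /andP[xr xs].
have k1 := hr x xr; have k2 := hs x xs.
have -> : f x * g x - f t * g t = (f x - f t) * (g x - g t) + (f x - f t) * g t + f t * (g x - g t) by ring.
apply: le_trans (cmodD _ _) _; apply: le_trans (lerD (cmodD _ _) (lexx _)) _; rewrite !cmodM.
have m1 : m <= 1 by rewrite ge_min lexx.
have mD : m * (2 * D) <= e by rewrite -ler_pdivlMr ?mulr_gt0 // ge_min lexx orbT.
move: k1 k2 mD; rewrite /D.
have := cmod_ge0 (f x - f t); have := cmod_ge0 (g x - g t); have := cmod_ge0 (f t); have := cmod_ge0 (g t).
move: (cmod (f x - f t)) (cmod (g x - g t)) (cmod (f t)) (cmod (g t)) => a b c d d0 c0 b0 a0 k1 k2 mD.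
have j1 : a * b <= m * 1 by apply: ler_pM => //; exact: le_trans k2 m1.
have j2 : a * d <= m * d by apply: ler_pM.
have j3 : c * b <= c * m by apply: ler_pM.
have : m * (2 * (c + d + 1)) = 2 * (m * c) + 2 * (m * d) + 2 * m by ring.
have := mulr_ge0 (ltW m0) c0; have := mulr_ge0 (ltW m0) d0; lra.
Qed.

(** With l the common limit, f - l = w q for a continuous q. Replacing q by its values at nodes c k,
    against the hats w (tau k), leaves two errors: f - l where the hats fail to sum to 1, which
    happens only far out, and the oscillation of q over one step, damped by w <= 1. *)
Theorem Cdot_closure (f : R -> R[i]) : Cdot f -> Q f.
Proof.
move=> [cf [l [lp lm]]].
have ccf t : ccont f t.
  move=> e e0; have e1 : 0 < e%:C :> R[i] by rewrite -(rmorph0 (real_complex R)) ltcR.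
  have /cvgrPdist_le /(_ _ e1) [r /= r0 hr] := cf t.
  exists r => // s st; have := hr s; rewrite /ball_ /= distrC => /(_ st).
  by rewrite normcE_cmod lecr cmodC.
pose f0 x := f x + - l.
have far (e : R) : 0 < e -> exists N : nat, forall x, N%:R <= `|x| -> cmod (f0 x) <= e.
  move=> e0; have e1 : 0 < e%:C :> R[i] by rewrite -(rmorph0 (real_complex R)) ltcR.
  have /cvgrPdist_le /(_ _ e1) [M [_ hM]] := lp.
  have /cvgrPdist_le /(_ _ e1) [M' [_ hM']] := lm.
  exists (Num.truncn (`|M| + `|M'|)).+1 => x hx.
  have {}hx : `|M| + `|M'| < `|x| by apply: lt_le_trans (truncnS_gt _) hx.
  have m1 := ler_norm M; have m2 := ler_norm (- M'); rewrite normrN in m2.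
  have m3 := normr_ge0 M; have m4 := normr_ge0 M'.
  case: (ltP 0 x) => x0.
    have := hM x; rewrite /= normcE_cmod lecr cmodC; apply.
    by move: hx; rewrite (gtr0_norm x0); lra.
  have := hM' x; rewrite /= normcE_cmod lecr cmodC; apply.
  by move: hx; rewrite (ler0_norm x0); lra.
pose q x := (1 + x%:C * x%:C) * f0 x.
have wq x : (w x)%:C * q x = f0 x.
  rewrite /q mulrA (_ : _ * (1 + _) = 1) ?mul1r //.
  by rewrite -rmorphM -(rmorph1 (real_complex R)) -rmorphD -rmorphM -expr2 wE.
have cq t : ccont q t.
  apply: ccontM.
    have := cdiffD (cdiff_cst 1 t%:C) (cdiffM (cdiff_id t%:C) (cdiff_id t%:C)).
    exact: cdiff_ccont.
  move=> e e0; have [r r0 hr] := ccf t e e0; exists r => // s /hr.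
  by rewrite /f0 opprD addrACA subrr addr0.
suff q0 : Q f0.
  have := QD q0 (Qc l); rewrite (_ : (fun x => _) = f) //.
  by apply/funext => x; rewrite /f0 subrK.
apply: Qlim.
  apply: ccont_measurable => t e e0; have [r r0 hr] := ccf t e e0; exists r => // s /hr.
  by rewrite /f0 opprD addrACA subrr addr0.
move=> e e0; have e2 : 0 < e / 2 by rewrite divr_gt0.
have [N hN] := far _ e2.
have [r r0 hr] := ccont_unif (- (N%:R + 1)) (N%:R + 1) cq e2.
pose m := (Num.truncn r^-1).+1; pose d : R := m%:R^-1.
have m0 : 0 < m%:R :> R by rewrite ltr0n.
have d0 : 0 < d by rewrite invr_gt0.
have d1 : d <= 1 by rewrite invf_le1 // ler1n.
have dr : d < r by rewrite -[r]invrK ltf_pV2 ?posrE ?invr_gt0 //; exact: truncnS_gt.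
pose n := (2 * N * m)%N.
have nd : n%:R * d = 2 * N%:R by rewrite /n !natrM mulfK // gt_eqF.
(* The breakpoints run with step d from A 0 = - N - d to A (n + 1) = N: the first ramp has reached 1
   at - N and the last one starts at N, so the differences [tau k] sum to 1 on [- N, N]. *)
pose A (k : nat) : R := - N%:R + (k%:R - 1) * d.
pose rho k x := ramp d (A k) x.
pose tau k x := rho k x - rho k.+1 x.
have AS k : A k.+1 = A k + d by rewrite /A -[k.+1%:R]natr1; ring.
have An : A n.+1 = N%:R by rewrite /A -[n.+1%:R]natr1 addrK nd; ring.
have A0 : A 0%N = - N%:R - d by rewrite /A sub0r mulN1r.
have tau0 k x : 0 <= tau k x by rewrite subr_ge0; apply: ramp_le => //; rewrite AS lerDl ltW.
have sumtau x : \sum_(k < n.+1) tau k x = rho 0%N x - rho n.+1 x.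
  elim: n.+1 => [|j IH]; first by rewrite big_ord0 subrr.
  by rewrite big_ord_recr /= IH /tau addrA subrK.
pose c k : R := A k + d.
have supp k x : tau k x != 0 -> `|x - c k| < d.
  move=> tn; rewrite ltr_norml; apply/andP; split; rewrite ltNge; apply: contra tn => h.
    have h1 : x <= A k by rewrite /c in h; lra.
    by rewrite /tau /rho (ramp0 d0 h1) (@ramp0 d) ?subrr // AS; lra.
  have h1 : A k + d + d <= x by rewrite /c in h; lra.
  by rewrite /tau /rho !(@ramp1 d) ?subrr // ?AS //; lra.
exists (fun x => \sum_(k < n.+1) q (c k) * (w x * tau k x)%:C).
  have qt k : Q (fun x => q (c k) * (w x * tau k x)%:C).
    apply: QM; first exact: Qc.
    have [h _] := QrD (Qr_ramp (A k) d0) (QrZ (-1) (Qr_ramp (A k.+1) d0)).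
    move: h; rewrite (_ : (fun x => _) = (fun x => (w x * tau k x)%:C)) //.
    by apply/funext => x; congr (_%:C); rewrite mulN1r -mulrBr.
  elim: n.+1 => [|j IH].
    by rewrite (_ : (fun x => _) = (fun=> 0)); [exact: Qc|apply/funext => x; rewrite big_ord0].
  have := QD IH (qt j); rewrite (_ : (fun x => _ + _) = (fun x => \sum_(k < j.+1) q (c k) * (w x * tau k x)%:C)) //.
  by apply/funext => x; rewrite big_ord_recr.
move=> x.
have -> : f0 x - \sum_(k < n.+1) q (c k) * (w x * tau k x)%:C =
    f0 x * (1 - \sum_(k < n.+1) tau k x)%:C + (w x)%:C * \sum_(k < n.+1) (tau k x)%:C * (q x - q (c k)).
  rewrite -wq; move: (q x) => y; elim: n.+1 => [|j IH].
    by rewrite !big_ord0 !subr0 (rmorph1 (real_complex R)) mulr1 mulr0 addr0.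
  rewrite !big_ord_recr /= opprD addrA IH.
  have gen (W t u : R) (z S v : R[i]) : W%:C * z * (1 - u)%:C + W%:C * S - v * (W * t)%:C =
      W%:C * z * (1 - (u + t))%:C + W%:C * (S + t%:C * (z - v)).
    by case: z S v => [z1 z2] [s1 s2] [v1 v2]; apply: complexP => /=; ring.
  exact: gen.
apply: le_trans (cmodD _ _) _; rewrite [leRHS]splitr; apply: lerD.
  rewrite sumtau cmodM cmod_real.
  have /andP[a0 a1] : 0 <= rho 0%N x <= 1 by exact: ramp01.
  have /andP[b0 b1] : 0 <= rho n.+1 x <= 1 by exact: ramp01.
  have ab : rho n.+1 x <= rho 0%N x.
    by apply: ramp_le => //; rewrite An A0; have := ler0n R N; lra.
  have [xN|xN] := leP N%:R `|x|.
    rewrite -[leRHS]mulr1; apply: ler_pM; rewrite ?cmod_ge0 ?hN //.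
    by rewrite ger0_norm; lra.
  move: xN; rewrite ltr_norml => /andP[x1 x2].
  have r1 : rho 0%N x = 1 by apply: ramp1 => //; rewrite A0; lra.
  have r2 : rho n.+1 x = 0 by apply: ramp0 => //; rewrite An; lra.
  by rewrite r1 r2 subr0 subrr normr0 mulr0 ltW.
rewrite cmodM cmod_real gtr0_norm //.
apply: (@le_trans _ _ (1 * (e / 2 * \sum_(k < n.+1) tau k x))).
  apply: ler_pM; rewrite ?(ltW (w_gt0 x)) ?cmod_ge0 ?w_le1 //.
  apply: le_trans (cmod_sum _ (fun k => (tau k x)%:C * (q x - q (c k)))) _.
  rewrite mulr_sumr; apply: ler_sum => k _; rewrite cmodM cmod_real ger0_norm //.
  have [->|tn] := eqVneq (tau k x) 0; first by rewrite mul0r mulr0.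
  rewrite mulrC ler_wpM2r //; apply: hr; last exact: lt_trans (supp _ _ tn) dr.
  have kn : k%:R * d <= 2 * N%:R.
    by rewrite -nd ler_pM2r // ler_nat -ltnS.
  have kd : 0 <= k%:R * d by rewrite mulr_ge0 ?ler0n ?ltW.
  have -> : c k = - N%:R + k%:R * d by rewrite /c /A; ring.
  by have := ler0n R N; lra.
rewrite mul1r; apply: ler_piMr; first exact: ltW.
rewrite sumtau.
have /andP[a0 a1] : 0 <= rho 0%N x <= 1 by exact: ramp01.
have /andP[b0 b1] : 0 <= rho n.+1 x <= 1 by exact: ramp01.
lra.
Qed.

End uniform_closure.

(** * Fourier transforms of truncated exponentials *)

Section simple_pole.
Context (R : realType).
Local Notation mu := (@lebesgue_measure R).
Local Notation V := (L2 mu).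

Lemma cdiff_shift (f : R[i] -> R[i]) c z D : cdiff f (z + c) D -> cdiff (fun w => f (w + c)) z D.
Proof.
move=> h e e0; have [r r0 hr] := h e e0; exists r => // w wr.
have E : w - z = (w + c) - (z + c) by rewrite opprD addrACA subrr addr0.
by rewrite E; apply: hr; rewrite -E.
Qed.

Definition polef (x : R) : R[i] := (x -i* 1)^-1.

Definition polef_conj (x : R) : R[i] := (x +i* 1)^-1.

Lemma cmod_ge_Im (z : R[i]) : 1 <= `|complex.Im z| -> cmod z^-1 <= 1.
Proof.
move=> h; rewrite cmodV invf_le1; first exact: le_trans h (Im_le_cmod z).
by apply: lt_le_trans ltr01 _; exact: le_trans h (Im_le_cmod z).
Qed.

Let ebounded_shift (c : R[i]) : 1 <= `|complex.Im c| -> ebounded mu (fun x : R => (x%:C + c)^-1).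
Proof.
move=> h; split; last first.
  by exists 1; apply: aeW => x; apply: cmod_ge_Im; rewrite ImD /= add0r.
apply: ccont_measurable => t; have nz : t%:C + c != 0.
  apply: contraTneq h => e; have -> : complex.Im c = complex.Im (t%:C + c) by rewrite ImD /= add0r.
  by rewrite e /= normr0 -ltNge ltr01.
exact: cdiff_ccont (cdiff_shift (cdiffV nz)).
Qed.

Lemma ebounded_polef : ebounded mu polef.
Proof.
have := @ebounded_shift (0 -i* 1); rewrite /= normrN1 lexx => /(_ isT).
rewrite (_ : (fun x => _) = polef) //; apply/funext => x; rewrite /polef; congr (_^-1).
by apply: complexP; rewrite /= ?addr0 ?add0r.
Qed.

Lemma ebounded_polef_conj : ebounded mu polef_conj.
Proof.
have := @ebounded_shift (0 +i* 1); rewrite /= normr1 lexx => /(_ isT).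
rewrite (_ : (fun x => _) = polef_conj) //; apply/funext => x; rewrite /polef_conj; congr (_^-1).
by apply: complexP; rewrite /= ?addr0 ?add0r.
Qed.

(** The kernel of 1 / (x - i) is an exponential on the negative half-line; on [0, a] its convolution
    with [chif a] is a constant times 1 - e^(t - a), and [etrf] is the second term. *)
Definition etrf (a t : R) : R[i] := iv 0 a t * (expR (t - a))%:C.

Lemma ebounded_etrf a : ebounded mu (etrf a).
Proof.
split.
  apply: cmeasurableM; first exact: cmeasurable_iv.
  have m : measurable_fun setT (fun t : R => expR (t - a)).
    exact: (measurableT_comp (@measurable_expR R) (measurable_funB _ _)).
  exact: cmeasurable_real m.
exists 1; apply: aeW => x; rewrite /etrf cmodM cmod_iv cmod_real ger0_norm ?expR_ge0 //.
suff key (y : R) : (0 <= y <= a)%R%:R * expR (y - a) <= 1 :> R by exact: key.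
case: (boolP (0 <= y <= a)) => [/andP[_ ya]|_]; last by rewrite mul0r.
by rewrite mul1r -expR0 ler_expR subr_le0.
Qed.

Lemma iv_kern (a x t : R) (N : nat) : a <= N%:R ->
  iv 0 a t * (kern N x t)^* = iv 0 a t * expi (x * t).
Proof.
move=> aN; rewrite /kern conjM conj_expi opprK mulrA; congr (_ * _).
rewrite /iv conjc_real -rmorphM; congr (_%:C); have n0 := ler0n R N.
case: (leP 0 t) => [t0|]; last by rewrite mul0r.
case: (leP t a) => [ta|]; last by rewrite mul0r.
by rewrite mul1r (le_trans _ t0) ?oppr_le0 // (le_trans ta).
Qed.

Lemma sqi_etrf a : cLfun mu 2%:E (etrf a).
Proof.
(* Square integrability is inherited from the kernel at frequency 0, which equals 1 on [- N, N], an
   interval containing [0, a]. *)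
pose N := (Num.truncn a).+1.
have := sqi_mult (ebounded_etrf a) (sqi_kern N 0).
rewrite (_ : (fun x => _) = etrf a) //; apply/funext => t.
have e0 : (kern N 0 t)^* = kern N 0 t.
  by rewrite /kern mul0r oppr0 /expi cos0 sin0 conjM /iv conjc_real; congr (_ * _); rewrite -[1 +i* 0]/(1%:C) conjc_real.
rewrite /etrf mulrAC -e0 iv_kern ?(ltW (truncnS_gt _)) //.
by rewrite mul0r /expi cos0 sin0 -[1 +i* 0]/(1 : R[i]) mulr1.
Qed.

Definition etr a : V := L2_of mu (etrf a).

Definition etrh (a x : R) : R[i] := (expi (x * a) - (expR (- a))%:C) / (1 +i* x).

Lemma oneix_neq0 (x : R) : 1 +i* x != 0.
Proof. by rewrite eq_complex /= oner_eq0. Qed.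

Lemma ftf_etr (a : R) (N : nat) : 0 <= a -> a <= N%:R -> ftf N (etr a) = etrh a.
Proof.
move=> a0 aN; apply/funext => x; rewrite ftf_dot.
have [m _] := ebounded_etrf a.
rewrite (@dot_ae _ _ _ mu _ _ _ _ m (cmeasurable_kern N x) (L2_ofK (sqi_etrf a)) (L2_ofK (sqi_kern N x))).
have cE (t : R) : cexp ((1 +i* x) * t%:C) = (expR t)%:C * expi (x * t).
  by rewrite /cexp ReM ImM /= !mulr0 subr0 mul1r add0r.
have E (t : R) : etrf a t * (kern N x t)^* =
    (expR (- a))%:C * (iv 0 a t * cexp ((1 +i* x) * t%:C)).
  rewrite cE /etrf mulrAC iv_kern // addrC expRD rmorphM /=; ring.
rewrite (eq_cint mu E) cintZ; last exact: okI_cexp.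
rewrite -/(cI 0 a (fun t => cexp ((1 +i* x) * t%:C))) cI_cexp ?oneix_neq0 //.
rewrite /etrh mulrA; congr (_ / _).
rewrite !cE mulr0 expR0 /(expi 0) cos0 sin0 -[1 +i* 0]/(1 : R[i]) mul1r mulrBr mulr1; congr (_ - _).
by rewrite mulrA -rmorphM -expRD addNr expR0 mul1r.
Qed.

Lemma sqi_etrh a : 0 <= a -> cLfun mu 2%:E (etrh a).
Proof.
move=> a0; have := sqi_ftf (Num.truncn a).+1 (etr a).
by rewrite ftf_etr // ltW // truncnS_gt.
Qed.

Lemma fourier_etr a : 0 <= a -> fourier (etr a) = L2_of mu (etrh a) :> V.
Proof.
move=> a0; apply: tends_unique (fourier_tends _) _ => e e0.
exists (Num.truncn a).+1 => n hn.
have an : a <= n%:R by apply: le_trans (ltW (truncnS_gt _)) _; rewrite ler_nat.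
by rewrite /ft ftf_etr // subrr nrm0 ltW.
Qed.

(** The transform of e^t on the negative half-line. *)
Definition etaf (x : R) : R[i] := (1 +i* x)^-1.

Lemma sqi_etaf : cLfun mu 2%:E etaf.
Proof.
have E x : etaf x = (0 -i* 1) * polef x.
  have e1 : (0 -i* 1) * (0 +i* 1) = 1 :> R[i] by apply: complexP; rewrite ?ReM ?ImM /=; ring.
  have -> : (0 -i* 1) = (0 +i* 1)^-1 :> R[i].
    by apply: (mulIf (@ii_neq0 R)); rewrite e1 mulVf // ii_neq0.
  rewrite /polef /etaf -invfM; congr (_^-1).
  by apply: complexP; rewrite ?ReM ?ImM /=; ring.
apply/sqiP; split.
  rewrite (funext E); apply: cmeasurableM; first exact: cmeasurable_cst.
  by case: ebounded_polef.
have /integrableP[_] := @integrable_oneDsqrV R; apply: le_lt_trans.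
have key (x : R) : cmod (etaf x) ^+ 2 = `|(1 + x ^+ 2)^-1|.
  have p : 0 <= (1 + x ^+ 2)^-1 by rewrite invr_ge0 addr_ge0 ?sqr_ge0.
  by rewrite ger0_norm // /etaf cmodV exprVn cmod_sqr [complex.Re _]/= [complex.Im _]/= expr1n.
rewrite le_eqVlt; apply/orP; left; apply/eqP; apply: eq_integral => x _.
by rewrite key.
Qed.

(** Partial fractions for (e^(i x a) - 1) / (i x (x - i)). For a >= 0 the first two terms are
    transforms of functions on [0, a]; the last is a multiple of a function that does not depend on
    a. *)
Lemma pole_identity (a x : R) : x != 0 -> polef x * hatf a x =
  (0 +i* 1) * hatf a x + ((0 -i* 1) * etrh a x + (0 +i* 1) * (1 - (expR (- a))%:C) * etaf x).
Proof.
move=> x0; have X0 : x%:C != 0 :> R[i] by rewrite eq_complex /= negb_and x0.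
have xa : cexp ((0 +i* a) * x%:C) = expi (x * a).
  by rewrite -expi_cexp mulrC.
rewrite /hatf /chat xa /etrh /etaf /polef.
set ii : R[i] := 0 +i* 1; set E := expi _; set e := (expR _)%:C; set X := x%:C in X0 *.
have i2 : ii * - ii = 1 by apply: complexP; rewrite ?ReM ?ImM /=; ring.
have i0 : ii != 0 := @ii_neq0 R.
have iV : ii^-1 = - ii by apply: (mulfI i0); rewrite i2 mulfV.
have -> : 0 -i* 1 = - ii :> R[i] by apply: complexP; rewrite /= ?oppr0.
have e1 : 1 +i* x = ii * (X - ii) by apply: complexP; rewrite ?ReM ?ImM /=; ring.
have -> : x -i* 1 = X - ii by apply: complexP; rewrite /=; ring.
have w0 : X - ii != 0.
  by apply/eqP => /(congr1 (@complex.Im R)) /eqP; rewrite /= sub0r oppr_eq0 oner_eq0.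
rewrite e1 !invfM iV.
transitivity ((ii * - ii) * ((E - 1) / X) - (ii * - ii) * ((E - e) / (X - ii))
  + (ii * - ii) * ((1 - e) / (X - ii))).
  by rewrite i2 !mul1r; clearbody ii E e X; field; rewrite X0 w0.
by ring.
Qed.

End simple_pole.

(** * Toeplitz and Wiener-Hopf plus Hankel parametrices *)

Section toeplitz.
Context (R : realType) (V : normedModType R[i]).
Variables (P : V -> V) (I : (V -> V) -> Prop).
Hypotheses (cV : fast_complete V) (bP : bop P) (PP : forall u, P (P u) = P u).
Hypothesis nP : forall u, nrm (P u) <= nrm u.
Hypothesis oI : opideal I.

Lemma id_ext (S T : V -> V) : I T -> (forall u, S u = T u) -> I S.
Proof. by move=> iT /funext ->. Qed.

(** The operator 1 - P + a P A P differs from the identity by an operator of norm at most q, so a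
    Neumann series inverts it. Compressing the inverse by P and multiplying by a gives B. *)
Lemma toeplitz_inverse (A : V -> V) (a : R[i]) (q : R) : bop A -> 0 <= q -> q < 1 ->
  (forall u, nrm (u - a *: A u) <= q * nrm u) ->
  exists2 B, bop B & [/\ forall u, P (B u) = B u, forall u, B (P (A (P u))) = P u &
    forall u, P (A (B u)) = P u].
Proof.
move=> bA q0 q1 hq; pose E u := - P (P u - a *: A (P u)).
have bE : bop E.
  apply: bop_opp; apply: (bop_comp _ bP); apply: bop_sub => //; apply: bop_scale.
  exact: bop_comp bP bA.
have hE u : nrm (E u) <= q * nrm u.
  rewrite nrmN; apply: le_trans (nP _) _; apply: le_trans (hq _) _.
  by rewrite ler_wpM2l.
have [B0 b0 [h1 h2]] := neumann cV bE q1 hE.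
have DP u : P u + E (P u) = a *: P (A (P u)).
  by rewrite /E PP (bopB _ _ bP) PP (bopZ _ _ bP) opprB addrCA subrr addr0.
have PD u : P (u + E u) = a *: P (A (P u)).
  by rewrite (bopD _ _ bP) /E (bopN _ bP) PP (bopB _ _ bP) PP (bopZ _ _ bP) opprB addrCA subrr addr0.
exists (fun u => a *: P (B0 (P u))).
  by apply: bop_scale; apply: (bop_comp _ bP); exact: bop_comp bP b0.
split=> u.
- by rewrite (bopZ _ _ bP) PP.
- by rewrite PP -(bopZ _ _ bP) -(bopZ _ _ b0) -DP h2 PP.
- by rewrite (bopZ _ _ bA) (bopZ _ _ bP) -PD h1 PP.
Qed.

(** In the splitting by P and 1 - P, A is block triangular modulo I; [hankel_dn] is the opposite
    triangularity. Symbols in H^oo_+ and H^oo_- satisfy them for the zero ideal. *)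
Definition hankel_up A := I (fun u => A (P u) - P (A (P u))).

Definition hankel_dn A := I (fun u => P (A (u - P u))).

Definition toep_left A := exists S k,
  [/\ bop S, I k & forall u, S (P (A (P u))) = P u + k u].

Definition toep_right A := exists S k,
  [/\ bop S, I k, forall u, P (S u) = S u & forall u, P (A (S u)) = P u + k u].

(** Insert 1 = P + (1 - P) between A and B: in each term one of the two factors contributes its
    block in I. *)
Lemma hankel_up_comp A B : bop A -> bop B -> hankel_up A -> hankel_up B ->
  hankel_up (fun u => A (B u)).
Proof.
move=> bA bB hA hB.
have h1 := id_compr oI (bop_comp bP bB) hA.
have h2 := id_compl oI (bop_sub bA (bop_comp bA bP)) hB.
apply: id_ext (id_add oI h1 h2) _ => u.
set w := B (P u); set z := w - P w.
have -> : A w = A (P w) + A z by rewrite -(bopD _ _ bA) /z addrC subrK.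
by rewrite (bopD _ _ bP) opprD addrACA.
Qed.

Lemma hankel_up_add A B : bop A -> bop B -> hankel_up A -> hankel_up B ->
  hankel_up (fun u => A u + B u).
Proof.
move=> bA bB hA hB; apply: id_ext (id_add oI hA hB) _ => u.
by rewrite (bopD _ _ bP) opprD addrACA.
Qed.

Lemma hankel_dn_comp A B : bop A -> bop B -> hankel_dn A -> hankel_dn B ->
  hankel_dn (fun u => A (B u)).
Proof.
move=> bA bB hA hB.
have bQ : bop (fun u : V => u - P u) by apply: bop_sub => //; exact: bop_id.
have h1 := id_compr oI (bop_comp bQ bB) hA.
have h2 := id_compl oI (bop_comp bA bP) hB.
apply: id_ext (id_add oI h1 h2) _ => u.
by set w := B _; rewrite -(bopD _ _ bP) -(bopD _ _ bA) subrK.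
Qed.

Section parametrices.
Variables (Ms Mh Mg B : V -> V).
Hypotheses (bs : bop Ms) (bh : bop Mh) (bg : bop Mg) (bB : bop B).
Hypotheses (gh : forall u, Mg (Mh u) = u) (hg : forall u, Mh (Mg u) = u).
Hypotheses (PB : forall u, P (B u) = B u) (Bs : forall u, B (P (Ms (P u))) = P u).
Hypothesis sB : forall u, P (Ms (B u)) = P u.

(** The range of P is invariant under Mh modulo I, so P Ms Mh P factors as (P Ms P) (P Mh P); B
    undoes the first factor and P Mg the second. *)
Lemma toeplitz_up_left : hankel_up Mh -> toep_left (fun u => Ms (Mh u)).
Proof.
move=> hX; set X := (fun u => Mh (P u) - P (Mh (P u))) in hX.
have bX := id_bop oI hX.
have bgP := bop_comp bg bP.
exists (fun u => P (Mg (B u))), (fun u => P (Mg (B (P (Ms (X u))))) - P (Mg (X u))); split.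
- exact: bop_comp bB bgP.
- apply: (id_add oI); last by apply: (id_opp oI); exact: (id_compl oI bgP hX).
  exact: (id_compl oI (bop_comp (bop_comp (bop_comp bs bP) bB) bgP) hX).
- move=> u; have e1 : Mh (P u) = P (Mh (P u)) + X u by rewrite /X addrC subrK.
  have e2 : P (Mh (P u)) = Mh (P u) - X u by rewrite /X opprB addrC subrK.
  rewrite {1}e1 (bopD _ _ bs) (bopD _ _ bP) (bopD _ _ bB) (bopD _ _ bg) (bopD _ _ bP) Bs.
  by rewrite e2 (bopB _ _ bg) gh (bopB _ _ bP) PP addrAC addrA.
Qed.

(** Here Mg leaves the range of P invariant modulo I, so Mh P Mg B equals Mh Mg B = B up to I, and
    Ms then meets its right inverse. *)
Lemma toeplitz_up_right : hankel_up Mg -> toep_right (fun u => Ms (Mh u)).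
Proof.
move=> hX; set X := (fun u => Mg (P u) - P (Mg (P u))) in hX.
have bX := id_bop oI hX.
exists (fun u => P (Mg (B u))), (fun u => - P (Ms (Mh (X (B u))))); split.
- exact: bop_comp bB (bop_comp bg bP).
- apply: (id_opp oI).
  exact: (id_compl oI (bop_comp (bop_comp bh bs) bP) (id_compr oI bB hX)).
- by move=> u; rewrite PP.
- move=> u; have -> : P (Mg (B u)) = Mg (B u) - X (B u) by rewrite /X PB opprB addrC subrK.
  by rewrite (bopB _ _ bh) hg (bopB _ _ bs) (bopB _ _ bP) sB.
Qed.

(** With the opposite triangularity P Mh = P Mh P modulo I, so the factors appear in the order (P Mh
    P) (P Ms P); B is the right inverse of the second and P Mg P that of the first. *)
Lemma toeplitz_dn_right : hankel_dn Mh -> toep_right (fun u => Mh (Ms u)).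
Proof.
move=> hY; set Y := (fun u => P (Mh (u - P u))) in hY.
pose S u := B (P (Mg (P u))).
have bS : bop S by exact: bop_comp (bop_comp (bop_comp bP bg) bP) bB.
exists S, (fun u => Y (Ms (S u)) - Y (Mg (P u))); split => //.
- apply: (id_add oI); first exact: (id_compr oI (bop_comp bS bs) hY).
  by apply: (id_opp oI); exact: (id_compr oI (bop_comp bP bg) hY).
- by move=> u; rewrite PB.
- have YE z : P (Mh z) = P (Mh (P z)) + Y z.
    by rewrite /Y -(bopD _ _ bP) -(bopD _ _ bh) addrC subrK.
  move=> u; rewrite YE sB PP.
  have -> : P (Mh (P (Mg (P u)))) = P u - Y (Mg (P u)).
    apply/eqP; rewrite eq_sym subr_eq; apply/eqP.
    by have := YE (Mg (P u)); rewrite hg PP.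
  by rewrite -addrA; congr (_ + _); rewrite addrC.
Qed.

Lemma toeplitz_dn_left : hankel_dn Mg -> toep_left (fun u => Mh (Ms u)).
Proof.
move=> hY; set Y := (fun u => P (Mg (u - P u))) in hY.
exists (fun u => B (P (Mg (P u)))), (fun u => - B (Y (Mh (Ms (P u))))); split.
- exact: bop_comp (bop_comp (bop_comp bP bg) bP) bB.
- apply: (id_opp oI).
  exact: (id_compl oI bB (id_compr oI (bop_comp (bop_comp bP bs) bh) hY)).
- move=> u; rewrite PP; set w := Mh (Ms (P u)).
  have -> : P (Mg (P w)) = P (Ms (P u)) - Y w.
    rewrite /Y -[Ms (P u)]gh -/w -(bopB _ _ bP) -(bopB _ _ bg); congr (P (Mg _)).
    by rewrite opprB addrC subrK.
  by rewrite (bopB _ _ bB) Bs.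
Qed.

End parametrices.

Variable J : V -> V.
Hypotheses (bJ : bop J) (JJ : forall u, J (J u) = u).
Hypothesis JPJ : forall u, J (P (J u)) = u - P u.

Let PJ0 u : P u = u -> P (J u) = 0.
Proof.
move=> Pu; have := JPJ (J u); rewrite JJ Pu => /eqP.
by rewrite -subr_eq0 opprB addrC subrK => /eqP.
Qed.

(** [J] exchanges P and 1 - P, hence carries the block (1 - P) A' P to P A (1 - P). *)
Lemma hankel_reflect A A' : (forall u, J (A u) = A' (J u)) -> hankel_up A' -> hankel_dn A.
Proof.
move=> AJ h; apply: id_ext (id_compl oI bJ (id_compr oI bJ h)) _ => u.
rewrite (bopB _ _ bJ); have e : A' (P (J u)) = J (A (u - P u)) by rewrite AJ -JPJ JJ.
by rewrite e; set w := A _; rewrite JJ JPJ opprB addrC subrK.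
Qed.

Section plus_hankel.
Variables (Mf Mv A : V -> V).
Hypotheses (bf : bop Mf) (bv : bop Mv) (bA : bop A).
Hypotheses (vf : forall u, Mv (Mf u) = u) (fv : forall u, Mf (Mv u) = u).
Hypothesis AJf : forall u, A (J (Mf u)) = Mf (J u).

(** Put f = Mf (u + J u), so that A J f = f. From y = P f alone one computes P (y - A J y) = P A J
    (1 - P) f = P A P (J f). Then S returns P (J f), whose reflection is the missing part (1 - P) f,
    and P Mv f = P (u + J u) = u. *)
Lemma wh_left : toep_left A -> exists L k,
  [/\ bop L, I k & forall u, P u = u -> L (P (Mf (u + J u))) = u + k u].
Proof.
move=> [S [k [bS ik hS]]].
have bvP := bop_comp bv bP.
have bI : bop (fun u : V => u) by exact: bop_id.
exists (fun y => P (Mv (y + J (S (P (y - A (J y))))))),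
  (fun u => P (Mv (J (k (J (Mf (u + J u))))))); split.
- apply: (bop_comp _ bvP); apply: bop_add => //; apply: (bop_comp _ bJ); apply: (bop_comp _ bS).
  by apply: (bop_comp _ bP); apply: bop_sub => //; exact: bop_comp bJ bA.
- have b1 : bop (fun u => J (Mf (u + J u))).
    by apply: (bop_comp _ bJ); apply: (bop_comp _ bf); exact: bop_add.
  exact: (id_compl oI (bop_comp bJ bvP) (id_compr oI b1 ik)).
- move=> u Pu; set f := Mf (u + J u).
  have Af : A (J f) = f by rewrite AJf (bopD _ _ bJ) JJ addrC.
  have e : P (P f - A (J (P f))) = P (A (P (J f))).
    have -> : P (J f) = J f - J (P f) by rewrite -[P (J f)]JJ JPJ (bopB _ _ bJ).
    by rewrite (bopB _ _ bA) Af !(bopB _ _ bP) PP.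
  rewrite e hS (bopD _ _ bJ) JPJ addrA [P f + _]addrC subrK.
  rewrite (bopD _ _ bv) (bopD _ _ bP) vf (bopD _ _ bP) Pu PJ0 // addr0.
  by [].
Qed.

(** The vector f1 completes y so that P f1 = y and P A J f1 = y up to I. Its preimage Mv f1 is then
    symmetrized to e with J e = e, hence e = P e + J P e. As Mf J Mv f1 = A J f1, Mf e is the mean
    of f1 and A J f1, and both compress to y up to I. *)
Lemma wh_right : toep_right A -> exists L k,
  [/\ bop L, I k, forall y, P (L y) = L y &
    forall y, P y = y -> P (Mf (L y + J (L y))) = y + k y].
Proof.
move=> [S [k [bS ik PS hS]]].
have bI : bop (fun u : V => u) by exact: bop_id.
have b1 : bop (fun y => P (y - A (J y))).
  by apply: (bop_comp _ bP); apply: bop_sub => //; exact: bop_comp bJ bA.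
pose f1 y := y + J (S (P (y - A (J y)))).
have bf1 : bop f1 by apply: bop_add => //; exact: bop_comp (bop_comp b1 bS) bJ.
pose e y := 2^-1 *: (J (Mv (f1 y)) + Mv (f1 y)).
have be : bop e.
  have b2 := bop_comp bf1 bv.
  by apply: bop_scale; apply: bop_add => //; exact: bop_comp b2 bJ.
exists (fun y => P (e y)), (fun y => 2^-1 *: k (P (y - A (J y)))); split.
- exact: bop_comp be bP.
- exact: (id_compl oI (bop_scale 2^-1 bI) (id_compr oI b1 ik)).
- by move=> y; rewrite PP.
- move=> y Py.
  have Je : J (e y) = e y by rewrite /e (bopZ _ _ bJ) (bopD _ _ bJ) JJ addrC.
  have -> : P (e y) + J (P (e y)) = e y by rewrite -{2}Je JPJ addrC subrK.
  rewrite /e (bopZ _ _ bf) (bopD _ _ bf) fv -AJf fv (bopZ _ _ bP) (bopD _ _ bP).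
  have -> : P (f1 y) = y by rewrite /f1 (bopD _ _ bP) PJ0 ?PS // addr0.
  have -> : P (A (J (f1 y))) = y + k (P (y - A (J y))).
    rewrite /f1 (bopD _ _ bJ) JJ (bopD _ _ bA) (bopD _ _ bP) hS PP (bopB _ _ bP) Py.
    by rewrite addrA addrCA subrr addr0.
  have half (v : V) : 2^-1 *: (v + v) = v.
    by rewrite scalerDr -scalerDl (_ : 2^-1 + 2^-1 = 1) ?scale1r //; field.
  by rewrite addrAC scalerDr half.
Qed.

End plus_hankel.
End toeplitz.

(** * Fourier multipliers *)

Section multipliers.
Context (R : realType).
Local Notation mu := (@lebesgue_measure R).
Local Notation V := (L2 mu).
Let ip := L2_inner mu.
Local Notation MR := (@Mult _ _ R mu).
(** The Fourier transform, its inverse and the reflection enter through the properties listed here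
    and not through their definitions by limit and choice; the actual operators are supplied at the
    end. *)
Variables (F Fi J : V -> V).
Hypotheses (bF : bop F) (bFi : bop Fi) (bJ : bop J).
Hypotheses (FiF : forall u, Fi (F u) = u) (FFi : forall u, F (Fi u) = u).
Hypothesis FJ : forall u, F (J u) = J (F u).
Hypothesis JE : forall u, {ae mu, forall x : R, L2_repr (J u) x = L2_repr u (- x)}.
Hypothesis dotF : forall u v, dot (F u) (F v) = (kap R)%:C * dot u v.
Hypothesis nrmF : forall u, nrm (F u) = Num.sqrt (kap R) * nrm u.
Hypothesis F_chi : forall a, F (chi a) = hat a.
Local Opaque Mult.

Lemma fourier_inj u v : F u = F v -> u = v.
Proof. by move=> e; rewrite -[u]FiF e FiF. Qed.

Definition fmult (p : R -> R[i]) (u : V) : V := Fi (MR p (F u)).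
Local Notation M := fmult.

Lemma fourier_fmult p u : F (M p u) = MR p (F u).
Proof. exact: FFi. Qed.

Lemma bop_fmult p : ebounded mu p -> bop (M p).
Proof.
by move=> bp; exact: bop_comp (bop_comp bF (bop_Mult bp)) bFi.
Qed.

Lemma fmult_comp p q u : ebounded mu p -> ebounded mu q -> M p (M q u) = M (fun x => p x * q x) u.
Proof. by move=> bp bq; apply: fourier_inj; rewrite !fourier_fmult Mult_comp. Qed.

Lemma fmult_add p q u : ebounded mu p -> ebounded mu q -> M (fun x => p x + q x) u = M p u + M q u.
Proof.
move=> bp bq; apply: fourier_inj.
by rewrite (bopD _ _ bF) !fourier_fmult MultD.
Qed.

Lemma fmult_cst c u : M (fun=> c) u = c *: u.
Proof.
by apply: fourier_inj; rewrite (bopZ _ _ bF) fourier_fmult Mult_cst.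
Qed.

Lemma fmult_ae p q u : ebounded mu p -> ebounded mu q -> eq_ae p q -> M p u = M q u.
Proof. by move=> bp bq h; apply: fourier_inj; rewrite !fourier_fmult; exact: Mult_ae. Qed.

Lemma ebounded_oppr (p : R -> R[i]) : ebounded mu p -> ebounded mu (fun x : R => p (- x)).
Proof.
move=> [mp [C hC]]; split; first exact: cmeasurable_oppr.
by exists C; exact: (ae_oppr hC).
Qed.

Lemma reflection_fmult p u : ebounded mu p -> J (M p u) = M (fun x : R => p (- x)) (J u).
Proof.
move=> bp; apply: fourier_inj; rewrite FJ !fourier_fmult FJ.
have bp' := ebounded_oppr bp.
apply: L2_ext.
have h1 := ae_and (JE (MR p (F u))) (ae_oppr (MultE (F u) bp)).
have h2 := ae_and (MultE (J (F u)) bp') (JE (F u)).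
by apply: aeS (ae_and h1 h2) => x [[-> ->] [-> ->]].
Qed.

Lemma nrm_fmult p u (C : R) : cmeasurable p -> 0 <= C -> {ae mu, forall x, cmod (p x) <= C} ->
  nrm (M p u) <= C * nrm u.
Proof.
move=> mp C0 hC; have k0 : 0 < Num.sqrt (kap R) by rewrite sqrtr_gt0 kap_gt0.
rewrite -(ler_pM2l k0) -nrmF fourier_fmult; apply: le_trans (nrm_Mult _ mp C0 hC) _.
by rewrite nrmF mulrCA.
Qed.

Lemma dot_fmult p u v : dot (M p u) v = ((kap R)^-1)%:C * dot (MR p (F u)) (F v).
Proof.
rewrite -fourier_fmult dotF mulrA -rmorphM mulVf ?mul1r //.
by rewrite gt_eqF // kap_gt0.
Qed.

Definition posf (x : R) : R[i] := ((0 < x)%R%:R)%:C.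

Lemma ebounded_posf : ebounded mu posf.
Proof.
split; last first.
  by exists 1; apply: aeW => x; rewrite /posf cmod_real; case: (0 < x); rewrite ?normr1 ?normr0.
apply: cmeasurable_real.
have := @measurable_indic _ _ R setT _ (@measurable_itv R `]0, +oo[).
apply: eq_measurable_fun => x _ /=; rewrite indicE; congr (_%:R).
by rewrite mem_setE in_itv /= andbT.
Qed.

Definition half_proj (u : V) : V := MR posf u.
Local Notation P := half_proj.

Lemma half_projE u : {ae mu, forall x : R, L2_repr (P u) x = posf x * L2_repr u x}.
Proof. exact: MultE ebounded_posf. Qed.

Lemma bop_half_proj : bop P.
Proof. exact: bop_Mult ebounded_posf. Qed.

Lemma half_projK u : P (P u) = P u.
Proof.
rewrite /half_proj (Mult_comp u ebounded_posf ebounded_posf); congr (MR _ u); apply/funext => x.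
by rewrite /posf -rmorphM -natrM mulnb andbb.
Qed.

Lemma nrm_half_proj u : nrm (P u) <= nrm u.
Proof.
have [mp _] := ebounded_posf; rewrite -[leRHS]mul1r; apply: nrm_Mult => //.
by apply: aeW => x; rewrite /posf cmod_real; case: (0 < x); rewrite ?normr1 ?normr0.
Qed.

Lemma reflection_half_proj u : J (P (J u)) = u - P u.
Proof.
apply/eqP; rewrite eq_sym subr_eq; apply/eqP; apply: L2_ext.
have h1 := ae_and (JE (P (J u))) (ae_oppr (ae_and (half_projE (J u)) (JE u))).
apply: aeS (ae_and (ae_and (L2_addE (J (P (J u))) (P u)) h1) (ae_and (half_projE u) (ae_neq 0))).
move=> x [[-> [-> [-> ->]]] [-> x0]].
suff key (y : R) z : y <> 0 -> z = posf (- y) * z + posf y * z :> R[i].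
  by rewrite opprK; exact: key.
move=> y0; rewrite /posf oppr_gt0; case: ltgtP => // _; rewrite ?mul0r ?mul1r ?addr0 ?add0r //.
all: by rewrite -[_%:C]/(0 : R[i]) ?mul0r ?add0r ?addr0 -?[_%:C]/(1 : R[i]) ?mul1r.
Qed.

Lemma half_proj_chi_ge0 a : 0 <= a -> P (chi a) = chi a.
Proof.
move=> a0; apply: L2_ext; apply: aeS (ae_and (half_projE (chi a)) (chiE a)) => x [-> ->].
suff key (y : R) : posf y * (chif a y)%:C = (chif a y)%:C by exact: key.
rewrite /posf -rmorphM; congr (_%:C); rewrite /chif; case: ltP => y0; rewrite /= ?mul1r // mul0r.
by rewrite sub0r (_ : a < y = false) ?oppr0 //; apply/negbTE; rewrite -leNgt (le_trans y0).
Qed.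

Lemma half_proj_chi_le0 a : a <= 0 -> P (chi a) = 0.
Proof.
move=> a0; apply: L2_ext.
apply: aeS (ae_and (ae_and (half_projE (chi a)) (chiE a)) (@L2_zeroE _ _ _ mu)) => x [[-> ->] ->].
suff key (y : R) : posf y * (chif a y)%:C = 0 by exact: key.
rewrite /posf -rmorphM /chif; case: (ltP 0 y) => y0; rewrite ?mul0r // mul1r andbF subr0.
by rewrite (_ : y <= a = false) //; apply/negbTE; rewrite -ltNge (le_lt_trans a0).
Qed.

Lemma dot_half_proj u v : dot (P u) v = dot u (P v).
Proof.
rewrite /half_proj dot_Mult; last exact: ebounded_posf.
by congr (dot u (MR _ v)); apply/funext => x; rewrite /posf conjc_real.
Qed.

(** The vertical case of the non-tangential limits. Symbols of the lower half-plane reach this form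
    after x -> - x. *)
Definition hardy (h : R -> R[i]) : Prop := exists (F : R[i] -> R[i]) (C : R),
  [/\ forall z, 0 < complex.Im z -> exists D, cdiff F z D,
      forall z, 0 < complex.Im z -> cmod (F z) <= C &
      {ae mu, forall x : R, forall e : R, 0 < e ->
        exists2 r : R, 0 < r & forall y, 0 < y < r -> cmod (F (x +i* y) - h x) <= e}].

(** For a >= 0 > c, the coefficient of M_h (chi a) at chi c is, up to a constant factor, the
    integral of h times [hatf a] times [hatf (- c)], because the conjugate of [hatf c] is -
    [hatf (- c)]. Both indices are nonnegative, so it vanishes by [hardy_cint]. *)
Lemma hardy_hankel h : ebounded mu h -> hardy h -> forall u, M h (P u) - P (M h (P u)) = 0.
Proof.
move=> bh [G [C [dG bG lG]]].
have [mh _] := bh; have bM := bop_comp bop_half_proj (bop_fmult bh).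
apply: (bop_ext (bop_sub bM (bop_comp bM bop_half_proj))) => a.
have [a0|a0] := leP 0 a; last first.
  by rewrite (half_proj_chi_le0 (ltW a0)) (bop0 (bop_fmult bh)) (bop0 bop_half_proj) subrr.
rewrite half_proj_chi_ge0 //; apply: weak_zero => c.
rewrite (ipBl ip) dot_half_proj; have [c0|c0] := leP 0 c; first by rewrite half_proj_chi_ge0 // subrr.
rewrite (half_proj_chi_le0 (ltW c0)) (ip0r ip) subr0 dot_fmult !F_chi.
have hh : {ae mu, forall x, L2_repr (MR h (hat a)) x = h x * hatf a x}.
  by apply: aeS (ae_and (MultE (hat a) bh) (hatE a)) => x [-> ->].
have mha := cmeasurableM mh (@cmeasurable_hatf R a).
rewrite (@dot_ae _ _ _ mu _ _ _ _ mha (@cmeasurable_hatf R c) hh (hatE c)).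
have := hardy_cint dG bG mh lG a0 (_ : 0 <= - c); rewrite oppr_ge0 => /(_ (ltW c0)) z.
have ci := sqi_mul (sqi_mult bh (@sqi_hatf R a)) (@sqi_hatf R c).
have key (x : R) : -1 * (h x * hatf a x * (hatf c x)^*) = h x * (hatf a x * hatf (- c) x).
  by rewrite -(conj_hatfN c x) conjcK hatfN mulrN mulN1r opprK mulrA.
have : -1 * cint mu (fun x : R => h x * hatf a x * (hatf c x)^*) = 0.
  by rewrite -cintZ // -z; apply: eq_cint => x; exact: key.
by rewrite mulN1r => /eqP; rewrite oppr_eq0 => /eqP ->; rewrite mulr0.
Qed.

Lemma Linf_ebounded (f : R -> R[i]) : Linf f -> ebounded mu f.
Proof.
move=> [mf]; rewrite /finite_norm unlock /=.
(* The norm with exponent +oo is the essential supremum only on a space of positive measure. *)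
have -> : (0 < mu setT)%E.
  apply: (@lt_le_trans _ _ (mu `[0, 1]%classic)).
    by rewrite lebesgue_measure_itv /= lte_fin ltr01 oppr0 adde0 lte_fin ltr01.
  by apply: le_measure; rewrite ?inE.
move=> h; split => //.
have := @ess_sup_ge _ _ _ mu (abse \o (EFin \o (cmod \o f))).
case: (ess_sup _ _) h => [r _|//|_] hh.
  by exists r; apply: aeS hh => x /=; rewrite lee_fin; apply: le_trans; rewrite ler_norm.
by exists 0; apply: aeS hh => x /=; rewrite leeNy_eq.
Qed.

Hypothesis JJ : forall u, J (J u) = u.
Hypothesis F_etr : forall a, 0 <= a -> F (etr a) = L2_of mu (etrh a).

Lemma half_proj_etr a : P (etr a) = etr a.
Proof.
apply: L2_ext; apply: aeS (ae_and (ae_and (half_projE (etr a)) (L2_ofK (sqi_etrf a))) (ae_neq 0)).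
move=> x [[-> ->] x0]; suff key (y : R) : y <> 0 -> posf y * etrf a y = etrf a y by exact: key.
move=> y0; rewrite /posf /etrf mulrA; congr (_ * _); rewrite /iv -rmorphM; congr (_%:C).
by case: (ltgtP 0 y) => [y1|y1|/esym //]; rewrite ?mul1r ?mul0r.
Qed.

(** As an inverse transform this is e^t on the negative half-line, where the convolution of the
    pole's kernel with any chi a, a >= 0, is a multiple of it. *)
Let eta : V := Fi (L2_of mu (@etaf R)).

Lemma pole_chi a : 0 <= a -> M (@polef R) (chi a) = (0 +i* 1) *: chi a +
  ((0 -i* 1) *: etr a + ((0 +i* 1) * (1 - (expR (- a))%:C)) *: eta).
Proof.
move=> a0; apply: fourier_inj.
rewrite fourier_fmult !(bopD _ _ bF) !(bopZ _ _ bF) F_chi F_etr // /eta FFi.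
set c1 := (X in X *: hat a); set c2 := (X in X *: L2_of mu (etrh a)); set c3 := (X in X *: L2_of mu (@etaf R)).
set v2 := L2_of mu (etrh a); set v3 := L2_of mu (@etaf R).
apply: L2_ext.
have h1 := ae_and (MultE (hat a) (@ebounded_polef R)) (hatE a).
have h2 := ae_and (L2_addE (c1 *: hat a) (c2 *: v2 + c3 *: v3)) (L2_addE (c2 *: v2) (c3 *: v3)).
have h3 := ae_and (L2_scaleE c1 (hat a)) (ae_and (L2_scaleE c2 v2) (L2_scaleE c3 v3)).
have h4 := ae_and (L2_ofK (sqi_etrh a0)) (ae_and (L2_ofK (@sqi_etaf R)) (ae_neq 0)).
apply: aeS (ae_and (ae_and h1 h2) (ae_and h3 h4)).
move=> x [[[-> ->] [-> ->]] [[-> [-> ->]] [-> [-> /eqP x0]]]].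
exact: pole_identity.
Qed.

(** For a >= 0 the terms chi a and etr a of [pole_chi] are fixed by P and cancel, leaving a multiple
    of eta - P eta. With the projection Pi onto this line, membership is the vanishing of a bounded
    operator, so it extends from the functions chi a to all u. *)
Lemma pole_hankel : frank (fun u => M (@polef R) (P u) - P (M (@polef R) (P u))).
Proof.
have bM := bop_comp bop_half_proj (bop_fmult (@ebounded_polef R)).
have bA := bop_sub bM (bop_comp bM bop_half_proj); split => //.
exists [:: eta - P eta] => u.
have [Pi bPi [rPi fPi]] := span_proj ip [:: eta - P eta].
suff h : forall u, (M (@polef R) (P u) - P (M (@polef R) (P u))) -
    Pi (M (@polef R) (P u) - P (M (@polef R) (P u))) = 0.
  by have /eqP := h u; rewrite subr_eq0 => /eqP ->; exact: rPi.
apply: (bop_ext (bop_sub bA (bop_comp bA bPi))) => a.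
apply/eqP; rewrite subr_eq0 eq_sym; apply/eqP; apply: fPi.
have [a0|a0] := leP 0 a; last first.
  by rewrite (half_proj_chi_le0 (ltW a0)) (bop0 (bop_fmult (@ebounded_polef R))) (bop0 bop_half_proj) subrr; exact: span0.
rewrite half_proj_chi_ge0 // pole_chi // !(bopD _ _ bop_half_proj) !(bopZ _ _ bop_half_proj) half_proj_chi_ge0 // half_proj_etr.
set c3 := _ * _; set w1 := _ *: chi a; set w2 := _ *: etr a.
have -> : w1 + (w2 + c3 *: eta) - (w1 + (w2 + c3 *: P eta)) = c3 *: (eta - P eta).
  by rewrite opprD addrACA subrr add0r opprD addrACA subrr add0r scalerBr.
by apply: spanZ; exists 1; rewrite scale1r subrr.
Qed.

Lemma hardy_polef_conj : hardy (@polef_conj R).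
Proof.
have nz (z : R[i]) : 0 <= complex.Im z -> z + (0 +i* 1) != 0.
  by move=> z0; apply/eqP => /(congr1 (@complex.Im R)) /=; rewrite ImD /=; lra.
exists (fun z => (z + (0 +i* 1))^-1), 1; split.
- by move=> z z0; exists (- ((z + (0 +i* 1)) ^- 2)); apply: cdiff_shift; apply: cdiffV; apply: nz; exact: ltW.
- by move=> z z0; apply: cmod_ge_Im; rewrite ImD /= ger0_norm; lra.
- apply: aeW => x e e0.
  have [//|r r0 hr] := cdiff_cont (cdiff_shift (cdiffV (nz x%:C _))) e0.
  exists r => // y /andP[y0 yr].
  have -> : polef_conj x = (x%:C + (0 +i* 1))^-1.
    by rewrite /polef_conj; congr (_^-1); apply: complexP; rewrite ?ReD ?ImD /= ?addr0 ?add0r.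
  apply: hr; have -> : (x +i* y) - x%:C = (0 +i* 1) * y%:C.
    by apply: complexP; rewrite ?ReM ?ImM ?ReD ?ImD /=; ring.
  by rewrite cmodM cmod_ii mul1r cmod_real gtr0_norm.
Qed.

(** Restricts a non-tangential limit to a path inside the cone, parametrized by the distance to x;
    the vertical path serves both half-planes. *)
Lemma cone_limit (s : half_plane) (G : R[i] -> R[i]) (l : R[i]) (x : R) (w : R -> R[i]) :
  (G z : R[i]^o) @[z --> within (cone s x 1) (nbhs (x%:C : R[i]^o))] --> (l : R[i]^o) ->
  (forall y, 0 < y -> cone s x 1 (w y) /\ cmod (w y - x%:C) = y) ->
  forall e : R, 0 < e -> exists2 r : R, 0 < r & forall y, 0 < y < r -> cmod (G (w y) - l) <= e.
Proof.
move=> h hw e e0; have e1 : 0 < e%:C :> R[i] by rewrite -(rmorph0 (real_complex R)) ltcR.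
have /cvgrPdist_le /(_ _ e1) [r /= r0 hr] := h.
have rE : r = (complex.Re r)%:C by apply: complexP => //=; exact: ger0_Im (ltW r0).
exists (complex.Re r).
  by move: r0; rewrite {1}rE -(rmorph0 (real_complex R)) ltcR.
move=> y /andP[y0 yr]; have [cw nw] := hw y y0.
have b : `|x%:C - w y| < r by rewrite rE normcE_cmod ltcR cmodC nw.
by have := hr (w y) b cw; rewrite normcE_cmod lecr cmodC.
Qed.

Lemma Hinf_upper_hardy h : Hinf upper h -> ebounded mu h /\ hardy h.
Proof.
move=> [lh [G [dG [C bG] lG]]]; split; first exact: Linf_ebounded.
exists G, (complex.Re C); split.
- by move=> z z0; apply: derivable_cdiff; exact: dG.
- move=> z z0; have := bG z z0; rewrite normcE_cmod => hC.
  by have := lecE _ _; move: hC; rewrite lecE => /andP[_].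
- apply: aeS lG => x hx; apply: (@cone_limit upper G _ x (fun y => x +i* y) (hx 1 ltr01)) => y y0.
  split; first by split => //=; rewrite subrr normr0 mul1r normr_gt0 gt_eqF.
  have -> : (x +i* y) - x%:C = (0 +i* 1) * y%:C.
    by apply: complexP; rewrite ?ReM ?ImM ?ReD ?ImD /=; ring.
  by rewrite cmodM cmod_ii mul1r cmod_real gtr0_norm.
Qed.

(** The map z -> - z exchanges the half-planes, so the reflected symbol extends analytically to the
    upper one. *)
Lemma Hinf_lower_hardy h : Hinf lower h -> ebounded mu h /\ hardy (fun x : R => h (- x)).
Proof.
move=> [lh [G [dG [C bG] lG]]]; split; first exact: Linf_ebounded.
exists (fun z => G (- z)), (complex.Re C); split.
- move=> z z0; have [|D hD] := derivable_cdiff (dG (- z) _).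
    by rewrite /= ImN oppr_lt0.
  exists (- D) => e e0; have [r r0 hr] := hD e e0; exists r => // w wr.
  have E : - w - - z = - (w - z) by rewrite opprB opprK addrC.
  have := hr (- w); rewrite E cmodN => /(_ wr).
  by rewrite mulrN mulNr.
- move=> z z0; have := bG (- z); rewrite /= ImN oppr_lt0 normcE_cmod => /(_ z0).
  by rewrite lecE => /andP[_].
- apply: aeS (ae_oppr lG) => x hx.
  apply: (@cone_limit lower G _ (- x) (fun y => - (x +i* y)) (hx 1 ltr01)) => y y0.
  split; first by split => /=; rewrite ?oppr_lt0 // subrr normr0 mul1r normrN normr_gt0 gt_eqF.
  have -> : - (x +i* y) - (- x)%:C = - ((0 +i* 1) * y%:C).
    by apply: complexP; rewrite ?ReN ?ImN ?ReM ?ImM ?ReD ?ImD /=; ring.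
  by rewrite cmodN cmodM cmod_ii mul1r cmod_real gtr0_norm.
Qed.

Local Notation up := (hankel_up P).
Local Notation dn := (hankel_dn P).
Local Notation appxV := (@appx R V V).
Let zeroV (T : V -> V) := forall x, T x = 0.

Lemma Hinf_up h : Hinf upper h -> up zeroV (M h).
Proof. by move=> /Hinf_upper_hardy [bh hh]; exact: hardy_hankel. Qed.

Let dn_of_up I h : opideal I -> ebounded mu h -> up I (M (fun x : R => h (- x))) -> dn I (M h).
Proof.
move=> oI bh hu; apply: (hankel_reflect oI bJ JJ reflection_half_proj _ hu) => u.
exact: reflection_fmult.
Qed.

Lemma Hinf_dn h : Hinf lower h -> dn zeroV (M h).
Proof.
move=> /Hinf_lower_hardy [bh hh]; apply: (dn_of_up (@zero_ideal R V) bh).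
exact: hardy_hankel (ebounded_oppr bh) hh.
Qed.

Let zero_appx (T : V -> V) : zeroV T -> appxV T.
Proof.
move=> h; apply: frank_appx; rewrite (_ : T = fun=> 0); first exact: frank_zero.
by apply/funext => u; exact: h.
Qed.

Let upM I p q : opideal I -> ebounded mu p -> ebounded mu q -> up I (M p) -> up I (M q) ->
  up I (M (fun x => p x * q x)).
Proof.
move=> oI bp bq hp hq.
have := hankel_up_comp bop_half_proj oI (bop_fmult bp) (bop_fmult bq) hp hq.
by rewrite (_ : (fun u => _) = M (fun x => p x * q x)) //; apply/funext => u; exact: fmult_comp.
Qed.

Let dnM I p q : opideal I -> ebounded mu p -> ebounded mu q -> dn I (M p) -> dn I (M q) ->
  dn I (M (fun x => p x * q x)).
Proof.
move=> oI bp bq hp hq.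
have := hankel_dn_comp bop_half_proj oI (bop_fmult bp) (bop_fmult bq) hp hq.
by rewrite (_ : (fun u => _) = M (fun x => p x * q x)) //; apply/funext => u; exact: fmult_comp.
Qed.

Let upD I p q : opideal I -> ebounded mu p -> ebounded mu q -> up I (M p) -> up I (M q) ->
  up I (M (fun x => p x + q x)).
Proof.
move=> oI bp bq hp hq.
have := hankel_up_add bop_half_proj oI (bop_fmult bp) (bop_fmult bq) hp hq.
rewrite (_ : (fun u => M p u + _) = M (fun x => p x + q x)) //.
by apply/funext => u; symmetry; exact: fmult_add.
Qed.

Lemma Cdot_up f : Cdot f -> ebounded mu f /\ up appxV (M f).
Proof.
have oA := @appx_ideal R V.
apply: (@Cdot_closure R (fun f => ebounded mu f /\ up appxV (M f))).
- by move=> g [[]].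
- move=> c; split; first exact: ebounded_cst.
  apply: zero_appx => u; rewrite fmult_cst (bopZ _ _ bop_half_proj) half_projK subrr //.
- by move=> p q [bp hp] [bq hq]; split; [exact: eboundedD|exact: upD].
- by move=> p q [bp hp] [bq hq]; split; [exact: eboundedM|exact: upM].
- by split; [exact: ebounded_polef|apply: frank_appx; exact: pole_hankel].
- split; first exact: ebounded_polef_conj.
  apply: zero_appx; exact: (hardy_hankel (@ebounded_polef_conj R) hardy_polef_conj).
- move=> g mg hg.
  have bg : ebounded mu g.
    have [p [[mp [C hC]] _] hp] := hg 1 ltr01; split => //; exists (C + 1).
    apply: aeS hC => x hx; have -> : g x = p x + (g x - p x) by rewrite addrC subrK.
    by apply: le_trans (cmodD _ _) _; exact: lerD.
  split => //.
  have bM := bop_comp bop_half_proj (bop_fmult bg).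
  split; first exact: bop_sub bM (bop_comp bM bop_half_proj).
  (* Three errors of size e / 3: the finite-rank approximation for the symbol [p], and the
     multiplier of g - p once directly and once under P. *)
  move=> e e0; have e3 : 0 < e / 3 by rewrite divr_gt0.
  have [p [bp [_ ap]] hp] := hg _ e3; have [T fT hT] := ap _ e3.
  exists T => // u; have [mp _] := bp.
  set w := M (fun x => g x - p x) (P u).
  have gE : M g (P u) = M p (P u) + w.
    rewrite /w -fmult_add //; last exact: eboundedB.
    by congr (M _ (P u)); apply/funext => x; rewrite addrC subrK.
  have nw : nrm w <= e / 3 * nrm u.
    apply: (@le_trans _ _ (e / 3 * nrm (P u))).
      by apply: nrm_fmult; [exact: cmeasurableB|exact: ltW|apply: aeW => x; exact: hp].
    by rewrite ler_pM2l // nrm_half_proj.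
  have -> : M g (P u) - P (M g (P u)) - T u = (M p (P u) - P (M p (P u)) - T u) + (w - P w).
    have gen (W : zmodType) (x1 x2 y1 y2 t : W) : (x1 + x2) - (y1 + y2) - t = x1 - y1 - t + (x2 - y2).
      by rewrite opprD (addrACA x1 x2) (addrAC (x1 - y1)).
    by rewrite gE (bopD _ _ bop_half_proj); exact: gen.
  apply: le_trans (nrmD _ _) _; have h1 := hT u.
  have h2 := nrmB w (P w); have h3 := nrm_half_proj w.
  have -> : e * nrm u = e / 3 * nrm u + e / 3 * nrm u + e / 3 * nrm u by field.
  lra.
Qed.

Lemma CdotDHinf_up f : CdotDHinf upper f -> ebounded mu f /\ up appxV (M f).
Proof.
move=> [c [h [/Cdot_up [bc uc] hh ->]]]; have [bh _] := Hinf_upper_hardy hh.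
split; first exact: eboundedD.
by apply: (upD (@appx_ideal R V) bc bh uc); apply: zero_appx; exact: Hinf_up.
Qed.

Lemma Cdot_oppr f : Cdot f -> Cdot (fun x : R => f (- x)).
Proof.
move=> [cf [l [lp lm]]]; split.
  by move=> x; apply: (@continuous_comp _ _ _ (@GRing.opp R)); [exact: opp_continuous|exact: cf].
exists l; split; [exact: (iffLR (cvgNy_compNP _ _) lm)|exact: (iffLR (cvgy_compNP _ _) lp)].
Qed.

Lemma CdotDHinf_dn f : CdotDHinf lower f -> ebounded mu f /\ dn appxV (M f).
Proof.
move=> [c [h [cc hh ->]]]; have [bh rh] := Hinf_lower_hardy hh.
have [bc _] := Cdot_up cc; have [bc' uc] := Cdot_up (Cdot_oppr cc).
split; first exact: eboundedD.
apply: (dn_of_up (@appx_ideal R V) (eboundedD bc bh)).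
apply: (upD (@appx_ideal R V) bc' (ebounded_oppr bh) uc).
by apply: zero_appx; exact: hardy_hankel (ebounded_oppr bh) rh.
Qed.

(** Rotated by c, the values z of s satisfy Re z >= eps and |z| <= K; a suitable dilation d moves
    this region into a disc |1 - d z| <= q with q < 1. *)
Lemma sectorial_near1 s : sectorial s -> ebounded mu s /\ exists (a : R[i]) (q : R),
  [/\ 0 <= q, q < 1 & forall u, nrm (u - a *: M s u) <= q * nrm u].
Proof.
move=> [ls [eps [c [eps0 c1 hs]]]]; have bs := Linf_ebounded ls; split => //.
have [ms _] := bs; have [K0 K00 hK0] := ebounded_ge0 bs; pose K := K0 + eps.
have Kp : 0 < K by rewrite /K; lra.
have c1' : cmod c = 1 by move: c1; rewrite normcE_cmod => /(congr1 (@complex.Re R)).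
(* This d minimizes 1 - 2 d eps + d^2 K^2, an upper bound for |1 - d z|^2, and the minimum is 1 -
   (eps / K)^2. *)
pose d := eps / K ^+ 2; have d0 : 0 < d by rewrite divr_gt0 // exprn_gt0.
pose q2 := 1 - (eps / K) ^+ 2.
have eK : eps / K <= 1 by rewrite ler_pdivrMr // mul1r /K; lra.
have eK0 : 0 < eps / K by rewrite divr_gt0.
have q20 : 0 <= q2 by rewrite /q2 subr_ge0 expr_le1 // ltW.
have q21 : q2 < 1 by rewrite /q2 gtrBl exprn_gt0.
exists (d%:C * c), (Num.sqrt q2); split; first exact: sqrtr_ge0.
  by rewrite -[ltRHS]sqrtr1 ltr_sqrt.
move=> u; have bc := ebounded_cst mu (- (d%:C * c)).
have -> : u - (d%:C * c) *: M s u = M (fun x => 1 + - (d%:C * c) * s x) u.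
  rewrite fmult_add; [|exact: ebounded_cst|exact: eboundedM].
  by rewrite -(fmult_comp u bc bs) !fmult_cst scale1r scaleNr.
apply: nrm_fmult.
- by apply: cmeasurableD; [exact: cmeasurable_cst|apply: cmeasurableM => //; exact: cmeasurable_cst].
- exact: sqrtr_ge0.
apply: aeS (ae_and hs hK0) => x [h1 h2].
rewrite -(@ler_pXn2r _ 2) ?nnegrE ?cmod_ge0 ?sqrtr_ge0 // sqr_sqrtr //.
have h3 : cmod (c * s x) <= K by rewrite cmodM c1' mul1r /K; lra.
rewrite mulNr -mulrA; move: (c * s x) h1 h3 => z h1 h3.
have h4 : cmod z ^+ 2 <= K ^+ 2 by rewrite !expr2; apply: ler_pM => //; exact: cmod_ge0.
rewrite cmod_sqr in h4; rewrite cmod_sqr ReD ImD ReN ImN ReZ ImM /= mul0r addr0 add0r.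
move: (complex.Re z) (complex.Im z) h1 h4 => a b h1 h4.
have -> : q2 = 1 - 2 * d * eps + d ^+ 2 * K ^+ 2 by rewrite /q2 /d; field; rewrite gt_eqF.
have -> : (1 - d * a) ^+ 2 + (- (d * b)) ^+ 2 = 1 - 2 * d * a + d ^+ 2 * (a ^+ 2 + b ^+ 2) by ring.
have k1 : 2 * d * eps <= 2 * d * a by rewrite ler_pM2l // mulr_gt0.
have k2 : d ^+ 2 * (a ^+ 2 + b ^+ 2) <= d ^+ 2 * K ^+ 2 by rewrite ler_pM2l // exprn_gt0.
lra.
Qed.

(** Multipliers commute, so the factor of s can be put on either side of that of h, as the
    triangularity of h or of its inverse g requires. *)
Lemma symbol_toeplitz I s h g Psi : opideal I -> sectorial s ->
  ebounded mu h -> ebounded mu g -> ebounded mu Psi ->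
  eq_ae Psi (fun x => s x * h x) -> eq_ae (fun x => h x * g x) (fun=> 1) ->
  [/\ up I (M h) -> toep_left P I (M Psi), up I (M g) -> toep_right P I (M Psi),
      dn I (M h) -> toep_right P I (M Psi) & dn I (M g) -> toep_left P I (M Psi)].
Proof.
move=> oI ss bh bg bPsi eP eg.
have [bs [a [q [q0 q1 hq]]]] := sectorial_near1 ss.
have [B bB [PB Bs sB]] := toeplitz_inverse (@L2_complete _ _ _ mu) bop_half_proj half_projK nrm_half_proj (bop_fmult bs) q0 q1 hq.
have hg u : M h (M g u) = u.
  rewrite fmult_comp // (fmult_ae u (eboundedM bh bg) (ebounded_cst mu 1) eg) fmult_cst.
  exact: scale1r.
have gh u : M g (M h u) = u.
  by rewrite -[RHS]hg !fmult_comp //; congr (M _ u); apply/funext => x; rewrite mulrC.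
have E1 : M Psi = fun u => M s (M h u).
  by apply/funext => u; rewrite fmult_comp //; apply: fmult_ae => //; exact: eboundedM.
have E2 : M Psi = fun u => M h (M s u).
  rewrite E1; apply/funext => u; rewrite !fmult_comp //; congr (M _ u).
  by apply/funext => x; rewrite mulrC.
have [[bMs bMh] bMg] := (bop_fmult bs, bop_fmult bh, bop_fmult bg).
split=> H.
- by rewrite E1; exact: (toeplitz_up_left bop_half_proj half_projK oI bMs bMg bB gh Bs H).
- by rewrite E1; exact: (toeplitz_up_right bop_half_proj half_projK oI bMs bMh bMg bB hg PB sB H).
- by rewrite E2; exact: (toeplitz_dn_right bop_half_proj half_projK oI bMs bMh bMg bB hg PB sB H).
- by rewrite E2; exact: (toeplitz_dn_left bop_half_proj half_projK oI bMs bMh bMg bB gh Bs H).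
Qed.

Definition half_left I phi := exists L k,
  [/\ bop L, I k & forall u, P u = u -> L (P (M phi (u + J u))) = u + k u].

Definition half_right I phi := exists L k,
  [/\ bop L, I k, forall y, P (L y) = L y &
    forall y, P y = y -> P (M phi (L y + J (L y))) = y + k y].

Lemma half_parametrix I phi s h : opideal I -> units (@Linf R) phi -> sectorial s ->
  ebounded mu h -> eq_ae (refl_quot phi) (fun x => s x * h x) ->
  [/\ up I (M h) -> half_left I phi, dn I (M h) -> half_right I phi &
      forall g, ebounded mu g -> eq_ae (fun x => h x * g x) (fun=> 1) ->
      (up I (M g) -> half_right I phi) /\ (dn I (M g) -> half_left I phi)].
Proof.
move=> oI [/Linf_ebounded bphi [psi /Linf_ebounded bpsi pp]] ss bh eP.
have [bs _] := sectorial_near1 ss.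
have [bphi' bpsi'] := (ebounded_oppr bphi, ebounded_oppr bpsi).
have pp' : {ae mu, forall x : R, phi (- x) * psi (- x) = 1} := ae_oppr pp.
have inv_of (a b : R[i]) : a * b = 1 -> a^-1 = b /\ a != 0.
  move=> ab; have a0 : a != 0 by apply: contra_eq_neq ab => ->; rewrite mul0r eq_sym oner_eq0.
  by split => //; apply: (mulfI a0); rewrite ab mulfV.
(* Using [psi] in place of the pointwise reciprocal in [refl_quot] makes measurability and
   boundedness of the symbol immediate. *)
pose Psi x := phi x * psi (- x).
have bPsi : ebounded mu Psi by exact: eboundedM.
have ePsi : eq_ae (refl_quot phi) Psi.
  by apply: aeS pp' => x /inv_of [e _]; rewrite /refl_quot e.
have ePsi' : eq_ae Psi (fun x => s x * h x).
  by apply: aeS (ae_and ePsi eP) => x [<- <-].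
have [[bMp bMq] bA] := (bop_fmult bphi, bop_fmult bpsi, bop_fmult bPsi).
have fv u : M phi (M psi u) = u.
  rewrite fmult_comp // (fmult_ae u (eboundedM bphi bpsi) (ebounded_cst mu 1) pp) fmult_cst.
  exact: scale1r.
have vf u : M psi (M phi u) = u.
  by rewrite -[RHS]fv !fmult_comp //; congr (M _ u); apply/funext => x; rewrite mulrC.
have AJf u : M Psi (J (M phi u)) = M phi (J u).
  rewrite reflection_fmult // fmult_comp //; apply: fmult_ae => //; first exact: eboundedM.
  apply: aeS pp' => x e; rewrite /Psi -mulrA [psi _ * _]mulrC.
  by rewrite e mulr1.
have toL := wh_left bop_half_proj half_projK oI bJ JJ reflection_half_proj bMp bMq bA vf AJf.
have toR := wh_right bop_half_proj half_projK oI bJ JJ reflection_half_proj bMp bMq bA fv AJf.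
(* Since Psi = s h is invertible, s / Psi is a bounded inverse of h. It need not lie in the Hardy
   algebra, which is why the Hankel condition on h alone yields one side only. *)
pose g0 x := s x * (psi x * phi (- x)).
have bg0 : ebounded mu g0 by apply: eboundedM => //; exact: eboundedM.
have hg0 : eq_ae (fun x => h x * g0 x) (fun=> 1).
  apply: aeS (ae_and ePsi' (ae_and pp pp')) => x [e1 [e2 e3]].
  transitivity (Psi x * (psi x * phi (- x))); first by rewrite e1 /g0 mulrA [h x * _]mulrC.
  transitivity ((phi x * psi x) * (phi (- x) * psi (- x))); first by rewrite /Psi; ring.
  by rewrite e2 e3 mulr1.
have [h1 _ h3 _] := symbol_toeplitz oI ss bh bg0 bPsi ePsi' hg0.
split; [by move=> /h1 /toL|by move=> /h3 /toR|] => g bg hg.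
have [_ h2 _ h4] := symbol_toeplitz oI ss bh bg bPsi ePsi' hg.
by split; [move=> /h2 /toR|move=> /h4 /toL].
Qed.

Let Hinf_ebounded sg h : Hinf sg h -> ebounded mu h.
Proof. by case=> /Linf_ebounded. Qed.

Section six_cases.
Variables (phi s : R -> R[i]).
Hypotheses (Gphi : units (@Linf R) phi) (ss : sectorial s).
Let zero_id := @zero_ideal R V.
Let appx_id := @appx_ideal R V.

Lemma left_of_Hinf h : Hinf upper h -> eq_ae (refl_quot phi) (fun x => s x * h x) ->
  half_left zeroV phi.
Proof.
move=> hh e; have [H _ _] := half_parametrix zero_id Gphi ss (Hinf_ebounded hh) e.
by apply: H; exact: Hinf_up.
Qed.

Lemma right_of_Hinf h : Hinf lower h -> eq_ae (refl_quot phi) (fun x => s x * h x) ->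
  half_right zeroV phi.
Proof.
move=> hh e; have [_ H _] := half_parametrix zero_id Gphi ss (Hinf_ebounded hh) e.
by apply: H; exact: Hinf_dn.
Qed.

(** For upper symbols h provides the left inverse and 1 / h the right one; for lower symbols the
    roles are exchanged. *)
Lemma inverse_of_Hinf sg h : units (Hinf sg) h -> eq_ae (refl_quot phi) (fun x => s x * h x) ->
  half_left zeroV phi /\ half_right zeroV phi.
Proof.
move=> [hh [g hg hg1]] e.
have [H1 H2 /(_ g (Hinf_ebounded hg) hg1) [H3 H4]] := half_parametrix zero_id Gphi ss (Hinf_ebounded hh) e.
case: sg hh hg => hh hg.
  by split; [apply: H1; exact: Hinf_up|apply: H3; exact: Hinf_up].
by split; [apply: H4; exact: Hinf_dn|apply: H2; exact: Hinf_dn].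
Qed.

Variables (h1 h2 : R -> R[i]).
Hypothesis e : eq_ae (refl_quot phi) (fun x => s x * h1 x * h2 x).

Let e' : eq_ae (refl_quot phi) (fun x => s x * (h1 x * h2 x)).
Proof. by apply: aeS e => x ->; rewrite mulrA. Qed.

Let up_prod f g : CdotDHinf upper f -> Hinf upper g -> up appxV (M (fun x => f x * g x)).
Proof.
move=> /CdotDHinf_up [bf uf] hg; apply: (upM appx_id bf (Hinf_ebounded hg) uf).
by apply: zero_appx; exact: Hinf_up.
Qed.

Let dn_prod f g : CdotDHinf lower f -> Hinf lower g -> dn appxV (M (fun x => f x * g x)).
Proof.
move=> /CdotDHinf_dn [bf uf] hg; apply: (dnM appx_id bf (Hinf_ebounded hg) uf).
by apply: zero_appx; exact: Hinf_dn.
Qed.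

Let ebounded_prod sg f g : CdotDHinf sg f -> Hinf sg g -> ebounded mu (fun x => f x * g x).
Proof.
by case: sg => [/CdotDHinf_up [bf _]|/CdotDHinf_dn [bf _]] hg; apply: eboundedM => //; exact: Hinf_ebounded hg.
Qed.

Lemma left_of_CdotDHinf : CdotDHinf upper h1 -> Hinf upper h2 -> half_left appxV phi.
Proof.
move=> u1 u2; have [H _ _] := half_parametrix appx_id Gphi ss (ebounded_prod u1 u2) e'.
by apply: H; exact: up_prod.
Qed.

Lemma right_of_CdotDHinf : CdotDHinf lower h1 -> Hinf lower h2 -> half_right appxV phi.
Proof.
move=> u1 u2; have [_ H _] := half_parametrix appx_id Gphi ss (ebounded_prod u1 u2) e'.
by apply: H; exact: dn_prod.
Qed.

Lemma both_of_CdotDHinf sg : units (CdotDHinf sg) h1 -> units (Hinf sg) h2 ->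
  half_left appxV phi /\ half_right appxV phi.
Proof.
move=> [u1 [g1 v1 hg1]] [u2 [g2 v2 hg2]].
have hg : eq_ae (fun x => (h1 x * h2 x) * (g1 x * g2 x)) (fun=> 1).
  by apply: aeS (ae_and hg1 hg2) => x [k1 k2]; rewrite mulrACA k1 k2 mulr1.
have [H1 H2 /(_ _ (ebounded_prod v1 v2) hg) [H3 H4]] :=
  half_parametrix appx_id Gphi ss (ebounded_prod u1 u2) e'.
case: sg u1 v1 u2 v2 {H1 H2 H3 H4} (H1, H2, H3, H4) => u1 v1 u2 v2 [[[H1 H2] H3] H4].
  by split; [apply: H1; exact: up_prod|apply: H3; exact: up_prod].
by split; [apply: H4; exact: dn_prod|apply: H2; exact: dn_prod].
Qed.

End six_cases.

End multipliers.

(** * The half-line *)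

Section half_line.
Context (R : realType).
Local Notation mu := (@lebesgue_measure R).
Local Notation V := (L2 mu).
Local Notation X := (L2_plus R).
Local Notation Y := (L2Rplus R).
Local Notation nu := (mrestr mu (@measurable_Rplus R)).
Local Notation P := (@half_proj R).

Lemma ae_mrestr (Q : R -> Prop) :
  {ae nu, forall x : R, Q x} <-> {ae mu, forall x : R, 0 < x -> Q x}.
Proof.
split=> -[A [mA A0 hA]].
  exists (A `&` @Rplus R); split; [exact: (measurableI _ _ mA (@measurable_Rplus R))|exact: A0|].
  by move=> x /= h; split; [apply: hA => q; apply: h|apply: contrapT => n; apply: h => x0; exfalso; exact: n].
exists (A `|` ~` @Rplus R); split.
- by apply: measurableU => //; apply: measurableC; exact: measurable_Rplus.
- rewrite /mrestr setIUl setICl setU0; apply/eqP; rewrite eq_le measure_ge0 andbT -A0.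
  apply: le_measure; [|by rewrite inE|by move=> x []].
  by rewrite inE; exact: (measurableI _ _ mA (@measurable_Rplus R)).
- move=> x /= h; case: (pselect (0 < x)) => x0; last by right.
  by left; apply: hA => /= q; apply: h; exact: q.
Qed.

Lemma sint_mrestr (f : R -> R[i]) : cmeasurable f ->
  sint nu f = sint mu (fun x => posf x * f x).
Proof.
move=> mf; have [mp _] := ebounded_posf R.
have m2 := measurable_cmod2 mf.
transitivity (\int[nu]_(x in @Rplus R) (cmod (f x) ^+ 2)%:E)%E.
  rewrite /sint [RHS]integral_mkcond; apply: ae_eq_integral => //.
    by apply/(measurable_restrictT _ _).1 => //; [exact: measurable_Rplus|exact: measurable_funTS].
  apply/ae_mrestr; apply: aeW => x x0 _ /=; rewrite /patch mem_set //.
transitivity (\int[mu]_(x in @Rplus R) (cmod (f x) ^+ 2)%:E)%E.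
  apply: eq_measure_integral => A mA AD; rewrite /= /mrestr; congr (mu _).
  by apply/setIidPl.
rewrite integral_mkcond; apply: eq_integral => x _; rewrite /patch.
rewrite /posf; case: ifPn => [/set_mem|/negP h].
  by rewrite /Rplus /= => ->; rewrite mul1r.
have -> : (0 < x) = false by apply/negbTE/negP => x0; apply: h; rewrite inE.
by rewrite mul0r cmod0 expr0n.
Qed.

Lemma sqi_repr_nu (v : V) : cLfun nu 2%:E (L2_repr v).
Proof.
apply/sqiP; split; first exact: (cmeasurable_repr v).
rewrite sint_mrestr; last exact: (cmeasurable_repr v).
by have [] := (sqiP _ _).1 (sqi_mult (ebounded_posf R) (L2_reprP v)).
Qed.

Lemma restrictionE (v : V) :
  {ae mu, forall x : R, 0 < x -> L2_repr (restriction v) x = L2_repr v x}.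
Proof. by apply/ae_mrestr; exact: L2_ofK (sqi_repr_nu v). Qed.

(** Extension by zero identifies L^2(R_+) isometrically with the range of P, so the operator can be
    studied inside L^2(R). *)
Definition ext (y : Y) : V := L2_of mu (fun x => posf x * L2_repr y x).

Lemma sqi_ext (y : Y) : cLfun mu 2%:E (fun x : R => posf x * L2_repr y x).
Proof.
have [my sy] := (sqiP nu _).1 (L2_reprP y); have [mp _] := ebounded_posf R.
apply/sqiP; split; first exact: cmeasurableM.
by rewrite -sint_mrestr.
Qed.

Lemma extE (y : Y) : {ae mu, forall x : R, L2_repr (ext y) x = posf x * L2_repr y x}.
Proof. exact: L2_ofK (sqi_ext y). Qed.

Let posf_ae (x : R) (a b : R[i]) : (0 < x -> a = b) -> posf x * a = posf x * b.
Proof.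
rewrite /posf; case: (0 < x) => h; first by rewrite h.
by rewrite -[_%:C]/(0 : R[i]) !mul0r.
Qed.

Lemma ext_restriction (v : V) : ext (restriction v) = P v.
Proof.
apply: L2_ext.
apply: aeS (ae_and (extE (restriction v)) (ae_and (restrictionE v) (half_projE v))) => x [-> [h ->]].
exact: posf_ae.
Qed.

Lemma restriction_ext (y : Y) : restriction (ext y) = y.
Proof.
apply: L2_ext; apply/ae_mrestr.
apply: aeS (ae_and (extE y) (restrictionE (ext y))) => x [e h] x0; rewrite (h x0) e.
suff key (t : R) (z : R[i]) : 0 < t -> posf t * z = z by exact: key.
by move=> t0; rewrite /posf t0 mul1r.
Qed.

Lemma nrm_ext (y : Y) : nrm (ext y) = nrm y.
Proof.
apply/eqP; rewrite -(@eqrXn2 _ 2) ?nrm_ge0 //; apply/eqP; apply: EFin_inj.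
rewrite (nrm_L2_of (sqi_ext y)) nrm_sint sint_mrestr //.
by have [] := (sqiP nu _).1 (L2_reprP y).
Qed.

Lemma bop_ext_half : bop ext.
Proof.
split; last by exists 1 => // y; rewrite nrm_ext mul1r.
move=> a y z; apply: L2_ext.
have h0 := ae_and (L2_addE (a *: y) z) (L2_scaleE a y).
have h1 := (ae_mrestr _).1 h0.
have h2 := ae_and (L2_addE (a *: ext y) (ext z)) (L2_scaleE a (ext y)).
apply: aeS (ae_and (ae_and (extE (a *: y + z)) h1) (ae_and h2 (ae_and (extE y) (extE z)))).
move=> x [[-> h] [[-> ->] [-> ->]]].
rewrite mulrCA -mulrDr; apply: posf_ae => x0.
by have [-> ->] := h x0.
Qed.

Lemma ext_inj : injective ext.
Proof. exact: can_inj restriction_ext. Qed.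

Lemma bop_restriction : bop (@restriction R : V -> Y).
Proof.
have [lP _] := bop_half_proj R; have [lE _] := bop_ext_half.
split; first by move=> a u v; apply: ext_inj; rewrite lE !ext_restriction lP.
by exists 1 => // v; rewrite -nrm_ext ext_restriction mul1r nrm_half_proj.
Qed.

Lemma restriction_half_proj (v : V) : restriction (P v) = restriction v.
Proof. by apply: ext_inj; rewrite !ext_restriction half_projK. Qed.

Lemma half_proj_ext (y : Y) : P (ext y) = ext y.
Proof. by rewrite -[y]restriction_ext ext_restriction half_projK. Qed.

Lemma half_proj_vanishing (v : V) : (P v : L2R R) \in L2_vanishing (mu := mu) [set x : R | x < 0].
Proof.
apply/asboolP; apply: aeS (half_projE v) => x -> /= x0.
suff key (t : R) (z : R[i]) : t < 0 -> posf t * z = 0 by exact: key.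
by move=> t0; rewrite /posf ltNge (ltW t0) -[_%:C]/(0 : R[i]) mul0r.
Qed.

Definition proj (v : V) : X := Sub (P v : L2R R) (half_proj_vanishing v).

Lemma val_proj (v : V) : val (proj v) = P v.
Proof. by []. Qed.

Lemma half_proj_val (u : X) : P (val u) = val u.
Proof.
have /asboolP h := valP u.
apply: L2_ext; apply: aeS (ae_and (half_projE (val u)) (ae_and h (ae_neq 0))) => x [-> [hx x0]].
suff key (t : R) (z : R[i]) : t <> 0 -> (t < 0 -> z = 0) -> posf t * z = z by exact: key.
move=> t0 tz; rewrite /posf; case: (ltgtP 0 t) => [_|/tz ->|/esym //]; first by rewrite mul1r.
by rewrite mulr0.
Qed.

Lemma bop_val : bop (val : X -> V).
Proof. by split => //; exists 1 => // u; rewrite mul1r. Qed.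

Lemma bop_proj : bop proj.
Proof.
have [lP _] := bop_half_proj R; split; first by move=> a u v; apply: val_inj; exact: lP.
by exists 1 => // v; rewrite mul1r; exact: nrm_half_proj.
Qed.

Lemma projK (u : X) : proj (val u) = u.
Proof. by apply: val_inj; rewrite val_proj half_proj_val. Qed.

Variables (A : V -> V) (W : X -> Y).
Hypotheses (bA : bop A) (WE : forall u, W u = restriction (A (val u))).
Let zeroV (T : V -> V) := forall x, T x = 0.

Lemma bop_half : bop W.
Proof.
rewrite (_ : W = fun u => restriction (A (val u))); last exact/funext.
exact: bop_comp (bop_comp bop_val bA) bop_restriction.
Qed.

Lemma half_left_inverse L k : bop L -> zeroV k ->
  (forall u, P u = u -> L (P (A u)) = u + k u) ->
  exists2 S, bop S & cancel W S.
Proof.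
move=> bL k0 h; exists (fun y => proj (L (ext y))).
  exact: bop_comp (bop_comp bop_ext_half bL) bop_proj.
by move=> u; rewrite WE ext_restriction h ?half_proj_val // k0 addr0 projK.
Qed.

Lemma half_left_fredholm L k : bop L -> appx k ->
  (forall u, P u = u -> L (P (A u)) = u + k u) -> left_fredholm W.
Proof.
move=> bL ak h; have [B [F [bB fF hB]]] := appx_left (@L2_complete _ _ _ mu) ak.
apply: (left_parametrix (L2_inner nu) bop_half (L := fun y => proj (B (L (ext y))))
  (F := fun u => proj (F (val u)))).
- exact: bop_comp (bop_comp (bop_comp bop_ext_half bL) bB) bop_proj.
- exact: (frank_compl bop_proj (frank_compr bop_val fF)).
- move=> u; rewrite WE ext_restriction h ?half_proj_val // hB (bopD _ _ bop_proj).
  by rewrite projK.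
Qed.

Lemma half_right_inverse L k : bop L -> zeroV k -> (forall y, P (L y) = L y) ->
  (forall y, P y = y -> P (A (L y)) = y + k y) ->
  exists2 S, bop S & cancel S W.
Proof.
move=> bL k0 PL h; exists (fun y => proj (L (ext y))).
  exact: bop_comp (bop_comp bop_ext_half bL) bop_proj.
move=> y; rewrite WE val_proj PL -restriction_half_proj h ?half_proj_ext // k0 addr0.
exact: restriction_ext.
Qed.

(** [appx_right] asks for an error that stays in the range of P, so k is replaced by K = P k P. The
    two agree on the range of P, because P A L z = z + k z forces k z into that range. *)
Lemma half_right_fredholm L k : bop L -> appx k -> (forall y, P (L y) = L y) ->
  (forall y, P y = y -> P (A (L y)) = y + k y) -> right_fredholm W.
Proof.
move=> bL ak PL h; pose K u := P (k (P u)).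
have bP := bop_half_proj R.
have aK : appx K by exact: (appx_compl bP (appx_compr bP ak)).
have PK u : P (K u) = K u by exact: half_projK.
have [B [F [bB fF hB PB]]] := appx_right (@L2_complete _ _ _ mu) aK bP (@nrm_half_proj R) (@half_projK R) PK.
apply: (right_parametrix (L2_inner nu) bop_half (S := fun y => proj (L (B (ext y))))
  (F := fun y => restriction (F (ext y)))).
- exact: bop_comp (bop_comp (bop_comp bop_ext_half bB) bL) bop_proj.
- exact: (frank_compl bop_restriction (frank_compr bop_ext_half fF)).
- move=> y; have Pz := PB _ (half_proj_ext y); set z := B (ext y) in Pz *.
  have kz : k z = K z.
    have := h z Pz; move/(congr1 P); rewrite half_projK (bopD _ _ bP) Pz => e.
    have := h z Pz; rewrite e => /addrI {}e.
    by rewrite /K Pz.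
  rewrite WE val_proj PL -restriction_half_proj h // kz hB (bopD _ _ bop_restriction).
  by rewrite restriction_ext.
Qed.

End half_line.

(** * Transfer of the abstract results to the Fourier transform and the operator [WH] *)

Section fourier_instance.
Context (R : realType).
Local Notation mu := (@lebesgue_measure R).
Local Notation V := (L2 mu).
Local Notation F := (@fourier R : V -> V).
Local Notation Fi := (@fourier_inv R : V -> V).
Local Notation J := (@reflection R : V -> V).

Let kV : ((kap R)^-1)%:C * (kap R)%:C = 1 :> R[i].
Proof. by rewrite -rmorphM mulVf // gt_eqF // kap_gt0. Qed.

Lemma bop_fourier_inv : bop Fi.
Proof.
have h := bop_scale ((kap R)^-1)%:C (bop_comp (@bop_fourier R) (@bop_reflection R)).
have e : Fi = fun g : V => ((kap R)^-1)%:C *: J (F g) by apply/funext => g; exact: fourier_invE.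
by rewrite e.
Qed.

Lemma fourier_invK (u : V) : Fi (F u) = u.
Proof.
have h1 := fourier_invE (F u); have h2 := fourier_fourier u.
by rewrite h1 h2 scalerA kV scale1r.
Qed.

Lemma fourierK (g : V) : F (Fi g) = g.
Proof.
have h1 := fourier_invE g; have h2 := bopZ ((kap R)^-1)%:C (J (F g)) (@bop_fourier R).
have h3 := fourier_reflection (F g); have h4 := fourier_fourier g.
by rewrite h1 h2 h3 h4 scalerA kV scale1r.
Qed.

Definition wh (phi : R -> R[i]) (u : V) : V := fmult F Fi phi (u + J u).

Lemma bop_wh phi : ebounded mu phi -> bop (wh phi).
Proof.
move=> bp; have bM := bop_fmult (@bop_fourier R) bop_fourier_inv bp.
exact: bop_comp (bop_add (@bop_id R V) (@bop_reflection R)) bM.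
Qed.

Lemma WHE phi (u : L2_plus R) : ebounded mu phi -> WH phi u = restriction (wh phi (val u)).
Proof.
move=> bp; have bM := bop_fmult (@bop_fourier R) bop_fourier_inv bp.
by rewrite /wh (bopD _ _ bM) (bopD _ _ (@bop_restriction R)).
Qed.

Let zeroV (T : V -> V) := forall x, T x = 0.

Section transfer.
Variable phi : R -> R[i].
Hypothesis bp : ebounded mu phi.
Let bW := bop_half (bop_wh bp) (fun u => WHE u bp).

Lemma WH_bounded : bounded_linear (WH phi).
Proof. exact: bop_bounded_linear bW. Qed.

Lemma WH_left_inverse : half_left F Fi J zeroV phi ->
  exists S, bounded_linear S /\ cancel (WH phi) S.
Proof.
move=> [L [k [bL k0 h]]].
have [S bS hS] := half_left_inverse (fun u => WHE u bp) bL k0 h.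
by exists S; split => //; exact: bop_bounded_linear.
Qed.

Lemma WH_right_inverse : half_right F Fi J zeroV phi ->
  exists S, bounded_linear S /\ cancel S (WH phi).
Proof.
move=> [L [k [bL k0 PL h]]].
have [S bS hS] := half_right_inverse (fun u => WHE u bp) bL k0 PL h.
by exists S; split => //; exact: bop_bounded_linear.
Qed.

Lemma WH_left_fredholm : half_left F Fi J (@appx R V V) phi -> left_fredholm (WH phi).
Proof.
by move=> [L [k [bL ak h]]]; exact: (half_left_fredholm (bop_wh bp) (fun u => WHE u bp) bL ak h).
Qed.

Lemma WH_right_fredholm : half_right F Fi J (@appx R V V) phi -> right_fredholm (WH phi).
Proof.
by move=> [L [k [bL ak PL h]]]; exact: (half_right_fredholm (bop_wh bp) (fun u => WHE u bp) bL ak PL h).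
Qed.

End transfer.

Let bF := @bop_fourier R.
Let bFi := bop_fourier_inv.
Let bJ := @bop_reflection R.
Let FJ := @fourier_reflection R.
Let JE := @reflectionE R.
Let JJ := @reflectionK R.
Let dF := @dot_fourier2 R.
Let nF := @nrm_fourier R.
Let Fc := @fourier_chi R.
Let Fe := @fourier_etr R.

Definition case_inverse := inverse_of_Hinf bF bFi bJ fourier_invK fourierK FJ JE dF nF Fc JJ.
Definition case_left := left_of_Hinf bF bFi bJ fourier_invK fourierK FJ JE dF nF Fc JJ.
Definition case_right := right_of_Hinf bF bFi bJ fourier_invK fourierK FJ JE dF nF Fc JJ.
Definition case_fredholm := both_of_CdotDHinf bF bFi bJ fourier_invK fourierK FJ JE dF nF Fc JJ Fe.
Definition case_left_fredholm := left_of_CdotDHinf bF bFi bJ fourier_invK fourierK FJ JE dF nF Fc JJ Fe.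
Definition case_right_fredholm := right_of_CdotDHinf bF bFi bJ fourier_invK fourierK FJ JE dF nF Fc JJ Fe.

End fourier_instance.

Theorem corollary4p6 (R : realType) (phi : R -> R[i])
  (Gphi : units (@Linf R) phi) :
  (* (a) *)
  (forall (sg : half_plane) (s h : R -> R[i]),
      sectorial s -> units (Hinf sg) h ->
      eq_ae (refl_quot phi) (fun x => s x * h x) ->
      invertible (WH phi)) /\
  (* (b) *)
  (forall s h : R -> R[i],
      sectorial s -> Hinf upper h ->
      eq_ae (refl_quot phi) (fun x => s x * h x) ->
      left_invertible (WH phi)) /\
  (* (c) *)
  (forall s h : R -> R[i],
      sectorial s -> Hinf lower h ->
      eq_ae (refl_quot phi) (fun x => s x * h x) ->
      right_invertible (WH phi)) /\
  (* (d) *)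
  (forall (sg : half_plane) (s h1 h2 : R -> R[i]),
      sectorial s -> units (CdotDHinf sg) h1 -> units (Hinf sg) h2 ->
      eq_ae (refl_quot phi) (fun x => s x * h1 x * h2 x) ->
      fredholm (WH phi)) /\
  (* (e) *)
  (forall s h1 h2 : R -> R[i],
      sectorial s -> CdotDHinf upper h1 -> units (Hinf upper) h2 ->
      eq_ae (refl_quot phi) (fun x => s x * h1 x * h2 x) ->
      left_fredholm (WH phi)) /\
  (* (f) *)
  (forall s h1 h2 : R -> R[i],
      sectorial s -> CdotDHinf lower h1 -> units (Hinf lower) h2 ->
      eq_ae (refl_quot phi) (fun x => s x * h1 x * h2 x) ->
      right_fredholm (WH phi)).
Proof.
have bp : ebounded (@lebesgue_measure R) phi by case: Gphi => /Linf_ebounded.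
have bl := WH_bounded bp.
split; [|split; [|split; [|split; [|split]]]].
- move=> sg s h ss hh e; have [hl hr] := case_inverse Gphi ss hh e.
  have [S [bS KS]] := WH_left_inverse bp hl; have [T [bT KT]] := WH_right_inverse bp hr.
  split; first exact: bl.
  exists S; split; [exact: bS|exact: KS|move=> y].
  (* A left and a right inverse coincide: apply S to y written as the image of T y. *)
  have ST : S y = T y := etrans (congr1 S (esym (KT y))) (KS (T y)).
  by rewrite ST; exact: KT.
- move=> s h ss hh e; split; first exact: bl.
  exact: (WH_left_inverse bp (case_left Gphi ss hh e)).
- move=> s h ss hh e; split; first exact: bl.
  exact: (WH_right_inverse bp (case_right Gphi ss hh e)).
- move=> sg s h1 h2 ss u1 u2 e; have [hl hr] := case_fredholm Gphi ss e u1 u2.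
  have [ns fk] := WH_left_fredholm bp hl; have [_ fc] := WH_right_fredholm bp hr.
  split; [exact: ns|exact: fk|exact: fc].
- move=> s h1 h2 ss u1 [u2 _] e.
  exact: (WH_left_fredholm bp (case_left_fredholm Gphi ss e u1 u2)).
- move=> s h1 h2 ss u1 [u2 _] e.
  exact: (WH_right_fredholm bp (case_right_fredholm Gphi ss e u1 u2)).
Qed.
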